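(* Let $S(\Gamma_{\mathbf Q})$ be the étale $\mathbf Q$-species associated to the $\mathbf Q$-rational cyclic quiver. There is an equivalence of categories \[ \mathrm{HC}_0(\mathfrak g,K)_{\mathbf Q}\simeq\operatorname{Rep}^{\rm nil}(S(\Gamma_{\mathbf Q})). \]
   Context: Let $F=\mathbf Q[\sqrt{-1}]$ with complex conjugation $a\mapsto\bar a$. **Harish-Chandra modules.** Let $\mathfrak g_{\mathbf Q}=\mathfrak{sl}_{2,\mathbf Q}$ and $K_{\mathbf Q}=\mathrm{SO}(2)_{\mathbf Q}=\operatorname{Spec}\mathbf Q[x,y]/(x^2+y^2-1)$, the point $(x,y)$ corresponding to $\begin{pmatrix} x & -y \\ y & x \end{pmatrix}$. A $(\mathfrak g,K)$-module over $\mathbf Q$ is a $\mathbf Q$-vector space $M_{\mathbf Q}$ which is a rational (algebraic, locally finite) representation of $K_{\mathbf Q}$ with a $\mathbf Q$-linear action of $\mathfrak g_{\mathbf Q}$ which is $K_{\mathbf Q}$-equivariant for the adjoint action and restricts on $\operatorname{Lie}K_{\mathbf Q}$ to the differential of the $K_{\mathbf Q}$-action. It is a Harish-Chandra module if it is finitely generated over $U(\mathfrak g_{\mathbf Q})$ and admissible, i.e. every isotypic component of $F\otimes_{\mathbf Q}M_{\mathbf Q}$ for a character of $\mathrm{SO}(2)_F$ is finite-dimensional. Let $C=H^2-2H+4XY+1$ with $H=\begin{pmatrix} 0 & -\sqrt{-1} \\ \sqrt{-1} & 0 \end{pmatrix}$, $X=\tfrac12\begin{pmatrix} 1 & \sqrt{-1}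 \\ \sqrt{-1} & -1 \end{pmatrix}$, $Y=\tfrac12\begin{pmatrix} 1 & -\sqrt{-1} \\ -\sqrt{-1} & -1 \end{pmatrix}$; $C$ lies in $U(\mathfrak g_{\mathbf Q})$. $\mathrm{HC}_0(\mathfrak g,K)_{\mathbf Q}$ is the full subcategory of Harish-Chandra modules over $\mathbf Q$ with $C^mM_{\mathbf Q}=0$ for some $m\ge0$ on which $-1_2\in\mathrm{SO}(2)$ acts as $-1$. **Species.** The $\mathbf Q$-rational cyclic quiver has vertices $\pm$, arrows $a\colon-\to+$, $b\colon+\to-$, with the non-trivial element of $\operatorname{Gal}(F/\mathbf Q)$ exchanging $+\leftrightarrow-$ and $a\leftrightarrow b$. Its associated étale $\mathbf Q$-species $S(\Gamma_{\mathbf Q})$ has one vertex, with field $F$, and one $F,F$-bimodule $F^{\rm twisted}$, which is $F$ with left action $a\cdot m=am$ and right action $m\cdot a=m\bar a$. A (finite-dimensional) representation is a finite-dimensional right $F$-vector space $W$ with a right $F$-linear map $f\colon W\otimes_FF^{\rm twisted}\to W$; morphisms are $F$-linear maps commuting with the structure maps $f$. It is nilpotent if for some $n\ge1$ the $n$-fold iterate $W\otimes_F(F^{\rm twisted})^{\otimes_F n}\to W$ of $f$ is zero. $\operatorname{Rep}^{\rm nil}(S(\Gamma_{\mathbf Q}))$ is the category of nilpotent finite-dimensional representations. *)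

(* Defs.v *)
From HB Require Import structures.
From mathcomp Require Import all_boot all_order all_algebra.
From mathcomp Require Import boolp complex qpoly ring.

Set Implicit Arguments.
Unset Strict Implicit.
Unset Printing Implicit Defensive.

Import GRing.Theory.
Local Open Scope ring_scope.
Local Open Scope quotient_scope.

Record category := Category {
  obj :> Type;
  hom : obj -> obj -> Type;
  idm : forall a, hom a a;
  cmp : forall a b c, hom b c -> hom a b -> hom a c;
  cmp1m : forall a b (f : hom a b), cmp (idm b) f = f;
  cmpm1 : forall a b (f : hom a b), cmp f (idm a) = f;
  cmpA : forall a b c d (h : hom c d) (g : hom b c) (f : hom a b),
    cmp h (cmp g f) = cmp (cmp h g) f }.

Record functor (C D : category) := Functor {
  fobj :> C -> D;
  fmor : forall a b : C, hom a b -> hom (fobj a) (fobj b);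
  fmor1 : forall a : C, fmor (idm a) = idm (fobj a);
  fmorM : forall (a b c : C) (g : hom b c) (f : hom a b),
    fmor (cmp g f) = cmp (fmor g) (fmor f) }.

Section FunctorOps.
Variables C D E : category.

Definition idF : functor C C :=
  @Functor C C (fun a => a) (fun a b f => f) (fun a => erefl)
    (fun a b c g f => erefl).

Variables (G : functor D E) (F : functor C D).

Let compF1 (a : C) : fmor G (fmor F (idm a)) = idm (G (F a)).
Proof. by rewrite !fmor1. Qed.

Let compFM (a b c : C) (g : hom b c) (f : hom a b) :
  fmor G (fmor F (cmp g f)) = cmp (fmor G (fmor F g)) (fmor G (fmor F f)).
Proof. by rewrite !fmorM. Qed.

Definition compF : functor C E :=
  @Functor C E (fun a => G (F a)) (fun a b f => fmor G (fmor F f)) compF1 compFM.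

End FunctorOps.

Definition is_iso (C : category) (a b : C) (f : hom a b) : Prop :=
  exists g : hom b a, cmp g f = idm a /\ cmp f g = idm b.

Definition nat_isomorphic (C D : category) (F G : functor C D) : Prop :=
  exists eta : forall a, hom (F a) (G a),
    (forall a, is_iso (eta a)) /\
    (forall a b (f : hom a b), cmp (eta b) (fmor F f) = cmp (fmor G f) (eta a)).

Definition equivalent_categories (C D : category) : Prop :=
  exists (F : functor C D) (G : functor D C),
    nat_isomorphic (compF G F) (idF C) /\ nat_isomorphic (compF F G) (idF D).

Definition full_subcategory (C : category) (P : C -> Prop) : category :=
  @Category {a : C | P a} (fun a b => hom (sval a) (sval b))
    (fun a => idm (sval a)) (fun a b c g f => cmp g f)
    (fun a b f => cmp1m f) (fun a b f => cmpm1 f)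
    (fun a b c d h g f => cmpA h g f).

(* An (R, S)-bimodule for commutative R and S: [lact] is the left action of R,
   and [s *: b] stands for the right action b . s of S.  In the same way a right
   module over a commutative ring is written as an [lmodType]. *)
Record bimodule (R S : comNzRingType) := Bimodule {
  bimod_sort :> lmodType S;
  lact : R -> bimod_sort -> bimod_sort;
  lact1 : forall b, lact 1 b = b;
  lactM : forall r r' b, lact (r * r') b = lact r (lact r' b);
  lactDl : forall r r' b, lact (r + r') b = lact r b + lact r' b;
  lactDr : forall r b b', lact r (b + b') = lact r b + lact r b';
  lactZ : forall r s b, lact r (s *: b) = s *: lact r b }.

(* The tensor product over R of a right R-module W with an (R, S)-bimodule B:
   formal sums of pure tensors, i.e. lists of pairs, modulo the congruence
   generated by the usual relations.  No formal opposites are needed because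
   - (w (x) b) = (- w) (x) b. *)
Section Tensor.
Variables (R S : comNzRingType) (W : lmodType R) (B : bimodule R S).

Inductive tens_eq : seq (W * B) -> seq (W * B) -> Prop :=
| TensRefl s : tens_eq s s
| TensSym s t : tens_eq s t -> tens_eq t s
| TensTrans s t u : tens_eq s t -> tens_eq t u -> tens_eq s u
| TensCat s s' t t' : tens_eq s s' -> tens_eq t t' -> tens_eq (s ++ t) (s' ++ t')
| TensC s t : tens_eq (s ++ t) (t ++ s)
| TensDl w w' b : tens_eq [:: (w + w', b)] [:: (w, b); (w', b)]
| TensDr w b b' : tens_eq [:: (w, b + b')] [:: (w, b); (w, b')]
| TensBal w r b : tens_eq [:: (r *: w, b)] [:: (w, lact r b)]
| Tens0 b : tens_eq [:: (0, b)] [::].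

Definition tens_eqb : rel (seq (W * B)) := fun s t => `[< tens_eq s t >].

Let tens_eqb_refl : reflexive tens_eqb.
Proof. by move=> s; apply/asboolP; exact: TensRefl. Qed.

Let tens_eqb_sym : symmetric tens_eqb.
Proof. by move=> s t; apply/asboolP/asboolP; exact: TensSym. Qed.

Let tens_eqb_trans : transitive tens_eqb.
Proof.
by move=> t s u /asboolP st /asboolP tu; apply/asboolP; exact: TensTrans st tu.
Qed.

Canonical tens_equiv := EquivRel tens_eqb tens_eqb_refl tens_eqb_sym tens_eqb_trans.

Definition tens := {eq_quot tens_equiv}.

HB.instance Definition _ := Choice.on tens.

Definition tens_class (s : seq (W * B)) : tens := \pi_tens s.

Definition ptens (w : W) (b : B) : tens := tens_class [:: (w, b)].

Lemma tens_classP s t : tens_class s = tens_class t <-> tens_eq s t.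
Proof.
split=> [/eqmodP /asboolP //|st]; by apply/eqmodP/asboolP.
Qed.

Lemma tens_classK (t : tens) : tens_class (repr t) = t.
Proof. exact: reprK. Qed.

Lemma tens_reprP s : tens_eq (repr (tens_class s)) s.
Proof. by apply/tens_classP; rewrite tens_classK. Qed.

Definition tens_opp_seq (s : seq (W * B)) := [seq (- p.1, p.2) | p <- s].
Definition tens_scale_seq (c : S) (s : seq (W * B)) := [seq (p.1, c *: p.2) | p <- s].

Definition tens_zero : tens := tens_class [::].
Definition tens_add (t u : tens) : tens := tens_class (repr t ++ repr u).
Definition tens_opp (t : tens) : tens := tens_class (tens_opp_seq (repr t)).
Definition tens_scale (c : S) (t : tens) : tens :=
  tens_class (tens_scale_seq c (repr t)).

Let tens_eq_opp s t : tens_eq s t -> tens_eq (tens_opp_seq s) (tens_opp_seq t).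
Proof.
elim=> {s t} [s|s t _|s t u _ + _|s s' t t' _ + _|s t|w w' b|w b b'|w r b|b] /=.
- exact: TensRefl.
- exact: TensSym.
- exact: TensTrans.
- by rewrite /tens_opp_seq !map_cat; exact: TensCat.
- by rewrite /tens_opp_seq !map_cat; exact: TensC.
- by rewrite opprD; exact: TensDl.
- exact: TensDr.
- by rewrite -scalerN; exact: TensBal.
- by rewrite oppr0; exact: Tens0.
Qed.

Let tens_eq_scale c s t :
  tens_eq s t -> tens_eq (tens_scale_seq c s) (tens_scale_seq c t).
Proof.
elim=> {s t} [s|s t _|s t u _ + _|s s' t t' _ + _|s t|w w' b|w b b'|w r b|b] /=.
- exact: TensRefl.
- exact: TensSym.
- exact: TensTrans.
- by rewrite /tens_scale_seq !map_cat; exact: TensCat.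
- by rewrite /tens_scale_seq !map_cat; exact: TensC.
- exact: TensDl.
- by rewrite scalerDr; exact: TensDr.
- by rewrite -lactZ; exact: TensBal.
- exact: Tens0.
Qed.

Let addE s t : tens_add (tens_class s) (tens_class t) = tens_class (s ++ t).
Proof. by apply/tens_classP; apply: TensCat; exact: tens_reprP. Qed.

Let oppE s : tens_opp (tens_class s) = tens_class (tens_opp_seq s).
Proof. by apply/tens_classP; apply: tens_eq_opp; exact: tens_reprP. Qed.

Let scaleE c s : tens_scale c (tens_class s) = tens_class (tens_scale_seq c s).
Proof. by apply/tens_classP; apply: tens_eq_scale; exact: tens_reprP. Qed.

Let tens_addA : associative tens_add.
Proof.
move=> t u v.
by rewrite -(tens_classK t) -(tens_classK u) -(tens_classK v) !addE catA.
Qed.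

Let tens_addC : commutative tens_add.
Proof.
move=> t u; rewrite -(tens_classK t) -(tens_classK u) !addE.
by apply/tens_classP; exact: TensC.
Qed.

Let tens_add0 : left_id tens_zero tens_add.
Proof. by move=> t; rewrite -(tens_classK t) addE. Qed.

Let tens_addN : left_inverse tens_zero tens_opp tens_add.
Proof.
move=> t; rewrite -(tens_classK t) oppE addE; apply/tens_classP.
elim: (repr t) => [|[w b] s /tens_classP IHs]; first exact: TensRefl.
apply/tens_classP.
rewrite -[tens_opp_seq _ ++ _]/([:: (- w, b)] ++ (tens_opp_seq s ++ ([:: (w, b)] ++ s))).
rewrite -!addE [X in tens_add _ X]tens_addA.
rewrite [X in tens_add _ (tens_add X _)]tens_addC -tens_addA tens_addA !addE.
rewrite -addE IHs addE cats0; apply/tens_classP.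
apply: TensTrans (TensSym (TensDl _ _ _)) _.
by rewrite addNr; exact: Tens0.
Qed.

HB.instance Definition _ :=
  GRing.isZmodule.Build tens tens_addA tens_addC tens_add0 tens_addN.

Lemma tens_classD s t : tens_class (s ++ t) = tens_class s + tens_class t.
Proof. by rewrite -addE. Qed.

Lemma tens_class0 : tens_class [::] = 0.
Proof. by []. Qed.

Let tens_scaleA a b t : tens_scale a (tens_scale b t) = tens_scale (a * b) t.
Proof.
rewrite -(tens_classK t) !scaleE /tens_scale_seq -map_comp.
by congr tens_class; apply: eq_map => -[w c] /=; rewrite scalerA.
Qed.

Let tens_scale1 : left_id 1 tens_scale.
Proof.
move=> t; rewrite -{2}(tens_classK t) -(tens_classK t) scaleE tens_classK.
congr tens_class; rewrite -[RHS]map_id; apply: eq_map => -[w c] /=.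
by rewrite scale1r.
Qed.

Let tens_scaleDr : right_distributive tens_scale +%R.
Proof.
move=> c t u; rewrite -(tens_classK t) -(tens_classK u) -tens_classD !scaleE.
by rewrite /tens_scale_seq map_cat tens_classD.
Qed.

Let tens_scaleDl t : {morph tens_scale^~ t : a b / a + b}.
Proof.
move=> a c /=; rewrite -(tens_classK t) !scaleE.
elim: (repr t) => [|[w b] s IHs]; first by rewrite -tens_classD.
have consE d : tens_scale_seq d ((w, b) :: s) = [:: (w, d *: b)] ++ tens_scale_seq d s.
  by [].
rewrite !consE !tens_classD IHs addrACA; congr (_ + _).
rewrite -tens_classD; apply/tens_classP; rewrite scalerDl; exact: TensDr.
Qed.

HB.instance Definition _ :=
  GRing.Zmodule_isLmodule.Build S tens tens_scaleA tens_scale1 tens_scaleDr tens_scaleDl.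

Lemma ptensDl w w' b : ptens (w + w') b = ptens w b + ptens w' b.
Proof. by rewrite -tens_classD; apply/tens_classP; exact: TensDl. Qed.

Lemma ptensDr w b b' : ptens w (b + b') = ptens w b + ptens w b'.
Proof. by rewrite -tens_classD; apply/tens_classP; exact: TensDr. Qed.

Lemma ptens_bal w r b : ptens (r *: w) b = ptens w (lact r b).
Proof. by apply/tens_classP; exact: TensBal. Qed.

Lemma ptensZ c w b : c *: ptens w b = ptens w (c *: b).
Proof. exact: scaleE. Qed.

Lemma tens_ind (P : tens -> Prop) : P 0 -> (forall t u, P t -> P u -> P (t + u)) ->
  (forall w b, P (ptens w b)) -> forall t, P t.
Proof.
move=> P0 PD Pp t; rewrite -(tens_classK t).
elim: (repr t) => [|[w b] s IHs]; first exact: P0.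
rewrite -cat1s tens_classD; apply: PD; [exact: Pp|exact: IHs].
Qed.

(* The map w (x) b |-> beta w b, meaningful when beta is balanced. *)
Section Lift.
Variables (V : zmodType) (beta : W -> B -> V).

Definition tens_lift (t : tens) : V := \sum_(p <- repr t) beta p.1 p.2.

Definition balanced := [/\
  forall w w' b, beta (w + w') b = beta w b + beta w' b,
  forall w b b', beta w (b + b') = beta w b + beta w b' &
  forall r w b, beta (r *: w) b = beta w (lact r b)].

Hypothesis beta_bal : balanced.

Lemma tens_lift_class s : tens_lift (tens_class s) = \sum_(p <- s) beta p.1 p.2.
Proof.
case: beta_bal => bDl bDr bbal.
have b0 b : beta 0 b = 0 by apply: (addrI (beta 0 b)); rewrite -bDl !addr0.
suff E t u : tens_eq t u ->
    \sum_(p <- t) beta p.1 p.2 = \sum_(p <- u) beta p.1 p.2.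
  by apply: E; exact: tens_reprP.
elim=> {s t u} [s|s t _|s t u _ + _|s s' t t' _ + _|s t|w w' b|w b b'|w r b|b] //=.
- by move=> -> ->.
- by rewrite !big_cat /= => -> ->.
- by rewrite !big_cat /= addrC.
- by rewrite !big_cons !big_nil /= !addr0 bDl.
- by rewrite !big_cons !big_nil /= !addr0 bDr.
- by rewrite !big_cons !big_nil /= !addr0 bbal.
- by rewrite big_cons !big_nil /= addr0 b0.
Qed.

Lemma tens_liftE w b : tens_lift (ptens w b) = beta w b.
Proof. by rewrite tens_lift_class big_seq1. Qed.

Lemma tens_liftD t u : tens_lift (t + u) = tens_lift t + tens_lift u.
Proof.
rewrite -(tens_classK t) -(tens_classK u) -tens_classD !tens_lift_class.
by rewrite big_cat.
Qed.

End Lift.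
End Tensor.

Arguments ptens {R S W B}.

Definition tens_map (R S : comNzRingType) (W W' : lmodType R) (B : bimodule R S)
    (f : W -> W') : tens W B -> tens W' B :=
  tens_lift (fun w b => ptens (f w) b).
Arguments tens_map {R S W W'} B f.

Section Scalars.
Variable A : comAlgType rat.

Let scal_act (q : rat) (a : A^o) : A^o := q *: (a : A).

Let scal_actZ q (s : A) (a : A^o) : scal_act q (s *: a) = s *: scal_act q a.
Proof. exact: (scalerAr q s (a : A)). Qed.

(* A as a (Q, A)-bimodule *)
Definition scalars : bimodule rat A :=
  @Bimodule rat A A^o scal_act
    (fun a => scale1r (a : A)) (fun q r a => esym (scalerA q r (a : A)))
    (fun q r a => scalerDl (a : A) q r) (fun q a b => scalerDr q (a : A) b)
    scal_actZ.

End Scalars.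

Definition base_change (M : lmodType rat) (A : comAlgType rat) : lmodType A :=
  tens M (scalars A).

Definition btens (M : lmodType rat) (A : comAlgType rat) (m : M) (a : A) :
  base_change M A := @ptens rat A M (scalars A) m a.

Definition base_change_map (M : lmodType rat) (A A' : comAlgType rat) (phi : A -> A') :
  base_change M A -> base_change M A' :=
  @tens_lift rat A M (scalars A) (base_change M A') (fun m a => btens m (phi a)).

Notation Qi := (Rcomplex rat).
Definition sqrtm1 : Qi := Complex 0 1.

HB.instance Definition _ := GRing.Lalgebra_isComAlgebra.Build rat Qi.

Section Sl2.
Variable A : comNzRingType.

Definition mx22 (a b c d : A) : 'M[A]_2 :=
  \matrix_(i, j) if i == 0 then (if j == 0 then a else b)
                 else (if j == 0 then c else d).

Definition traceless_pred : pred 'M[A]_2 := fun Z => \tr Z == 0.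
Definition traceless := [qualify a Z | traceless_pred Z].

Fact traceless_submod_closed : submod_closed traceless.
Proof.
split=> [|a Z Z' /eqP trZ /eqP trZ']; rewrite qualifE /traceless_pred ?mxtrace0 //.
by rewrite mxtraceD mxtraceZ trZ trZ' mulr0 addr0.
Qed.

HB.instance Definition _ :=
  GRing.isSubmodClosed.Build A 'M[A]_2 traceless_pred traceless_submod_closed.

Record sl2 := Sl2 { sl2_mx :> 'M[A]_2; _ : sl2_mx \is a traceless }.

HB.instance Definition _ := [isSub for sl2_mx].
HB.instance Definition _ := [Choice of sl2 by <:].
HB.instance Definition _ := [SubChoice_isSubLmodule of sl2 by <:].

Fact sl2_bracket_subproof (Z Z' : sl2) : Z *m Z' - Z' *m Z \is a traceless.
Proof.
by rewrite qualifE /traceless_pred raddfB /= mxtrace_mulC subrr.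
Qed.

Definition bracket (Z Z' : sl2) : sl2 := Sl2 (sl2_bracket_subproof Z Z').

Fact mk_sl2_subproof a b c : mx22 a b c (- a) \is a traceless.
Proof.
by rewrite qualifE /traceless_pred /mxtrace !big_ord_recl big_ord0 !mxE /= addr0 subrr.
Qed.

(* the matrix (a b; c -a) *)
Definition mk_sl2 (a b c : A) : sl2 := Sl2 (mk_sl2_subproof a b c).

(* Expressions for the elements of the enveloping algebra U(sl_2): U(sl_2) is the
   free associative algebra on sl_2 modulo relations which hold in every
   sl_2-module, so that it acts on a module by evaluation of expressions. *)
Inductive U_expr :=
| UScal of A
| UGen of sl2
| UAdd of U_expr & U_expr
| UMul of U_expr & U_expr.

Fixpoint U_act (V : lmodType A) (rho : sl2 -> V -> V) (u : U_expr) (v : V) : V :=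
  match u with
  | UScal a => a *: v
  | UGen Z => rho Z v
  | UAdd u1 u2 => U_act rho u1 v + U_act rho u2 v
  | UMul u1 u2 => U_act rho u1 (U_act rho u2 v)
  end.

End Sl2.

(* The action of sl_2(A) = A (x) sl_2(Q) on A (x) M induced by an action on M,
   written out in the basis (1 0; 0 -1), (0 1; 0 0), (0 0; 1 0). *)
Definition base_change_act (M : lmodType rat) (rho : sl2 rat -> M -> M)
    (A : comAlgType rat) (Z : sl2 A) (v : base_change M A) : base_change M A :=
    Z 0 0 *: tens_map (scalars A) (rho (mk_sl2 1 0 0)) v
  + Z 0 1 *: tens_map (scalars A) (rho (mk_sl2 0 1 0)) v
  + Z 1 0 *: tens_map (scalars A) (rho (mk_sl2 0 0 1)) v.

Section SO2.
Variable A : comNzRingType.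

(* the A-points of Spec Q[x, y] / (x^2 + y^2 - 1) *)
Record so2 := SO2 { so2_pt :> A * A; _ : so2_pt.1 ^+ 2 + so2_pt.2 ^+ 2 == 1 }.

HB.instance Definition _ := [isSub for so2_pt].

Definition so2_mx (k : so2) : 'M[A]_2 := mx22 k.1 (- k.2) k.2 k.1.

Fact so2_one_subproof : (1 : A) ^+ 2 + (0 : A) ^+ 2 == 1.
Proof. by rewrite expr1n expr0n addr0. Qed.
Definition so2_one : so2 := @SO2 (1, 0) so2_one_subproof.

Fact so2_opp_one_subproof : (-1 : A) ^+ 2 + (0 : A) ^+ 2 == 1.
Proof. by rewrite sqrrN expr1n expr0n addr0. Qed.
Definition so2_opp_one : so2 := @SO2 (-1, 0) so2_opp_one_subproof.

Definition so2_mul_pt (k l : so2) := (k.1 * l.1 - k.2 * l.2, k.1 * l.2 + k.2 * l.1).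

Fact so2_mul_subproof k l : (so2_mul_pt k l).1 ^+ 2 + (so2_mul_pt k l).2 ^+ 2 == 1.
Proof.
case: k l => -[x y] /= /eqP Ek [[z t] /= /eqP El]; apply/eqP.
by rewrite /so2_mul_pt /= -[RHS]mulr1 -{1}Ek -El; ring.
Qed.
Definition so2_mul (k l : so2) : so2 := SO2 (so2_mul_subproof k l).

Fact so2_inv_subproof (k : so2) : k.1 ^+ 2 + (- k.2) ^+ 2 == 1.
Proof. by rewrite /= sqrrN; case: k. Qed.
Definition so2_inv (k : so2) : so2 := @SO2 (k.1, - k.2) (so2_inv_subproof k).

Fact so2_Ad_subproof (k : so2) (Z : sl2 A) :
  so2_mx k *m Z *m so2_mx (so2_inv k) \is a traceless A.
Proof.
have Ek : so2_mx (so2_inv k) *m so2_mx k = 1%:M.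
  have Ek : k.1 ^+ 2 + k.2 ^+ 2 = 1 by apply/eqP; case: (k).
  apply/matrixP => i j.
  rewrite !mxE !big_ord_recl big_ord0 !mxE /= addr0.
  case: i j => [[|[|//]] ?] [[|[|//]] ?] //=; rewrite -?[1%:R]Ek /=; ring.
by rewrite qualifE /traceless_pred mxtrace_mulC mulmxA Ek mul1mx; case: Z.
Qed.
Definition so2_Ad (k : so2) (Z : sl2 A) : sl2 A := Sl2 (so2_Ad_subproof k Z).

End SO2.

Arguments so2_one {A}.
Arguments so2_opp_one {A}.

Section SO2Map.
Variables (A B : comNzRingType) (phi : {rmorphism A -> B}).

Fact so2_map_subproof (k : so2 A) :
  phi k.1 ^+ 2 + phi k.2 ^+ 2 == 1.
Proof. by case: k => k /= /eqP Ek; rewrite -!rmorphXn -rmorphD Ek rmorph1. Qed.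
Definition so2_map (k : so2 A) : so2 B := @SO2 B (phi k.1, phi k.2) (so2_map_subproof k).

End SO2Map.

(* The dual numbers Q[eps]; Lie(SO(2)) consists of the points 1 + t eps J. *)
Notation dualQ := {poly %/ ('X^2 : {poly rat})}.
Definition eps : dualQ := 'qX.

Fact so2_tangent_subproof (t : rat) :
  (1 : dualQ) ^+ 2 + (t *: eps) ^+ 2 == 1.
Proof.
have eps2 : eps ^+ 2 = 0.
  have lt2 : (2 < size ('X^2 : {poly rat}))%N by rewrite size_polyXn.
  apply: val_inj; apply: etrans (poly_of_qpolyX _ _) _.
  rewrite /eps qpolyXE ?monicXn //.
  have X2 : Pdiv.CommonRing.rmodp 'X^2 'X^2 = 0 :> {poly rat}.
    by rewrite Pdiv.RingMonic.rmodpp ?monicXn.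
  by apply: etrans X2; congr Pdiv.CommonRing.rmodp; exact: mk_monic_Xn.
by rewrite /= expr1n exprZn eps2 scaler0 addr0.
Qed.
Definition so2_tangent (t : rat) : so2 dualQ := @SO2 dualQ (1, t *: eps) (so2_tangent_subproof t).

Definition sl2_J : sl2 rat := mk_sl2 0 (-1) 1.

(* The algebraic representation of K is given as a representation of the group
   functor: K(A) acts A-linearly on A (x) M, functorially in the commutative
   Q-algebra A.  This amounts to an O(K)-comodule structure on M; in particular
   local finiteness is automatic. *)
Record gK_module := GKModule {
  gK_sort :> lmodType rat;
  gact : sl2 rat -> gK_sort -> gK_sort;
  kact : forall A : comAlgType rat,
    so2 A -> base_change gK_sort A -> base_change gK_sort A;
  gact_linearl : forall m, linear (gact^~ m);
  gact_linear : forall Z, linear (gact Z);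
  gact_bracket : forall Z Z' m,
    gact (bracket Z Z') m = gact Z (gact Z' m) - gact Z' (gact Z m);
  kact_linear : forall (A : comAlgType rat) (k : so2 A), linear (kact k);
  kact1 : forall (A : comAlgType rat) (v : base_change gK_sort A), kact so2_one v = v;
  kactM : forall (A : comAlgType rat) (k l : so2 A) v, kact (so2_mul k l) v = kact k (kact l v);
  kact_natural : forall (A B : comAlgType rat) (phi : {lrmorphism A -> B}) k v,
    kact (so2_map phi k) (base_change_map phi v) = base_change_map phi (kact k v);
  kact_gact : forall (A : comAlgType rat) (k : so2 A) Z v,
    kact k (base_change_act gact Z v) = base_change_act gact (so2_Ad k Z) (kact k v);
  kact_differential : forall t m,
    kact (so2_tangent t) (btens m 1) = btens m 1 + btens (gact (t *: sl2_J) m) eps }.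

Definition is_gK_hom (M N : gK_module) (f : M -> N) : Prop :=
  (forall Z m, f (gact Z m) = gact Z (f m)) /\
  (forall (A : comAlgType rat) (k : so2 A) v,
     tens_map (scalars A) f (kact k v) = kact k (tens_map (scalars A) f v)).

Record gK_hom (M N : gK_module) := GKHom {
  gK_fun :> {linear M -> N};
  gK_funP : is_gK_hom gK_fun }.

Lemma linear_ext (R : nzRingType) (V W : lmodType R) (f g : {linear V -> W}) :
  f =1 g -> f = g.
Proof.
case: f g => f [[A] [C]] [g [[A'] [C']]] /= /funext E; rewrite /= in E; subst g.
by congr (GRing.Linear.Pack (GRing.Linear.Class _ _));
  [congr GRing.isNmodMorphism.Axioms_|congr GRing.isScalable.Axioms_];
  exact: Prop_irrelevance.
Qed.

Lemma gK_hom_ext M N (f g : gK_hom M N) : f =1 g -> f = g.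
Proof.
case: f g => f fP [g gP] /= /linear_ext E; subst g.
by congr GKHom; exact: Prop_irrelevance.
Qed.

Section TensMapComp.
Variables (R S : comNzRingType) (B : bimodule R S).

Lemma tens_mapE (W W' : lmodType R) (f : {linear W -> W'}) w b :
  tens_map B f (ptens w b) = ptens (f w) b.
Proof.
rewrite /tens_map tens_liftE //; split=> [u u' c|u c c'|r u c].
- by rewrite linearD ptensDl.
- by rewrite ptensDr.
- by rewrite linearZ ptens_bal.
Qed.

Lemma tens_mapD (W W' : lmodType R) (f : {linear W -> W'}) t u :
  tens_map B f (t + u) = tens_map B f t + tens_map B f u.
Proof.
rewrite /tens_map tens_liftD //; split=> [v v' c|v c c'|r v c].
- by rewrite linearD ptensDl.
- by rewrite ptensDr.
- by rewrite linearZ ptens_bal.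
Qed.

Lemma tens_map0 (W W' : lmodType R) (f : {linear W -> W'}) : tens_map B f 0 = 0.
Proof. by apply: (addrI (tens_map B f 0)); rewrite -tens_mapD !addr0. Qed.

Lemma tens_map_id (W : lmodType R) t : tens_map B (@idfun W) t = t.
Proof.
elim/tens_ind: t => [|t u IHt IHu|w b]; first exact: tens_map0.
- by rewrite tens_mapD IHt IHu.
- by rewrite tens_mapE.
Qed.

Lemma tens_map_comp (W1 W2 W3 : lmodType R) (g : {linear W2 -> W3})
    (f : {linear W1 -> W2}) t :
  tens_map B (g \o f) t = tens_map B g (tens_map B f t).
Proof.
elim/tens_ind: t => [|t u IHt IHu|w b]; first by rewrite !tens_map0.
- by rewrite !tens_mapD IHt IHu.
- by rewrite !tens_mapE.
Qed.

End TensMapComp.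

Fact gK_id_subproof (M : gK_module) : is_gK_hom (@idfun M).
Proof. by split=> // A k v; rewrite !tens_map_id. Qed.
Definition gK_id (M : gK_module) : gK_hom M M := @GKHom M M idfun (gK_id_subproof M).

Fact gK_comp_subproof (M N P : gK_module) (g : gK_hom N P) (f : gK_hom M N) :
  is_gK_hom (g \o f).
Proof.
case: f g => f [fg fk] [g [gg gk]]; split=> [Z m|A k v] /=; first by rewrite fg gg.
by rewrite !tens_map_comp fk gk.
Qed.
Definition gK_comp (M N P : gK_module) (g : gK_hom N P) (f : gK_hom M N) : gK_hom M P :=
  @GKHom M P (g \o f) (gK_comp_subproof g f).

Fact gK_cmp1m (M N : gK_module) (f : gK_hom M N) : gK_comp (gK_id N) f = f.
Proof. exact: gK_hom_ext. Qed.

Fact gK_cmpm1 (M N : gK_module) (f : gK_hom M N) : gK_comp f (gK_id M) = f.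
Proof. exact: gK_hom_ext. Qed.

Fact gK_cmpA (M N P Q : gK_module) (h : gK_hom P Q) (g : gK_hom N P) (f : gK_hom M N) :
  gK_comp h (gK_comp g f) = gK_comp (gK_comp h g) f.
Proof. exact: gK_hom_ext. Qed.

Definition gK_Mod : category :=
  @Category gK_module gK_hom gK_id gK_comp gK_cmp1m gK_cmpm1 gK_cmpA.

Definition finitely_generated (M : gK_module) : Prop :=
  exists (n : nat) (s : 'I_n -> M), forall m, exists u : 'I_n -> U_expr rat,
    m = \sum_(i < n) U_act (@gact M) (u i) (s i).

(* Characters SO(2)_F -> G_m over F.  A commutative F-algebra is a commutative
   Q-algebra A with a Q-algebra morphism j : F -> A.  The values are units, since
   k is invertible in SO(2)(A). *)
Record so2_character := SO2Character {
  char_fun :> forall A : comAlgType rat, {lrmorphism Qi -> A} -> so2 A -> A;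
  char1 : forall (A : comAlgType rat) (j : {lrmorphism Qi -> A}),
    char_fun j so2_one = 1;
  charM : forall (A : comAlgType rat) (j : {lrmorphism Qi -> A}) (k l : so2 A),
    char_fun j (so2_mul k l) = char_fun j k * char_fun j l;
  char_natural : forall (A B : comAlgType rat) (j : {lrmorphism Qi -> A})
      (phi : {lrmorphism A -> B}) (k : so2 A),
    char_fun (phi \o j : {lrmorphism Qi -> B}) (so2_map phi k) = phi (char_fun j k) }.

Definition isotypic (M : gK_module) (chi : so2_character) (v : base_change M Qi) : Prop :=
  forall (A : comAlgType rat) (j : {lrmorphism Qi -> A}) (k : so2 A),
    kact k (base_change_map j v) = chi A j k *: base_change_map j v.

Definition finite_dimensional (F : fieldType) (V : lmodType F) (P : V -> Prop) : Prop :=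
  exists (n : nat) (s : 'I_n -> V), (forall i, P (s i)) /\
    forall v, P v -> exists c : 'I_n -> F, v = \sum_(i < n) c i *: s i.

Definition admissible (M : gK_module) : Prop :=
  forall chi : so2_character, finite_dimensional (isotypic (M := M) chi).

Definition sl2_H : sl2 Qi := mk_sl2 0 (- sqrtm1) sqrtm1.
Definition sl2_X : sl2 Qi := mk_sl2 (1 / 2) (sqrtm1 / 2) (sqrtm1 / 2).
Definition sl2_Y : sl2 Qi := mk_sl2 (1 / 2) (- sqrtm1 / 2) (- sqrtm1 / 2).

Definition U_C : U_expr Qi :=
  UAdd (UMul (UGen sl2_H) (UGen sl2_H))
  (UAdd (UMul (UScal (- 2)) (UGen sl2_H))
  (UAdd (UMul (UScal 4) (UMul (UGen sl2_X) (UGen sl2_Y)))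
        (UScal 1))).

(* C lies in U(sl_2(Q)), although H, X and Y do not lie in sl_2(Q).  C^m M = 0 is
   checked in F (x) M, on which C acts and into which M embeds by x |-> 1 (x) x. *)
Definition C_nilpotent (M : gK_module) : Prop :=
  exists m : nat, forall x : M,
    iter m (U_act (@base_change_act M (@gact M) Qi) U_C) (btens x 1) = 0.

Definition opp_one_acts_by_opp (M : gK_module) : Prop :=
  forall v : base_change M rat^o, kact so2_opp_one v = - v.

Definition in_HC0 (M : gK_module) : Prop :=
  [/\ finitely_generated M, admissible M, C_nilpotent M & opp_one_acts_by_opp M].

Definition HC0 : category := @full_subcategory gK_Mod in_HC0.

Definition Qi_twisted := Qi.
HB.instance Definition _ := GRing.Zmodule.on Qi_twisted.

Section Twisted.

Definition tw_right (a : Qi) (m : Qi_twisted) : Qi_twisted := (m : Qi) * (conjc a : Qi).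

Let conjcM (a b : Qi) : conjc (a * b) = conjc a * conjc b :> Qi.
Proof.
case: a b => a b [c d]; rewrite /GRing.mul /=.
by congr Complex; rewrite ?mulrNN // mulrN mulNr opprD.
Qed.

Let conjcD (a b : Qi) : conjc (a + b) = conjc a + conjc b :> Qi.
Proof. by case: a b => a b [c d]; rewrite /GRing.add /= opprD. Qed.

Let tw_rightA a b m : tw_right a (tw_right b m) = tw_right (a * b) m.
Proof. by rewrite /tw_right conjcM -mulrA [_ * conjc b]mulrC. Qed.

Let tw_right1 : left_id 1 tw_right.
Proof. by move=> m; rewrite /tw_right /conjc /= oppr0 [LHS]mulr1. Qed.

Let tw_rightDr : right_distributive tw_right +%R.
Proof. by move=> a m m'; exact: mulrDl. Qed.

Let tw_rightDl m : {morph tw_right^~ m : a b / a + b}.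
Proof. by move=> a b; rewrite /tw_right conjcD [LHS]mulrDr. Qed.

HB.instance Definition _ :=
  GRing.Zmodule_isLmodule.Build Qi Qi_twisted tw_rightA tw_right1 tw_rightDr tw_rightDl.

Definition tw_left (a : Qi) (m : Qi_twisted) : Qi_twisted := a * (m : Qi).

Let tw_leftZ r s (b : Qi_twisted) : tw_left r (s *: b) = s *: tw_left r b.
Proof. exact: mulrA. Qed.

(* a . m = a m and m . a = m (conjugate of a) *)
Definition F_twisted : bimodule Qi Qi :=
  @Bimodule Qi Qi Qi_twisted tw_left
    (@mul1r Qi) (fun r r' b => esym (@mulrA Qi r r' b)) (fun r r' b => @mulrDl Qi r r' b)
    (@mulrDr Qi) tw_leftZ.

End Twisted.

(* Representations of a species with one vertex, with field F, and one
   (F, F)-bimodule B. *)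
Section Rep.
Variables (F : fieldType) (B : bimodule F F).

Record species_rep := SpeciesRep {
  rep_space :> vectType F;
  rep_map : {linear tens rep_space B -> rep_space} }.

Definition is_rep_hom (V W : species_rep) (h : V -> W) : Prop :=
  forall t, h (rep_map V t) = rep_map W (tens_map B h t).

Record rep_hom (V W : species_rep) := RepHom {
  rep_fun :> {linear V -> W};
  rep_funP : is_rep_hom rep_fun }.

Lemma rep_hom_ext V W (f g : rep_hom V W) : f =1 g -> f = g.
Proof.
case: f g => f fP [g gP] /= /linear_ext E; subst g.
by congr RepHom; exact: Prop_irrelevance.
Qed.

Fact rep_id_subproof (V : species_rep) : is_rep_hom (@idfun V).
Proof. by move=> t; rewrite tens_map_id. Qed.
Definition rep_id (V : species_rep) : rep_hom V V := @RepHom V V idfun (@rep_id_subproof V).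

Fact rep_comp_subproof (U V W : species_rep) (g : rep_hom V W) (f : rep_hom U V) :
  is_rep_hom (g \o f).
Proof. by case: f g => f fP [g gP] t /=; rewrite tens_map_comp fP gP. Qed.
Definition rep_comp (U V W : species_rep) (g : rep_hom V W) (f : rep_hom U V) : rep_hom U W :=
  @RepHom U W (g \o f) (@rep_comp_subproof U V W g f).

Fact rep_cmp1m (M N : species_rep) (f : rep_hom M N) : rep_comp (rep_id N) f = f.
Proof. exact: rep_hom_ext. Qed.

Fact rep_cmpm1 (M N : species_rep) (f : rep_hom M N) : rep_comp f (rep_id M) = f.
Proof. exact: rep_hom_ext. Qed.

Fact rep_cmpA (M N P Q : species_rep) (h : rep_hom P Q) (g : rep_hom N P) (f : rep_hom M N) :
  rep_comp h (rep_comp g f) = rep_comp (rep_comp h g) f.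
Proof. exact: rep_hom_ext. Qed.

Definition species_Rep : category :=
  @Category species_rep rep_hom rep_id rep_comp rep_cmp1m rep_cmpm1 rep_cmpA.

(* W (x) B^(x)n, bracketed to the left *)
Fixpoint tens_power (W : lmodType F) (n : nat) : lmodType F :=
  if n is n'.+1 then tens (tens_power W n') B else W.

Fixpoint rep_iter (W : species_rep) (n : nat) : tens_power W n -> W :=
  match n with
  | 0 => id
  | n'.+1 => fun t => rep_map W (tens_map B (@rep_iter W n') t)
  end.

Definition nilpotent_rep (W : species_rep) : Prop :=
  exists2 n : nat, (0 < n)%N & forall t : tens_power W n, rep_iter t = 0.

End Rep.

Definition Rep_nil_S_Gamma : category :=
  @full_subcategory (species_Rep F_twisted) (@nilpotent_rep Qi F_twisted).

(* Main.v *)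
Require Import Defs.
From HB Require Import structures.
From mathcomp Require Import all_boot all_order all_algebra.
From mathcomp Require Import boolp complex qpoly ring functions.

Set Implicit Arguments.
Unset Strict Implicit.
Unset Printing Implicit Defensive.

Import GRing.Theory.
Local Open Scope ring_scope.

(** The theorem holds because a module M of HC_0 is determined by its vectors of
    weight 1, together with one semilinear nilpotent operator on them.

    Over F = Q(i) the element H = iJ, with J = (0 -1; 1 0), acts on M with odd
    eigenvalues, X raises and Y lowers the eigenvalue by 2, and
    4 X Y = C - (H - 1)^2.  As C is nilpotent, X and Y are invertible between the
    eigenspaces of n and n + 2 unless n = -1.  Complex conjugation c exchanges the
    eigenspaces of n and - n, and X and Y.  So all information is contained in the
    eigenspace W of 1 and in phi = c Y : W -> W, which is semilinear, with
    4 phi^2 = C on W.  On the other side a right F-linear map from W (x) F^twisted to W is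
    the same thing as a semilinear map w |-> f (w (x) 1), and nilpotence means the
    same for both.

    Extending scalars to F can be avoided for most of the argument: a vector v in the
    eigenspace of n > 0 is determined by the rational vector v + c v, and these are
    the vectors of M with J^2 = - n^2, called vectors of weight n below.  On them J/n
    takes the place of - i, and X and Y are given by the operators [raise] and [lower]
    in terms of J, h = (1 0; 0 -1) and q = (0 1; 1 0).  In particular lower 1 maps the
    vectors of weight 1 to themselves, and it is phi.

    Four steps carry the proof.
    - The functor from representations to modules sends (W, phi) to the [model]: the direct
      sum of copies of W, one for each weight 2k + 1, where X is a shift
      and Y is the shift by phi^2 - k^2.  The action of K is defined by rotating
      the copy of weight n by the n-th power of a point of SO(2)
      ([weight_gK], [rep_gK_HC0]).
    - Conversely, an algebraic representation of K is a sum of vectors which K rotates with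
      integral frequencies, and J detects the frequencies ([kact_weights],
      [rotates_weight]).  This uses the universal point of SO(2), with values in
      its coordinate ring, and the linear independence of cos (n t) and sin (n t)
      ([trigonometric_independent]).  Hence J determines the action of K, and a
      linear map which commutes with h and J is a morphism ([hom_from_hJ]).
    - The functor is fully faithful: a morphism commutes with J and so preserves the
      weights, and commuting with h forces it to be the same map on all copies of W and
      to commute with phi ([rep_functor_full]).
    - It is essentially surjective: for M in HC_0 the vectors of weight 1 form a
      finite-dimensional F-space by admissibility ([weight_one_finite]), and iterated
      raising operators identify the model on it with M ([reconstruct_inj],
      [reconstruct_surj]). *)

(** * Linear identities in modules *)

(** Formal linear combinations of atoms, which are the positions in a list of vectors. *)
Inductive lexp (R : Type) :=
| LZero
| LVar of nat
| LAdd of lexp R & lexp R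
| LOpp of lexp R
| LScale of R & lexp R.
Arguments LZero {R}.
Arguments LVar {R}.

Section LexpEval.
Variables (R : comNzRingType) (V : lmodType R).

Fixpoint leval (vs : seq V) (e : lexp R) : V :=
  match e with
  | LZero => 0
  | LVar i => nth 0 vs i
  | LAdd e1 e2 => leval vs e1 + leval vs e2
  | LOpp e1 => - leval vs e1
  | LScale c e1 => c *: leval vs e1
  end.

Fixpoint lcoef (e : lexp R) (i : nat) : R :=
  match e with
  | LZero => 0
  | LVar j => if Nat.eqb j i then 1 else 0
  | LAdd e1 e2 => lcoef e1 i + lcoef e2 i
  | LOpp e1 => - lcoef e1 i
  | LScale c e1 => c * lcoef e1 i
  end.

Lemma levalE vs e : leval vs e = \sum_(i < size vs) lcoef e i *: nth 0 vs i.
Proof.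
elim: e => [|j|e1 IH1 e2 IH2|e1 IH1|c e1 IH1] /=.
- by rewrite big1 // => i _; rewrite scale0r.
- have [lt_j|le_j] := ltnP j (size vs).
    rewrite (bigD1 (Ordinal lt_j)) //= big1 ?addr0.
      by rewrite (introT (PeanoNat.Nat.eqb_spec _ _)) ?scale1r.
    move=> i /negP ne; case: (PeanoNat.Nat.eqb_spec j i) => [E|_]; last by rewrite scale0r.
    by case: ne; apply/eqP/val_inj; rewrite /= E.
  rewrite nth_default // big1 // => i _.
  case: (PeanoNat.Nat.eqb_spec j i) => [E|_]; last by rewrite scale0r.
  by have := ltn_ord i; rewrite -E ltnNge le_j.
- by rewrite IH1 IH2 -big_split /=; apply: eq_bigr => i _; rewrite scalerDl.
- by rewrite IH1 -sumrN; apply: eq_bigr => i _; rewrite scaleNr.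
- by rewrite IH1 scaler_sumr; apply: eq_bigr => i _; rewrite scalerA.
Qed.

Fixpoint lcoefs_eq (e1 e2 : lexp R) (n : nat) : Prop :=
  if n is n'.+1 then lcoef e1 n' = lcoef e2 n' /\ lcoefs_eq e1 e2 n' else True.

(** This reduces an identity in a module to ring identities between its scalars. The
    atoms may be linearly dependent, since only this implication is used. *)
Lemma leval_eq vs e1 e2 : lcoefs_eq e1 e2 (size vs) -> leval vs e1 = leval vs e2.
Proof.
rewrite !levalE => E; apply: eq_bigr => -[i /= lt_i] _; congr (_ *: _).
elim: (size vs) lt_i E => //= n IHn; rewrite ltnS leq_eqVlt => /predU1P[->|lt_in] [] //.
by move=> _ /(IHn lt_in).
Qed.

End LexpEval.

Create HintDb lmod_atom.

(* Atoms are compared up to conversion, since the same vector may be displayed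
   with different but convertible module structures. *)
Ltac lmod_index x vs :=
  lazymatch vs with
  | ?y :: ?vs' =>
      match constr:(tt) with
      | _ => let _ := match constr:(tt) with _ => unify x y with lmod_atom end in
             constr:(0%N)
      | _ => let i := lmod_index x vs' in constr:(S i)
      end
  end.

Ltac lmod_mem x vs :=
  match constr:(tt) with
  | _ => let i := lmod_index x vs in constr:(true)
  | _ => constr:(false)
  end.

Ltac lmod_atoms t vs :=
  lazymatch t with
  | GRing.add ?a ?b => let vs := lmod_atoms a vs in lmod_atoms b vs
  | GRing.opp ?a => lmod_atoms a vs
  | GRing.scale _ ?a => lmod_atoms a vs
  | GRing.zero => vs
  | _ => lazymatch lmod_mem t vs with
         | true => vs
         | false => constr:(t :: vs)
         end
  end.

Ltac lmod_reify R t vs :=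
  lazymatch t with
  | GRing.add ?a ?b =>
      let a' := lmod_reify R a vs in let b' := lmod_reify R b vs in
      constr:(@LAdd R a' b')
  | GRing.opp ?a => let a' := lmod_reify R a vs in constr:(@LOpp R a')
  | GRing.scale ?c ?a => let a' := lmod_reify R a vs in constr:(@LScale R c a')
  | GRing.zero => constr:(@LZero R)
  | _ => let i := lmod_index t vs in constr:(@LVar R i)
  end.

(* Reduces an equation in the R-module V to one equation in R for each atom. *)
Tactic Notation "lmod" constr(R) constr(V) :=
  lazymatch goal with
  | |- @eq _ ?s ?t =>
      let vs := lmod_atoms s (@nil V) in
      let vs := lmod_atoms t vs in
      let s' := lmod_reify R s vs in
      let t' := lmod_reify R t vs in
      change (@leval R V vs s' = @leval R V vs t');
      apply: leval_eq; cbn [lcoefs_eq lcoef size Nat.eqb]; repeat split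
  end.


Lemma linE (R : pzRingType) (U V : lmodType R) (f : {linear U -> V}) :
  (forall a b, f (a + b) = f a + f b) * (forall a, f (- a) = - f a)
  * (forall c a, f (c *: a) = c *: f a).
Proof. by split; [split|] => *; rewrite (linearD, linearN, linearZ). Qed.

Lemma linP (R : pzRingType) (U V : lmodType R) (f : U -> V) : linear f ->
  (forall a b, f (a + b) = f a + f b) * (forall a, f (- a) = - f a)
  * (forall c a, f (c *: a) = c *: f a) * (f 0 = 0).
Proof.
move=> fL; pose g : {linear U -> V} := HB.pack f (GRing.isLinear.Build R U V *:%R f fL).
by split; [exact: (linE g)|exact: (linear0 g)].
Qed.

Lemma lin_sum (R : pzRingType) (U V : lmodType R) (f : U -> V) I (r : seq I) (P : pred I)
    (F : I -> U) : linear f -> f (\sum_(i <- r | P i) F i) = \sum_(i <- r | P i) f (F i).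
Proof. by move=> fL; apply: big_morph => [x y|]; rewrite (linP fL). Qed.

(** * Weights of real sl_2-modules *)

(** The operators stand for h = (1 0; 0 -1), q = (0 1; 1 0) and J = (0 -1; 1 0). *)
Section RealSl2.
Variables (V : lmodType rat) (h q J : {linear V -> V}).

Definition sl2_relations : Prop := [/\
  forall v, h (q v) = q (h v) - 2 *: J v,
  forall v, J (q v) = q (J v) - 2 *: h v &
  forall v, J (h v) = h (J v) + 2 *: q v].

(** Over Q(i) these are the sums of an eigenvector of H = iJ with eigenvalue n and one
    with eigenvalue - n; weight n and weight (- n) are the same condition. *)
Definition weight (n : rat) (v : V) : Prop := J (J v) = - n ^+ 2 *: v.

(** Over Q(i), h = X + Y and q = - i X + i Y. If v has weight n, write - i as J/n on v;
    then J acts by n + 2 times - i on X v and by n - 2 times - i on Y v, and solving for X v and Y v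
    gives these formulas. They satisfy raise (- n) = lower n. *)
Definition raise (n : rat) (v : V) : V :=
  (2 * n)^-1 *: ((n - 2) *: h v - J (q v)).

Definition lower (n : rat) (v : V) : V :=
  (2 * n)^-1 *: ((n + 2) *: h v + J (q v)).

(** This is C = H^2 - 2H + 4XY + 1, rewritten in h, q and J. *)
Definition casimir (v : V) : V := h (h v) + q (q v) - J (J v) + v.

Hypothesis rel : sl2_relations.

Let hq v : q (h v) = h (q v) + 2 *: J v.
Proof. by case: rel => hq _ _; rewrite hq; lmod rat V; ring. Qed.
Let Jq v : J (q v) = q (J v) - 2 *: h v.
Proof. by case: rel. Qed.
Let Jh v : J (h v) = h (J v) + 2 *: q v.
Proof. by case: rel. Qed.

Let opE := (hq, Jq, Jh, linE h, linE q, linE J).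

Lemma casimir_h v : casimir (h v) = h (casimir v).
Proof. rewrite /casimir !opE; lmod rat V; ring. Qed.
Lemma casimir_q v : casimir (q v) = q (casimir v).
Proof. rewrite /casimir !opE; lmod rat V; ring. Qed.
Lemma casimir_J v : casimir (J v) = J (casimir v).
Proof. rewrite /casimir !opE; lmod rat V; ring. Qed.

Section Weight.
Variables (n : rat) (v : V).
Hypotheses (n0 : n != 0) (wt_v : weight n v).

Lemma raise_add_lower : raise n v + lower n v = h v.
Proof. rewrite /raise /lower !opE; lmod rat V; field => //. Qed.

Lemma weightJ : weight n (J v).
Proof. by rewrite /weight wt_v linearZ. Qed.

Lemma raiseJ : J (raise n v) = ((n + 2) / n) *: raise n (J v).
Proof.
by rewrite /raise !(opE, wt_v); lmod rat V; field.
Qed.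

Lemma lowerJ : J (lower n v) = ((n - 2) / n) *: lower n (J v).
Proof.
by rewrite /lower !(opE, wt_v); lmod rat V; field.
Qed.

Lemma weight_raise : weight (n + 2) (raise n v).
Proof.
by rewrite /weight /raise !(opE, wt_v); lmod rat V; field.
Qed.

Lemma weight_lower : weight (n - 2) (lower n v).
Proof.
by rewrite /weight /lower !(opE, wt_v); lmod rat V; field.
Qed.

(** This and [raise_lower] are 4 Y X = C - (H + 1)^2 and 4 X Y = C - (H - 1)^2. *)
Lemma lower_raise : n + 2 != 0 ->
  lower (n + 2) (raise n v) = 4^-1 *: (casimir v - (n + 1) ^+ 2 *: v).
Proof.
by move=> n2; rewrite /casimir /lower /raise !(opE, wt_v); lmod rat V; field; rewrite n0.
Qed.

Lemma raise_lower : n - 2 != 0 ->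
  raise (n - 2) (lower n v) = 4^-1 *: (casimir v - (n - 1) ^+ 2 *: v).
Proof.
by move=> n2; rewrite /casimir /lower /raise !(opE, wt_v); lmod rat V; field; rewrite n0.
Qed.

Lemma q_raise_lower : q v = n^-1 *: (raise n (J v) - lower n (J v)).
Proof.
by rewrite /lower /raise !(opE, wt_v); lmod rat V; field.
Qed.

End Weight.
End RealSl2.

(** * Base change *)

#[local] Hint Opaque tens_map tens_lift btens ptens base_change_map : lmod_atom.

Section BaseChange.
Variables (V : lmodType rat) (A : comAlgType rat).

Lemma btensE (m : V) (a : A) : btens m a = a *: btens m 1.
Proof. by rewrite /btens ptensZ; congr ptens; rewrite /GRing.scale /= mulr1. Qed.

Lemma btensD (m m' : V) : btens (m + m') 1 = btens m 1 + btens m' 1 :> base_change V A.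
Proof. exact: ptensDl. Qed.

Lemma btensZ (r : rat) (m : V) : btens (r *: m) 1 = r%:A *: btens m 1 :> base_change V A.
Proof. by rewrite -btensE; exact: ptens_bal. Qed.

Lemma btens0 : btens (0 : V) 1 = 0 :> base_change V A.
Proof. by rewrite -(scale0r (0 : V)) btensZ !scale0r. Qed.

Lemma btensN (m : V) : btens (- m) 1 = - btens m 1 :> base_change V A.
Proof. by rewrite -scaleN1r btensZ !scaleN1r. Qed.

Lemma btens_sum I (r : seq I) (P : pred I) (F : I -> V) :
  btens (\sum_(i <- r | P i) F i) 1 = \sum_(i <- r | P i) btens (F i) 1 :> base_change V A.
Proof. exact: (big_morph (fun m => btens m 1 : base_change V A) btensD btens0). Qed.

Lemma base_change_ind (P : base_change V A -> Prop) :
  P 0 -> (forall t u, P t -> P u -> P (t + u)) ->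
  (forall a t, P t -> P (a *: t)) -> (forall m, P (btens m 1)) -> forall t, P t.
Proof.
move=> P0 PD PZ Pb; elim/tens_ind => // m a.
by rewrite -[ptens m a]/(btens m a) btensE; exact: PZ.
Qed.

(** The vectors of V generate the base change over A. *)
Lemma base_change_eq (U : lmodType A) (f g : base_change V A -> U) :
  linear f -> linear g -> (forall m, f (btens m 1) = g (btens m 1)) -> f =1 g.
Proof.
move=> fL gL E.
have f0 : f 0 = 0 by have := fL (-1) 0 0; rewrite scaler0 addr0 scaleN1r addNr.
have g0 : g 0 = 0 by have := gL (-1) 0 0; rewrite scaler0 addr0 scaleN1r addNr.
elim/base_change_ind => [|t u Et Eu|a t Et|m]; first by rewrite f0 g0.
- by have := fL 1 t u; have := gL 1 t u; rewrite !scale1r => -> ->; rewrite Et Eu.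
- by have := fL a t 0; have := gL a t 0; rewrite !addr0 f0 g0 !addr0 => -> ->; rewrite Et.
- exact: E.
Qed.

Section Extension.
Variables (U : lmodType A) (g : V -> U).
Hypothesis gL : forall r u v, g (r *: u + v) = r%:A *: g u + g v.

Definition bc_ext (t : base_change V A) : U :=
  @tens_lift rat A V (scalars A) U (fun m (a : scalars A) => (a : A) *: g m) t.

Let bal : @balanced rat A V (scalars A) U (fun m (a : scalars A) => (a : A) *: g m).
Proof.
have g0 : g 0 = 0.
  by have := gL (-1) 0 0; rewrite scaler0 addr0 !scaleN1r addNr.
split=> [w w' b|w b b'|r w b].
- by have := gL 1 w w'; rewrite !scale1r => ->; rewrite scalerDr.
- by rewrite scalerDl.
- have := gL r w 0; rewrite !addr0 g0 addr0 => ->.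
  by rewrite scalerA; congr (_ *: _); rewrite mulrC -scalerAl mul1r.
Qed.

Lemma bc_extE m : bc_ext (btens m 1) = g m.
Proof. by rewrite /bc_ext /btens tens_liftE ?scale1r. Qed.

Lemma bc_ext_linear : linear bc_ext.
Proof.
move=> a t u; rewrite /bc_ext tens_liftD //; congr (_ + _).
elim/tens_ind: t => [|t t' Et Et'|m b].
- have z : tens_lift (fun m (a : scalars A) => (a : A) *: g m) (0 : tens V (scalars A)) = 0.
    by apply: (addrI (tens_lift (fun m (a : scalars A) => (a : A) *: g m) (0 : tens V (scalars A))));
       rewrite -tens_liftD // !addr0.
  by rewrite scaler0 z scaler0.
- by rewrite scalerDr !tens_liftD // Et Et' scalerDr.
- by rewrite ptensZ !tens_liftE // scalerA.
Qed.
End Extension.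

End BaseChange.

Section TensMap.
Variables (V W : lmodType rat) (f : {linear V -> W}) (A : comAlgType rat).

Lemma tens_map_btens m a : tens_map (scalars A) f (btens m a) = btens (f m) a.
Proof. exact: tens_mapE. Qed.

Lemma tens_map_linear : linear (tens_map (scalars A) f : base_change V A -> base_change W A).
Proof.
move=> a t u; rewrite tens_mapD; congr (_ + _).
elim/tens_ind: t => [|t t' Et Et'|m b]; first by rewrite scaler0 tens_map0 scaler0.
- by rewrite scalerDr !tens_mapD Et Et' scalerDr.
- by rewrite !(tens_mapE, ptensZ).
Qed.

Definition bc_map (t : base_change V A) : base_change W A := tens_map (scalars A) f t.
HB.instance Definition _ :=
  GRing.isLinear.Build A (base_change V A) (base_change W A) *:%R bc_map tens_map_linear.

End TensMap.
Arguments bc_map {V W} f A t.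

Section BaseChangeMap.
Variables (V : lmodType rat) (A B : comAlgType rat) (phi : {lrmorphism A -> B}).

Let bal : @balanced rat A V (scalars A) (base_change V B) (fun m a => btens m (phi a)).
Proof.
split=> [w w' b|w b b'|r w b]; first exact: ptensDl.
- by rewrite rmorphD; exact: ptensDr.
- transitivity (btens w (r *: phi b)); first exact: ptens_bal.
  by congr btens; rewrite -linearZ.
Qed.

Lemma base_change_map_btens (m : V) (a : A) :
  base_change_map phi (btens m a) = btens m (phi a).
Proof. by rewrite /base_change_map /btens tens_liftE. Qed.

Lemma base_change_mapD (t u : base_change V A) :
  base_change_map phi (t + u) = base_change_map phi t + base_change_map phi u.
Proof. by rewrite /base_change_map tens_liftD. Qed.

Lemma base_change_map0 : base_change_map phi (0 : base_change V A) = 0.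
Proof. by apply: (addrI (base_change_map phi 0)); rewrite -base_change_mapD !addr0. Qed.

Lemma base_change_mapZ (a : A) (t : base_change V A) :
  base_change_map phi (a *: t) = phi a *: base_change_map phi t.
Proof.
elim/tens_ind: t => [|t u Et Eu|m b].
- by rewrite scaler0 base_change_map0 scaler0.
- by rewrite scalerDr !base_change_mapD Et Eu scalerDr.
- rewrite -[ptens m b]/(btens m b) ptensZ -[ptens m _]/(btens m (a * b)) !base_change_map_btens.
  by rewrite (btensE _ (phi b)) (btensE _ (phi (a * b))) scalerA rmorphM.
Qed.

Lemma base_change_map_btens1 (m : V) : base_change_map phi (btens m 1) = btens m 1.
Proof. by rewrite base_change_map_btens rmorph1. Qed.

End BaseChangeMap.

Lemma base_change_map_id (V : lmodType rat) (A : comAlgType rat) (t : base_change V A) :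
  base_change_map (idfun : {lrmorphism A -> A}) t = t.
Proof.
elim/base_change_ind: t => [|t u Et Eu|a t Et|m].
- exact: base_change_map0.
- by rewrite base_change_mapD Et Eu.
- by rewrite base_change_mapZ Et.
- exact: base_change_map_btens1.
Qed.

Section BaseChangeAct.
Variables (V : lmodType rat) (rho : sl2 rat -> {linear V -> V}) (A : comAlgType rat).

Lemma base_change_act_linear (Z : sl2 A) : linear (base_change_act rho Z).
Proof.
move=> a t u; rewrite /base_change_act.
rewrite !tens_map_linear.
lmod A (base_change V A); ring.
Qed.

Lemma base_change_actE (Z : sl2 A) m :
  base_change_act rho Z (btens m 1) = Z 0 0 *: btens (rho (mk_sl2 1 0 0) m) 1
    + Z 0 1 *: btens (rho (mk_sl2 0 1 0) m) 1 + Z 1 0 *: btens (rho (mk_sl2 0 0 1) m) 1.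
Proof. by rewrite /base_change_act !tens_map_btens. Qed.

End BaseChangeAct.

Lemma sl2_11 (A : comNzRingType) (Z : sl2 A) : Z 1 1 = - Z 0 0.
Proof.
have : \tr Z = 0 by case: (Z) => Y /= /eqP.
rewrite /mxtrace !big_ord_recl big_ord0 addr0.
have -> : lift ord0 ord0 = 1 :> 'I_2 by apply: val_inj.
by move/eqP; rewrite addrC addr_eq0 => /eqP.
Qed.

(** * Powers in SO(2) *)

Lemma so2_eq (A : comNzRingType) (k l : so2 A) : k.1 = l.1 -> k.2 = l.2 -> k = l.
Proof. by move=> E1 E2; apply: val_inj; case: k l E1 E2 => -[? ?] ? [[? ?] ?] /= -> ->. Qed.

(** The n-th power of (x, y) is (cos nt, sin nt) if x = cos t and y = sin t. *)
Section Rotations.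
Variable A : comNzRingType.
Implicit Types (k l : so2 A) (n : nat).

Definition so2_exp n k : so2 A := iter n (so2_mul k) so2_one.

Lemma so2P k : k.1 ^+ 2 + k.2 ^+ 2 = 1.
Proof. by apply/eqP; case: k. Qed.

Lemma so2_mulA k l p : so2_mul k (so2_mul l p) = so2_mul (so2_mul k l) p.
Proof. by apply: so2_eq => /=; ring. Qed.

Lemma so2_mulC k l : so2_mul k l = so2_mul l k.
Proof. by apply: so2_eq => /=; ring. Qed.

Lemma so2_mul1 k : so2_mul so2_one k = k.
Proof. by apply: so2_eq => /=; ring. Qed.

Lemma so2_expS n k : so2_exp n.+1 k = so2_mul k (so2_exp n k).
Proof. by []. Qed.

Lemma so2_exp1 k : so2_exp 1 k = k.
Proof. by rewrite so2_expS so2_mulC so2_mul1. Qed.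

Lemma so2_expM n k l : so2_exp n (so2_mul k l) = so2_mul (so2_exp n k) (so2_exp n l).
Proof.
elim: n => [|n IHn]; first by rewrite so2_mul1.
rewrite !so2_expS IHn !so2_mulA; congr so2_mul.
by rewrite -!so2_mulA; congr so2_mul; rewrite so2_mulC.
Qed.

Lemma so2_expD m n k : so2_exp (m + n) k = so2_mul (so2_exp m k) (so2_exp n k).
Proof. by elim: m => [|m IHm]; rewrite ?so2_mul1 // addSn !so2_expS IHm so2_mulA. Qed.

Lemma so2_exp_one n : so2_exp n so2_one = so2_one.
Proof. by elim: n => // n IHn; rewrite so2_expS so2_mul1. Qed.

Lemma so2_expV n k : so2_exp n (so2_inv k) = so2_inv (so2_exp n k).
Proof.
elim: n => [|n IHn]; first by apply: so2_eq; rewrite /= ?oppr0.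
by rewrite !so2_expS IHn; apply: so2_eq => /=; ring.
Qed.

Lemma so2_exp_opp n : so2_exp n so2_opp_one = if odd n then so2_opp_one else so2_one.
Proof.
by elim: n => // n IHn; rewrite so2_expS IHn /=; case: (odd n); apply: so2_eq => /=; ring.
Qed.

End Rotations.

Lemma so2_exp_map (A B : comNzRingType) (phi : {rmorphism A -> B}) n (k : so2 A) :
  so2_exp n (so2_map phi k) = so2_map phi (so2_exp n k).
Proof.
elim: n => [|n IHn]; first by apply: so2_eq; rewrite /= ?(rmorph1, rmorph0).
by rewrite !so2_expS IHn; apply: so2_eq; rewrite /= !(rmorphD, rmorphB, rmorphN, rmorphM).
Qed.

Lemma eps2 : eps ^+ 2 = 0.
Proof. by have := so2P (so2_tangent 1); rewrite /= scale1r expr1n -[RHS]addr0 => /addrI. Qed.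

Lemma so2_exp_tangent n (t : rat) : so2_exp n (so2_tangent t) = so2_tangent (n%:R * t).
Proof.
elim: n => [|n IHn]; first by apply: so2_eq; rewrite /= ?mul0r ?scale0r.
rewrite so2_expS IHn; apply: so2_eq; rewrite /=.
  have E : (t *: eps) * ((n%:R * t) *: eps) = 0.
    by rewrite -scalerAl -scalerAr -[eps * eps]/(eps ^+ 2) eps2 !scaler0.
  by rewrite E subr0 mul1r.
rewrite mul1r mulr1 -scalerDl; congr (_ *: _).
by rewrite mulrSr mulrDl mul1r.
Qed.

(** * Integrating a weight module to SO(2) *)

Section Integration.
Variables (V : lmodType rat) (h q J : {linear V -> V}) (pr : nat -> {linear V -> V}).

(** The odd weights are numbered by j, so that the sign - 1 of - 1_2 is built in. *)
Definition wt (j : nat) : nat := j.*2.+1.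

Lemma wt0 j : (wt j)%:R != 0 :> rat.
Proof. by rewrite Num.Theory.pnatr_eq0. Qed.

Lemma wtS j : (wt j.+1)%:R = (wt j)%:R + 2 :> rat.
Proof. by rewrite -natrD addn2. Qed.

(** Projections pr j onto the spaces of weight 2j + 1, of which almost all vanish on each vector. *)
Definition odd_weight_decomposition : Prop := [/\
  forall j v, weight J (wt j)%:R (pr j v),
  forall i j v, weight J (wt j)%:R v -> pr i v = if i == j then v else 0 &
  forall v, exists N, v = \sum_(j < N) pr j v /\ forall j, (N <= j)%N -> pr j v = 0].

Hypothesis (rel : sl2_relations h q J) (dec : odd_weight_decomposition).

Lemma weight_sum v : exists N, exists a : 'I_N -> V,
  v = \sum_j a j /\ forall j : 'I_N, weight J (wt j)%:R (a j).
Proof.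
by case: dec => wt_pr _ /(_ v) [N [-> _]]; exists N, (fun j => pr j v).
Qed.

(** K-actions and g-actions on the base change can be compared on weight vectors only. *)
Lemma weight_eq (A : comAlgType rat) (U : lmodType A) (f g : base_change V A -> U) :
  linear f -> linear g ->
  (forall j v, weight J (wt j)%:R v -> f (btens v 1) = g (btens v 1)) -> f =1 g.
Proof.
move=> fL gL E; apply: base_change_eq => // v.
have [N [a [-> wt_a]]] := weight_sum v; rewrite btens_sum.
by rewrite !lin_sum //; apply: eq_bigr => j _; exact: E (wt_a j).
Qed.

Section Action.
Variable A : comAlgType rat.
Implicit Types (k l : so2 A).

(** In the plane spanned by v and J v the vector orthogonal to v: the action of J is
    n times the rotation by a right angle. *)
Definition partner (n : nat) (v : V) : V := n%:R^-1 *: J v.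

(** The required action of k on v of weight n, since the derivative of k^n at k = 1 is n. *)
Definition rotation (n : nat) k (v : V) : base_change V A :=
  (so2_exp n k).1 *: btens v 1 + (so2_exp n k).2 *: btens (partner n v) 1.

Lemma rotation_linear n k r u v :
  rotation n k (r *: u + v) = r%:A *: rotation n k u + rotation n k v.
Proof.
rewrite /rotation.
have -> : partner n (r *: u + v) = r *: partner n u + partner n v.
  by rewrite /partner (linE J) (linE J); lmod rat V; ring.
rewrite !(btensD, btensZ).
lmod A (base_change V A); ring.
Qed.

Lemma rotation0 n k : rotation n k 0 = 0.
Proof. by rewrite /rotation /partner linear0 scaler0 btens0 !scaler0 addr0. Qed.

Definition degree_bound v : nat := 
  let: ex := (let: And3 _ _ fin := dec in fin v) in projT1 (cid ex).

Lemma degree_boundP v : v = \sum_(j < degree_bound v) pr j v /\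
  forall j, (degree_bound v <= j)%N -> pr j v = 0.
Proof. by rewrite /degree_bound; case: dec => ? ? fin; case: cid. Qed.

Definition kact_gen k (v : V) : base_change V A :=
  \sum_(j < degree_bound v) rotation (wt j) k (pr j v).

(** Any bound on the support gives the same sum, which makes [kact_gen] additive. *)
Lemma kact_genE k v N : (forall j, (N <= j)%N -> pr j v = 0) ->
  kact_gen k v = \sum_(j < N) rotation (wt j) k (pr j v).
Proof.
move=> z; have [_ z'] := degree_boundP v.
have E N1 N2 : (N1 <= N2)%N -> (forall j, (N1 <= j)%N -> pr j v = 0) ->
    \sum_(j < N1) rotation (wt j) k (pr j v) = \sum_(j < N2) rotation (wt j) k (pr j v).
  move=> le z1; rewrite (big_ord_widen _ (fun j => rotation (wt j) k (pr j v)) le).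
  rewrite big_mkcond; apply: eq_bigr => j _; case: ltnP => // /z1 ->.
  by rewrite rotation0.
rewrite /kact_gen; case: (leqP N (degree_bound v)) => [le|/ltnW le].
  exact/esym/E.
exact: E.
Qed.

Lemma kact_gen_linear k r u v :
  kact_gen k (r *: u + v) = r%:A *: kact_gen k u + kact_gen k v.
Proof.
have [_ zu] := degree_boundP u; have [_ zv] := degree_boundP v.
set N := maxn (degree_bound u) (degree_bound v).
have Zu j : (N <= j)%N -> pr j u = 0 by rewrite geq_max => /andP[/zu].
have Zv j : (N <= j)%N -> pr j v = 0 by rewrite geq_max => /andP[_ /zv].
have Zuv j : (N <= j)%N -> pr j (r *: u + v) = 0.
  by move=> le; rewrite linearP Zu // Zv // scaler0 addr0.
rewrite (kact_genE _ Zu) (kact_genE _ Zv) (kact_genE _ Zuv) scaler_sumr -big_split.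
by apply: eq_bigr => j _; rewrite linearP rotation_linear.
Qed.

Definition weight_kact k : base_change V A -> base_change V A := bc_ext (kact_gen k).

Lemma weight_kact_linear k : linear (weight_kact k).
Proof. exact: bc_ext_linear (kact_gen_linear k). Qed.

Lemma weight_kactE j k v : weight J (wt j)%:R v ->
  weight_kact k (btens v 1) = rotation (wt j) k v.
Proof.
move=> wt_v; rewrite /weight_kact bc_extE; last exact: kact_gen_linear.
case: dec => _ pr_wt _.
rewrite (@kact_genE k v j.+1) => [|i lt_ji]; last first.
  by rewrite (pr_wt _ _ _ wt_v) gtn_eqF.
rewrite big_ord_recr /= (pr_wt _ _ _ wt_v) eqxx big1 ?add0r // => i _.
by rewrite (pr_wt _ _ _ wt_v) ltn_eqF // rotation0.
Qed.

Lemma rotation_one j v : weight J (wt j)%:R v -> rotation (wt j) so2_one v = btens v 1.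
Proof. by rewrite /rotation so2_exp_one /= scale1r scale0r addr0. Qed.

Lemma weight_kact1 t : weight_kact so2_one t = t.
Proof.
apply: (weight_eq (g := id)) => //; first exact: weight_kact_linear.
by move=> j v wt_v; rewrite (weight_kactE _ wt_v) rotation_one.
Qed.

Lemma partner_weight j v : weight J (wt j)%:R v -> weight J (wt j)%:R (partner (wt j) v).
Proof. by rewrite /weight /partner => E; rewrite !(linE J) E !(linE J) !scalerA mulrC. Qed.

Lemma partnerK j v : weight J (wt j)%:R v -> partner (wt j) (partner (wt j) v) = - v.
Proof.
move=> E; rewrite /partner (linE J) E !scalerA.
by lmod rat V; field; exact: wt0.
Qed.

Lemma weight_kactM k l t : weight_kact (so2_mul k l) t = weight_kact k (weight_kact l t).
Proof.
have K := weight_kact_linear; move: t.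
apply: weight_eq => [| |j v wt_v]; first exact: K.
  by move=> a t u; rewrite !(linP (K _)).
have wt_v' := partner_weight wt_v.
rewrite !(weight_kactE _ wt_v) /rotation so2_expM !(linP (K _)).
rewrite (weight_kactE _ wt_v) (weight_kactE _ wt_v') /rotation (partnerK wt_v) btensN /=.
lmod A (base_change V A); ring.
Qed.

End Action.

Lemma weight_kact_natural (A B : comAlgType rat) (phi : {lrmorphism A -> B}) (k : so2 A) t :
  weight_kact (so2_map phi k) (base_change_map phi t) = base_change_map phi (weight_kact k t).
Proof.
elim/base_change_ind: t => [|t u Et Eu|a t Et|v].
- by rewrite !(linP (weight_kact_linear _), base_change_map0).
- by rewrite !(linP (weight_kact_linear _), base_change_mapD) Et Eu.
- by rewrite !(linP (weight_kact_linear _), base_change_mapZ) Et.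
have [N [a [-> wt_a]]] := weight_sum v.
elim/big_ind: _ => [|u w Eu Ew|j _].
- by rewrite btens0 !(linP (weight_kact_linear _), base_change_map0).
- by rewrite btensD !(linP (weight_kact_linear _), base_change_mapD) Eu Ew.
rewrite base_change_map_btens1 !(weight_kactE _ (wt_a j)) /rotation so2_exp_map.
by rewrite base_change_mapD !base_change_mapZ !base_change_map_btens1.
Qed.

Lemma weight_kact_tangent (t : rat) v :
  weight_kact (so2_tangent t) (btens v 1) = btens v 1 + btens (t *: J v) eps.
Proof.
have K := weight_kact_linear (so2_tangent t).
have [N [a [-> wt_a]]] := weight_sum v.
elim/big_ind: _ => [|u w Eu Ew|j _].
- by rewrite btens0 !(linP K) linear0 scaler0 [btens _ eps]btensE btens0 scaler0 addr0.
- rewrite btensD !(linP K) Eu Ew !(linE J) scalerDr ![btens _ eps]btensE btensD scalerDr.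
  by rewrite addrACA.
rewrite (weight_kactE _ (wt_a j)) /rotation so2_exp_tangent /= scale1r; congr (_ + _).
rewrite /partner !btensZ [btens _ eps]btensE btensZ !scalerA; congr (_ *: _).
rewrite -!scalerAl -!scalerAr !mulr1 !scalerA; congr (_ *: _).
by field; exact: wt0.
Qed.

Definition weight_gact (Z : sl2 rat) (v : V) : V :=
  Z 0 0 *: h v + (2^-1 * (Z 0 1 + Z 1 0)) *: q v + (2^-1 * (Z 1 0 - Z 0 1)) *: J v.

Lemma weight_gact_linear Z : linear (weight_gact Z).
Proof. by move=> r u v; rewrite /weight_gact !(linE h, linE q, linE J); lmod rat V; ring. Qed.

Lemma weight_gact_linearl v : linear (weight_gact^~ v).
Proof.
move=> r Z Z'; rewrite /weight_gact !mxE; lmod rat V; ring.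
Qed.

Lemma weight_gact_bracket Z Z' v : weight_gact (bracket Z Z') v =
  weight_gact Z (weight_gact Z' v) - weight_gact Z' (weight_gact Z v).
Proof.
have tr := @sl2_11 rat.
case: rel => hq Jq Jh.
have qh u : q (h u) = h (q u) + 2 *: J u by rewrite hq; lmod rat V; ring.
have o : lift ord0 ord0 = 1 :> 'I_2 by apply: val_inj.
rewrite /weight_gact /= !mxE !big_ord_recl !big_ord0 /= !o !tr.
rewrite !(linE h, linE q, linE J) !(qh, Jq, Jh, linE h, linE q, linE J).
by lmod rat V; field.
Qed.


(** The coordinates of a matrix in the basis h, q, J of sl_2 are its diagonal
    entry and the following two. *)
Section Coordinates.
Variable A : comAlgType rat.

Let half : A := 2^-1%:A.

Let half2 : half * 2 = 1.
Proof. by rewrite mulr_natr -scaler_nat scalerA divff // scale1r. Qed.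

Definition coord_q (Z : sl2 A) : A := half * (Z 0 1 + Z 1 0).
Definition coord_J (Z : sl2 A) : A := half * (Z 1 0 - Z 0 1).

Lemma base_change_gactE (Z : sl2 A) (v : V) :
  base_change_act weight_gact Z (btens v 1) =
    Z 0 0 *: btens (h v) 1 + coord_q Z *: btens (q v) 1 + coord_J Z *: btens (J v) 1.
Proof.
pose g Z : {linear V -> V} :=
  HB.pack (weight_gact Z) (GRing.isLinear.Build rat V V *:%R _ (weight_gact_linear Z)).
rewrite (base_change_actE g) /= /weight_gact /= !mxE /= !(mulr1, mulr0, addr0, add0r, subr0, sub0r).
rewrite !(btensD, btensZ) /coord_q /coord_J -/half.
have -> : (0 : rat)%:A = 0 :> A by exact: scale0r.
have -> : (1 : rat)%:A = 1 :> A by exact: scale1r.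
have -> : (2^-1 * -1 : rat)%:A = - half :> A by rewrite mulrN1 scaleNr.
by lmod A (base_change V A); ring.
Qed.

Lemma base_change_gact_linear (Z : sl2 A) : linear (base_change_act weight_gact Z).
Proof.
pose g Z : {linear V -> V} :=
  HB.pack (weight_gact Z) (GRing.isLinear.Build rat V V *:%R _ (weight_gact_linear Z)).
exact: (base_change_act_linear g Z).
Qed.

Lemma so2_AdE (k : so2 A) (Z : sl2 A) : [/\
  so2_Ad k Z 0 0 = (k.1 ^+ 2 - k.2 ^+ 2) * Z 0 0 - 2 * k.1 * k.2 * coord_q Z,
  coord_q (so2_Ad k Z) = 2 * k.1 * k.2 * Z 0 0 + (k.1 ^+ 2 - k.2 ^+ 2) * coord_q Z &
  coord_J (so2_Ad k Z) = coord_J Z].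
Proof.
have tr := sl2_11 Z.
have o : lift ord0 ord0 = 1 :> 'I_2 by apply: val_inj.
rewrite /coord_q /coord_J /= !mxE !big_ord_recl !big_ord0 /=.
rewrite !mxE !big_ord_recl !big_ord0 /= !mxE /= !o tr.
have k1 := so2P k; move: half2; set c := half => c2.
have z : ord0 = 0 :> 'I_2 by [].
rewrite !z; split.
- transitivity ((k.1 ^+ 2 - k.2 ^+ 2) * Z 0 0 - (c * 2) * (k.1 * k.2 * (Z 0 1 + Z 1 0))).
    by rewrite c2; ring.
  by ring.
- transitivity ((c * 2) * (2 * k.1 * k.2 * Z 0 0)
      + (k.1 ^+ 2 - k.2 ^+ 2) * (c * (Z 0 1 + Z 1 0))); first by ring.
  by rewrite c2; ring.
- transitivity (c * ((k.1 ^+ 2 + k.2 ^+ 2) * (Z 1 0 - Z 0 1))); first by ring.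
  by rewrite k1; ring.
Qed.
End Coordinates.

Section Equivariance.
Variables (A : comAlgType rat) (k : so2 A).

Let K := weight_kact_linear k.
Let B := base_change_gact_linear.

Let raiseZ n c v : raise h q J n (c *: v) = c *: raise h q J n v.
Proof. by rewrite /raise !(linE h, linE q, linE J); lmod rat V; ring. Qed.

Let lowerZ n c v : lower h q J n (c *: v) = c *: lower h q J n v.
Proof. by rewrite /lower !(linE h, linE q, linE J); lmod rat V; ring. Qed.

Let X j := raise h q J (wt j)%:R.
Let Y j := lower h q J (wt j)%:R.

(** [raise] intertwines the rotations by k^n and k^(n+2), because it maps the partner of
    v to the partner of its image. *)
Lemma weight_kact_raise j v : weight J (wt j)%:R v ->
  weight_kact k (btens (X j v) 1) = (so2_exp (wt j).+2 k).1 *: btens (X j v) 1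
    + (so2_exp (wt j).+2 k).2 *: btens (X j (partner (wt j) v)) 1.
Proof.
move=> wt_v; have n0 := wt0 j.
have wt_u : weight J (wt j.+1)%:R (X j v) by rewrite wtS; exact: weight_raise.
rewrite (weight_kactE _ wt_u) /rotation; congr (_ + _ *: btens _ 1).
rewrite /partner /X (raiseJ rel n0 wt_v) -wtS raiseZ scalerA; congr (_ *: _).
by field; rewrite !wt0.
Qed.

(** At the weight 1 the lowered vector has weight -1, i.e. it is a vector of weight
    1 which is rotated backwards. *)
Lemma weight_kact_lower j v : weight J (wt j)%:R v ->
  weight_kact k (btens (Y j v) 1) =
    (so2_mul (so2_exp (wt j) k) (so2_inv (so2_exp 2 k))).1 *: btens (Y j v) 1
    + (so2_mul (so2_exp (wt j) k) (so2_inv (so2_exp 2 k))).2 *: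
        btens (Y j (partner (wt j) v)) 1.
Proof.
move=> wt_v; have n0 := wt0 j; have k1 := so2P k.
have wt_u := weight_lower rel n0 wt_v.
have YJ : J (Y j v) = ((wt j)%:R - 2) *: Y j (partner (wt j) v).
  rewrite /partner /Y (lowerJ rel n0 wt_v) lowerZ; lmod rat V; ring.
have norm2 : (so2_exp 2 k).1 ^+ 2 + (so2_exp 2 k).2 ^+ 2 = 1 := so2P _.
move: wt_v n0 wt_u YJ; case: j => [|j] wt_v n0 wt_u YJ.
  have wt_u0 : weight J (wt 0)%:R (Y 0 v) by rewrite /weight wt_u; congr (- _ *: _); ring.
  rewrite (weight_kactE _ wt_u0) /rotation (_ : wt 0 = 1%N) // so2_exp1.
  have -> : partner 1 (Y 0 v) = - Y 0 (partner 1 v).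
    by rewrite /partner YJ invr1 scale1r; lmod rat V; ring.
  rewrite btensN scalerN -scaleNr; congr (_ *: _ + _ *: _).
    by rewrite -[LHS]mulr1 -k1 /so2_exp /=; ring.
  by rewrite -[LHS]mulr1 -k1 /so2_exp /=; ring.
have wt_u' : weight J (wt j)%:R (Y j.+1 v).
  by have <- : (wt j.+1)%:R - 2 = (wt j)%:R :> rat by rewrite wtS addrK.
rewrite (weight_kactE _ wt_u') /rotation.
have -> : partner (wt j) (Y j.+1 v) = Y j.+1 (partner (wt j.+1) v).
  rewrite {1}/partner YJ (_ : (wt j.+1)%:R - 2 = (wt j)%:R); last by rewrite wtS addrK.
  by rewrite scalerA mulVf ?wt0 // scale1r.
have -> : so2_exp (wt j.+1) k = so2_mul (so2_exp 2 k) (so2_exp (wt j) k).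
  by rewrite -so2_expD.
congr (_ *: _ + _ *: _); rewrite -[LHS]mulr1 -norm2; set k2 := so2_exp 2 k; rewrite /=; ring.
Qed.

(** For h and q this is the addition theorem: k^2 rotates the plane spanned by h and q
    under Ad, and k^2 k^n = k^(n+2) and k^(-2) k^n = k^(n-2) on the raised and the
    lowered vector. *)
Lemma weight_kact_gact (Z : sl2 A) t :
  weight_kact k (base_change_act weight_gact Z t) =
  base_change_act weight_gact (so2_Ad k Z) (weight_kact k t).
Proof.
move: t; apply: weight_eq => [a t u|a t u|j v wt_v].
- by rewrite B K.
- by rewrite K B.
have n0 := wt0 j; have wt_v' := partner_weight wt_v.
have vK := partnerK wt_v.
have Jv : J v = (wt j)%:R *: partner (wt j) v.
  by rewrite /partner scalerA mulfV ?wt0 // scale1r.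
have Jv' : J (partner (wt j) v) = - ((wt j)%:R *: v).
  by rewrite -scalerN -vK [in RHS]/partner scalerA mulfV // scale1r.
have hv : h v = X j v + Y j v by rewrite raise_add_lower.
have hv' : h (partner (wt j) v) = X j (partner (wt j) v) + Y j (partner (wt j) v).
  by rewrite raise_add_lower.
have qv : q v = X j (partner (wt j) v) - Y j (partner (wt j) v).
  by rewrite (q_raise_lower rel n0 wt_v) Jv raiseZ lowerZ -scalerBr scalerA mulVf // scale1r.
have qv' : q (partner (wt j) v) = Y j v - X j v.
  rewrite (q_raise_lower rel n0 wt_v') Jv' -scaleNr raiseZ lowerZ -scalerBr scalerA.
  by rewrite mulrN mulVf // scaleN1r opprB.
have rX := weight_kact_raise wt_v; have rX' := weight_kact_raise wt_v'.
have rY := weight_kact_lower wt_v; have rY' := weight_kact_lower wt_v'.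
have rv := weight_kactE k wt_v; have rv' := weight_kactE k wt_v'.
move: rX' rY' rv'; rewrite /rotation vK.
have -> : X j (- v) = - X j v by rewrite -scaleN1r /X raiseZ scaleN1r.
have -> : Y j (- v) = - Y j v by rewrite -scaleN1r /Y lowerZ scaleN1r.
rewrite !btensN => rX' rY' rv'.
move: rv hv hv' qv qv' Jv Jv' rX rY rX' rY' rv'; rewrite /rotation.
move: (X j v) (X j (partner (wt j) v)) (Y j v) (Y j (partner (wt j) v)) => x x' y y'.
move: (partner (wt j) v) => v' rv hv hv' qv qv' Jv Jv' rX rY rX' rY' rv'.
rewrite rv !(linP (B _)) !base_change_gactE.
have [-> -> ->] := so2_AdE k Z.
rewrite hv hv' qv qv' Jv Jv' !(btensD, btensN, btensZ).
rewrite !(linP K) rX rY rX' rY' rv'.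
have -> : so2_exp 2 k = so2_mul k k by rewrite so2_expS so2_exp1.
rewrite !(so2_expS _.+1) so2_mulA.
set e := so2_exp (wt j) k; move: ((wt j)%:R%:A) => n.
rewrite /=; lmod A (base_change V A); rewrite /=; ring.
Qed.
End Equivariance.

Lemma weight_gact_coord a b c v : weight_gact (mk_sl2 a (b - c) (b + c)) v =
  a *: h v + b *: q v + c *: J v.
Proof.
by rewrite /weight_gact !mxE /=; lmod rat V; field.
Qed.

Lemma weight_gactJ v : weight_gact sl2_J v = J v.
Proof.
have -> : sl2_J = mk_sl2 0 (0 - 1) (0 + 1) by rewrite /sl2_J sub0r add0r.
by rewrite weight_gact_coord !scale0r !add0r scale1r.
Qed.

Lemma weight_gacth v : weight_gact (mk_sl2 1 0 0) v = h v.
Proof.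
have -> : mk_sl2 1 0 0 = mk_sl2 1 (0 - 0) (0 + 0) :> sl2 rat by rewrite subr0.
by rewrite weight_gact_coord !scale0r !addr0 scale1r.
Qed.

Lemma weight_gact_differential (t : rat) v : weight_kact (so2_tangent t) (btens v 1) =
  btens v 1 + btens (weight_gact (t *: sl2_J) v) eps.
Proof.
rewrite weight_kact_tangent -weight_gactJ.
by have /linP L := weight_gact_linearl v; rewrite !L.
Qed.

(** An sl_2-module which is a sum of vectors of odd weight integrates to K. *)
Definition weight_gK : gK_module :=
  @GKModule V weight_gact (fun A k => weight_kact k) weight_gact_linearl weight_gact_linear
    weight_gact_bracket (fun A k => weight_kact_linear k) (fun A => @weight_kact1 A)
    (fun A => @weight_kactM A) weight_kact_natural (fun A => @weight_kact_gact A)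
    weight_gact_differential.

End Integration.

(** * Trigonometric expansions *)

(** Subtracting l N times the relation from its image under T shortens the relation. *)
Lemma eigenvectors_independent (F : fieldType) (V : lmodType F) (T : V -> V)
    (l : nat -> F) (N : nat) (v : nat -> V) :
  linear T -> injective l -> (forall n, T (v n) = l n *: v n) ->
  \sum_(n < N) v n = 0 -> forall n, (n < N)%N -> v n = 0.
Proof.
move=> TL l_inj; elim: N v => // N IHN v Tv Ev.
have sumT : \sum_(n < N.+1) l n *: v n = 0.
  transitivity (T (\sum_(n < N.+1) v n)); last by rewrite Ev (linP TL).
  by rewrite lin_sum //; apply: eq_bigr => n _; rewrite Tv.
have vN n : (n < N)%N -> v n = 0.
  move=> lt_n; have : (l n - l N) *: v n = 0.
    apply: (IHN (fun n => (l n - l N) *: v n)) => // [i|].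
      by rewrite (linP TL) Tv !scalerA mulrC.
    have : \sum_(n < N.+1) (l n - l N) *: v n = 0.
      under eq_bigr do rewrite scalerBl.
      by rewrite sumrB sumT -scaler_sumr Ev scaler0 subr0.
    by rewrite big_ord_recr /= subrr scale0r addr0.
  move/eqP; rewrite scaler_eq0 subr_eq0 => /orP[/eqP /l_inj E|/eqP //].
  by rewrite E ltnn in lt_n.
move=> n; rewrite ltnS leq_eqVlt => /predU1P[->|/vN //].
by move: Ev; rewrite big_ord_recr /= big1 ?add0r // => i _; exact: vN.
Qed.

Fact so2_two_subproof : ((5 / 4 : Qi) ^+ 2 + ((3 / 4 : Qi) * sqrtm1) ^+ 2 == 1).
Proof. by apply/eqP. Qed.

(** The point of SO(2) over Q(i) at which x - iy takes the value 2. *)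
Definition so2_two : so2 Qi := @SO2 Qi (5 / 4, 3 / 4 * sqrtm1) so2_two_subproof.

Lemma sqrtm1_sqr : sqrtm1 * sqrtm1 = -1.
Proof. by apply/eqP. Qed.

Lemma so2_exp_two n :
  (so2_exp n so2_two).1 = (2 ^+ n + 2 ^- n) / 2 /\
  (so2_exp n so2_two).2 = sqrtm1 * ((2 ^+ n - 2 ^- n) / 2).
Proof.
have two0 : (2 : Qi) != 0 by [].
elim: n => [|n [IH1 IH2]].
  by rewrite /= expr0 invr1 subrr mul0r mulr0; split=> //; rewrite -[1 + 1]/2 mulfV.
rewrite so2_expS /= IH1 IH2 !exprS !invfM.
have n0 : (2 : Qi) ^+ n != 0 by rewrite expf_neq0.
split.
- transitivity (5 / 4 * ((2 ^+ n + 2 ^- n) / 2)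
      - (sqrtm1 * sqrtm1) * (3 / 4 * ((2 ^+ n - 2 ^- n) / 2) : Qi)); first by ring.
  by rewrite sqrtm1_sqr; field; apply/and3P; split.
- by field; apply/and3P; split.
Qed.

(** 2^n + 2^-n determines n, so that the powers of this point separate frequencies. *)
Lemma so2_exp_two_inj : injective (fun n => (so2_exp n so2_two).1).
Proof.
move=> m n /=; have [-> _] := so2_exp_two m; have [-> _] := so2_exp_two n.
have two0 : (2 : Qi) != 0 by [].
move=> /(mulIf (invr_neq0 two0)) E.
have m0 : (2 : Qi) ^+ m != 0 by rewrite expf_neq0.
have n0 : (2 : Qi) ^+ n != 0 by rewrite expf_neq0.
have /eqP : (2 ^+ m - 2 ^+ n) * (1 - 2 ^- (m + n)) = 0 :> Qi.
  transitivity ((2 ^+ m + 2 ^- m) - (2 ^+ n + 2 ^- n) : Qi); last by rewrite E subrr.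
  by rewrite exprD; field; apply/andP; split.
have cast k : (2 : Qi) ^+ k = (2 ^ k)%N%:R by rewrite natrX.
have natI : injective (fun k : nat => k%:R : Qi).
  move=> k l /= E'; apply/eqP; rewrite -(Num.Theory.eqr_nat rat).
  move: E'; rewrite -!(rmorph_nat (GRing.in_alg Qi)) => /fmorph_inj E'.
  by apply/eqP.
rewrite mulf_eq0 !subr_eq0 => /orP[/eqP|/eqP].
  by rewrite !cast => /natI /eqP; rewrite eqn_exp2l // => /eqP.
move/esym/(canRL (@invrK _)); rewrite invr1 cast => /(natI _ 1%N) /eqP.
rewrite -[1%N]/(2 ^ 0)%N eqn_exp2l // addn_eq0 => /andP[/eqP-> /eqP->] //.
Qed.

Lemma so2_exp_two_neq0 n : (0 < n)%N -> (so2_exp n so2_two).2 != 0.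
Proof.
move=> n_gt0; apply/eqP => E.
have E1 : (so2_exp n so2_two).1 ^+ 2 = 1 by rewrite -[RHS](so2P (so2_exp n so2_two)) E expr0n addr0.
have E2 : so2_exp (n + n) so2_two = so2_one.
  by rewrite so2_expD; apply: so2_eq; rewrite /= E ?(mul0r, mulr0, subr0, addr0) -?expr2 ?E1.
have : (so2_exp (n + n) so2_two).1 = (so2_exp 0 so2_two).1 by rewrite E2.
by move/so2_exp_two_inj/eqP; rewrite addn_eq0 andbb => /eqP n0; rewrite n0 in n_gt0.
Qed.

Section Trigonometric.
Variables (U : lmodType Qi) (a b : nat -> U) (N : nat).

(** The average of the translates of a function by l and by its inverse is
    cos (n s) times the function if it is cos (n t) or sin (n t), where l is the rotation
    by s; so functions of different frequencies are eigenvectors with different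
    eigenvalues as soon as l separates frequencies. *)
Lemma trigonometric_independent :
  (forall k : so2 Qi, \sum_(n < N) ((so2_exp n k).1 *: a n + (so2_exp n k).2 *: b n) = 0) ->
  forall n, (n < N)%N -> a n = 0 /\ ((0 < n)%N -> b n = 0).
Proof.
move=> E; set l := so2_two.
pose T (u : so2 Qi -> U) : so2 Qi -> U :=
  fun k => 2^-1 *: (u (so2_mul k l) + u (so2_mul k (so2_inv l))).
pose u n (k : so2 Qi) := (so2_exp n k).1 *: a n + (so2_exp n k).2 *: b n.
have TL : linear T.
  by move=> r v w; apply/funext => k; rewrite /T !fctE; lmod Qi U; ring.
have u0 := @eigenvectors_independent _ (so2 Qi -> U) T
  (fun n => (so2_exp n l).1) N u TL so2_exp_two_inj.
have Tu n : T (u n) = (so2_exp n l).1 *: u n.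
  apply/funext => k; rewrite /T /u !fctE /= !so2_expM so2_expV /=.
  by lmod Qi U; field.
have sumu : \sum_(n < N) u n = 0.
  by apply/funext => k; rewrite fct_sumE; exact: E.
move=> n lt_n; have un := u0 Tu sumu n lt_n.
have an : a n = 0.
  have : u n so2_one = 0 by rewrite un.
  by rewrite /u so2_exp_one /= scale1r scale0r addr0.
split=> // n_gt0.
have : u n l = 0 by rewrite un.
rewrite /u an scaler0 add0r => /eqP.
by rewrite scaler_eq0 (negPf (so2_exp_two_neq0 n_gt0)) => /eqP.
Qed.
End Trigonometric.

(** * The coordinate ring of SO(2) *)

(** The pair (p, q) stands for p(x) + y q(x) in Q[x, y]/(x^2 + y^2 - 1). *)
Definition circle_ring : Type := ({poly rat} * {poly rat})%type.
HB.instance Definition _ := GRing.Lmodule.copy circle_ring ({poly rat} * {poly rat})%type.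

Section CircleRing.
Implicit Types f g e : circle_ring.

Definition circle_mul f g : circle_ring :=
  (f.1 * g.1 + (1 - 'X^2) * (f.2 * g.2), f.1 * g.2 + f.2 * g.1).
Definition circle_one : circle_ring := (1, 0).

Let pairE (f g : circle_ring) : f.1 = g.1 -> f.2 = g.2 -> f = g.
Proof. by case: f g => ? ? [? ?] /= -> ->. Qed.

Fact circle_mulA : associative circle_mul.
Proof. by move=> f g e; apply: pairE => /=; ring. Qed.
Fact circle_mulC : commutative circle_mul.
Proof. by move=> f g; apply: pairE => /=; ring. Qed.
Fact circle_mul1 : left_id circle_one circle_mul.
Proof. by move=> f; apply: pairE => /=; ring. Qed.
Fact circle_mulDl : left_distributive circle_mul +%R.
Proof. by move=> f g e; apply: pairE => /=; ring. Qed.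
Fact circle_oner_neq0 : circle_one != 0.
Proof. by apply/eqP => /(congr1 fst) /eqP; rewrite oner_eq0. Qed.

HB.instance Definition _ := GRing.Zmodule_isComNzRing.Build circle_ring
  circle_mulA circle_mulC circle_mul1 circle_mulDl circle_oner_neq0.

Fact circle_scaleAl (r : rat) f g : r *: circle_mul f g = circle_mul (r *: f) g.
Proof.
by apply: pairE; rewrite /= -!mul_polyC; ring.
Qed.
HB.instance Definition _ := GRing.Lmodule_isLalgebra.Build rat circle_ring circle_scaleAl.
HB.instance Definition _ := GRing.Lalgebra_isComAlgebra.Build rat circle_ring.

End CircleRing.

Fact circle_point_subproof :
  (('X, 0) : circle_ring) ^+ 2 + ((0, 1) : circle_ring) ^+ 2 == 1.
Proof.
apply/eqP; rewrite !expr2; apply/pair_eqP/andP; split; apply/eqP => /=; ring.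
Qed.
Definition circle_point : so2 circle_ring :=
  @SO2 circle_ring (('X, 0), (0, 1)) circle_point_subproof.

Section CircleEval.
Variables (A : comAlgType rat) (k : so2 A).

(** Evaluation at k shows that [circle_point] is the universal point of SO(2). *)
Definition circle_eval (f : circle_ring) : A :=
  horner_alg k.1 f.1 + k.2 * horner_alg k.1 f.2.

Fact circle_eval_linear : linear circle_eval.
Proof.
by move=> r f g; rewrite /circle_eval /= !linearP /= !mulr_algl mulrDr -scalerAr scalerDr addrACA.
Qed.

Fact circle_eval_monoid : monoid_morphism circle_eval.
Proof.
split; first by rewrite /circle_eval /= rmorph1 rmorph0 mulr0 addr0.
move=> f g; rewrite /circle_eval /=.
have : horner_alg k.1 (1 - 'X^2) = k.2 ^+ 2.
  by rewrite rmorphB rmorph1 rmorphXn /= horner_algX -(so2P k); ring.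
move: (1 - 'X^2) => s Es.
by rewrite !(rmorphD, rmorphM) /= Es; ring.
Qed.

Definition circle_evalM : {lrmorphism circle_ring -> A} :=
  HB.pack circle_eval
    (GRing.isLinear.Build rat circle_ring A *:%R circle_eval circle_eval_linear)
    (GRing.isMonoidMorphism.Build circle_ring A circle_eval circle_eval_monoid).

Lemma so2_map_circle_point : so2_map circle_evalM circle_point = k.
Proof.
by apply: so2_eq; rewrite /= /circle_eval /= ?horner_algX ?rmorph0 ?rmorph1; ring.
Qed.

End CircleEval.

(** By the addition theorem the products of x and y with cos (n t) and sin (n t) are combinations of
    cos and sin of (n + 1) t and (n - 1) t; hence these functions span the coordinate
    ring. *)
Section Span.

Let C n := (so2_exp n circle_point).1.
Let S n := (so2_exp n circle_point).2.
Let x : circle_ring := ('X, 0).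
Let y : circle_ring := (0, 1).

(** The bound N' is arbitrary above N so that two expansions have a common length. *)
Definition trigonometric (f : circle_ring) : Prop := exists (N : nat) (a b : nat -> rat),
  forall N', (N <= N')%N -> f = \sum_(n < N') (a n *: C n + b n *: S n).

Lemma trigonometric_lin (r : rat) f g :
  trigonometric f -> trigonometric g -> trigonometric (r *: f + g).
Proof.
move=> [N [a [b E]]] [N' [a' [b' E']]].
exists (maxn N N'), (fun n => r * a n + a' n), (fun n => r * b n + b' n) => M.
rewrite geq_max => /andP[/E {1}-> /E' {1}->].
rewrite scaler_sumr -big_split; apply: eq_bigr => n _ /=.
by lmod rat circle_ring; ring.
Qed.

Lemma trigonometric0 : trigonometric 0.
Proof.
by exists 0%N, (fun=> 0), (fun=> 0) => N _; rewrite big1 // => n _; rewrite !scale0r addr0.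
Qed.

Lemma trigonometric_basis n (r s : rat) : trigonometric (r *: C n + s *: S n).
Proof.
exists n.+1, (fun m => if m == n then r else 0), (fun m => if m == n then s else 0) => N lt_n.
rewrite (bigD1 (Ordinal lt_n)) //= eqxx big1 ?addr0 // => m.
by rewrite -val_eqE /= => /negPf ->; rewrite !scale0r addr0.
Qed.

Lemma trigonometric_C n : trigonometric (C n).
Proof. by have := trigonometric_basis n 1 0; rewrite scale1r scale0r addr0. Qed.
Lemma trigonometric_S n : trigonometric (S n).
Proof. by have := trigonometric_basis n 0 1; rewrite scale1r scale0r add0r. Qed.

Let xy1 : x ^+ 2 + y ^+ 2 = 1.
Proof. exact: (so2P circle_point). Qed.

Let half_sum (f g e : circle_ring) : trigonometric g -> trigonometric e ->
  f + f = g + e -> trigonometric f.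
Proof.
move=> tg te E; have -> : f = 2^-1 *: g + (2^-1 *: e + 0).
  by rewrite addr0 -scalerDr -E; lmod rat circle_ring; field.
by do 2!apply: trigonometric_lin => //; exact: trigonometric0.
Qed.

Let trigonometricN f : trigonometric f -> trigonometric (- f).
Proof.
by move=> tf; rewrite -scaleN1r -[_ *: f]addr0; apply: trigonometric_lin => //; exact: trigonometric0.
Qed.

Let C1 n : C n.+1 = x * C n - y * S n. Proof. by []. Qed.
Let S1 n : S n.+1 = x * S n + y * C n. Proof. by []. Qed.

Let Cp n : C n = x * C n.+1 + y * S n.+1.
Proof. by rewrite C1 S1 -[LHS]mulr1 -xy1; ring. Qed.
Let Sp n : S n = x * S n.+1 - y * C n.+1.
Proof. by rewrite C1 S1 -[LHS]mulr1 -xy1; ring. Qed.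

Let C0 : C 0 = 1. Proof. by []. Qed.
Let S0 : S 0 = 0. Proof. by []. Qed.

Lemma trigonometric_mul n : [/\ trigonometric (x * C n), trigonometric (x * S n),
  trigonometric (y * C n) & trigonometric (y * S n)].
Proof.
case: n => [|n].
  have Ex : x = C 1 by rewrite C1 C0 S0; ring.
  have Ey : y = S 1 by rewrite S1 C0 S0; ring.
  rewrite C0 S0 !mulr1 !mulr0 Ex Ey.
  by split; [exact: trigonometric_C|exact: trigonometric0|exact: trigonometric_S|exact: trigonometric0].
have [tC tS] : (forall m, trigonometric (C m)) * (forall m, trigonometric (S m)).
  by split=> m; [exact: trigonometric_C|exact: trigonometric_S].
split.
- by apply: (@half_sum _ (C n) (C n.+2)); rewrite // [C n.+2]C1 (Cp n); ring.
- by apply: (@half_sum _ (S n) (S n.+2)); rewrite // [S n.+2]S1 (Sp n); ring.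
- apply: (@half_sum _ (S n.+2) (- S n)) => //; first exact: trigonometricN.
  by rewrite [S n.+2]S1 (Sp n); ring.
- apply: (@half_sum _ (C n) (- C n.+2)) => //; first exact: trigonometricN.
  by rewrite [C n.+2]C1 (Cp n); ring.
Qed.

Lemma trigonometric_mulxy f : trigonometric f -> trigonometric (x * f) /\ trigonometric (y * f).
Proof.
move=> [N [a [b /(_ N (leqnn N)) ->]]].
elim/big_ind: _ => [|g e [gx gy] [ex ey]|n _].
- by rewrite !mulr0; split; exact: trigonometric0.
- by rewrite !mulrDr -[x * g]scale1r -[y * g]scale1r; split; apply: trigonometric_lin.
have [xC xS yC yS] := trigonometric_mul n.
by rewrite !mulrDr -!scalerAr -[b n *: _ in X in X /\ _]addr0 -[b n *: _ in X in _ /\ X]addr0;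
  split; do 2!apply: trigonometric_lin => //; exact: trigonometric0.
Qed.

Lemma circle_ring_trigonometric f : trigonometric f.
Proof.
have t0 := trigonometric0.
have tp (p : {poly rat}) : trigonometric ((p, 0) : circle_ring).
  elim/poly_ind: p => [|p c tp]; first exact: t0.
  have -> : (p * 'X + c%:P, 0) = c *: C 0 + x * (p, 0) :> circle_ring.
    rewrite C0 addrC; congr pair; rewrite /= -?mul_polyC; ring.
  by apply: trigonometric_lin; [exact: trigonometric_C|case: (trigonometric_mulxy tp)].
case: f => p q.
have -> : (p, q) = 1 *: (p, 0) + y * (q, 0) :> circle_ring.
  rewrite scale1r; congr pair; rewrite /= ; ring.
by apply: trigonometric_lin => //; case: (trigonometric_mulxy (tp q)).
Qed.

End Span.

(** * Weights of (g, K)-modules *)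

(** Applying a linear form of A to the second factor shows that m |-> m (x) a is injective. *)
Section Functional.
Variables (V : lmodType rat) (A : comAlgType rat) (phi : A -> rat).
Hypothesis phiL : forall r x y, phi (r *: x + y) = r * phi x + phi y.

Definition bc_functional (t : base_change V A) : V :=
  @tens_lift rat A V (scalars A) V (fun m (a : scalars A) => phi (a : A) *: m) t.

Let phi0 : phi 0 = 0.
Proof. by have := phiL (-1) 0 0; rewrite scaler0 addr0 mulN1r addNr. Qed.

Let bal : @balanced rat A V (scalars A) V (fun m (a : scalars A) => phi (a : A) *: m).
Proof.
split=> [w w' b|w b b'|r w b]; first by rewrite scalerDr.
- by have := phiL 1 b b'; rewrite scale1r mul1r => E; rewrite [X in X *: w = _]E scalerDl.
- rewrite scalerA mulrC; congr (_ *: _).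
  by have := phiL r b 0; rewrite !addr0 phi0 addr0.
Qed.

Lemma bc_functionalE m a : bc_functional (btens m a) = phi a *: m.
Proof. exact: tens_liftE. Qed.

Lemma bc_functionalD t u : bc_functional (t + u) = bc_functional t + bc_functional u.
Proof. exact: tens_liftD. Qed.

Lemma btens_inj (a : A) (m m' : V) : phi a != 0 -> btens m a = btens m' a :> base_change V A -> m = m'.
Proof. by move=> a0 /(congr1 bc_functional); rewrite !bc_functionalE => /(scalerI a0). Qed.

End Functional.

Lemma Re_lin r (x y : Qi) : Re (r *: x + y) = r * Re x + Re y.
Proof. by case: x y => ? ? [? ?]. Qed.

Lemma btens_Qi_inj (V : lmodType rat) : injective (fun m : V => btens m (1 : Qi)).
Proof. by move=> m m'; apply: (btens_inj Re_lin). Qed.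

Lemma btens_rat_inj (V : lmodType rat) : injective (fun m : V => btens m (1 : rat^o)).
Proof. by move=> m m'; exact: (@btens_inj V rat^o (fun x => x) (fun r x y => erefl) 1). Qed.

Lemma btens_eps_inj (V : lmodType rat) : injective (fun m : V => btens m eps).
Proof.
move=> m m'; apply: (btens_inj (phi := fun f : dualQ => (val f)`_1)).
  by move=> r x y; rewrite /= coefD coefZ.
have -> : val eps = 'X :> {poly rat}.
  by rewrite -[LHS]/(polyn eps) /eps qpolyXE ?monicXn ?size_polyXn.
by rewrite coefX.
Qed.

HB.instance Definition _ (M : gK_module) (Z : sl2 rat) :=
  GRing.isLinear.Build rat M M *:%R (@gact M Z) (@gact_linear M Z).

Section Operators.
Variable M : gK_module.

Definition gh : {linear M -> M} := @gact M (mk_sl2 1 0 0).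
Definition gq : {linear M -> M} := @gact M (mk_sl2 0 1 1).
Definition gJ : {linear M -> M} := @gact M sl2_J.

Lemma gact_coord a b c v : gact (mk_sl2 a (b - c) (b + c)) v =
  a *: gh v + b *: gq v + c *: gJ v.
Proof.
have L := linP (gact_linearl v).
suff -> : mk_sl2 a (b - c) (b + c) = a *: mk_sl2 1 0 0 + b *: mk_sl2 0 1 1 + c *: sl2_J.
  by rewrite !L.
apply: val_inj; apply/matrixP => i j; rewrite !mxE.
by case: i j => [[|[|//]] ?] [[|[|//]] ?] /=; ring.
Qed.

Lemma gact_eq (Z : sl2 rat) : Z = mk_sl2 (Z 0 0) (Z 0 1) (Z 1 0).
Proof.
apply: val_inj; apply/matrixP => i j; rewrite !mxE.
have tr := sl2_11 Z.
have E0 (p : (0 < 2)%N) : Ordinal p = 0 by apply: val_inj.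
have E1 (p : (1 < 2)%N) : Ordinal p = 1 by apply: val_inj.
by case: i j => [[|[|//]] i] [[|[|//]] j] /=; rewrite ?E0 ?E1.
Qed.

Lemma gK_relations : sl2_relations gh gq gJ.
Proof.
have br Y Z W v : bracket Y Z = W -> gact Y (gact Z v) - gact Z (gact Y v) = gact W v :> M.
  by move=> <-; rewrite gact_bracket.
have mxE' (Y Z : sl2 rat) : Y 0 0 = Z 0 0 -> Y 0 1 = Z 0 1 -> Y 1 0 = Z 1 0 -> Y = Z.
  by move=> E1 E2 E3; rewrite (gact_eq Y) (gact_eq Z) E1 E2 E3.
have o : lift ord0 ord0 = 1 :> 'I_2 by apply: val_inj.
have calc v := linP (@gact_linearl M v).
split=> v.
- apply/eqP; rewrite -subr_eq0 opprB addrA addrAC /gh /gq /=.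
  rewrite (br _ _ (- 2 *: sl2_J)) ?(calc v) ?scaleNr ?addNr //.
  by apply: mxE'; rewrite /= !mxE ?big_ord_recl ?big_ord0 /= ?mxE /= ?o /=; ring.
- apply/eqP; rewrite -subr_eq0 opprB addrA addrAC /gJ /gq /=.
  rewrite (br _ _ (- 2 *: mk_sl2 1 0 0)) ?(calc v) ?scaleNr ?addNr //.
  by apply: mxE'; rewrite /= !mxE ?big_ord_recl ?big_ord0 /= ?mxE /= ?o /=; ring.
- apply/eqP; rewrite -subr_eq0 opprD addrA /gh /gJ /=.
  rewrite (br _ _ (2 *: mk_sl2 0 1 1)) ?(calc v) ?subrr //.
  by apply: mxE'; rewrite /= !mxE ?big_ord_recl ?big_ord0 /= ?mxE /= ?o /=; ring.
Qed.

End Operators.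

Section Expansion.
Variable M : gK_module.

Let cs (A : comAlgType rat) (k : so2 A) (n : nat) (a b : M) : base_change M A :=
  (so2_exp n k).1 *: btens a 1 + (so2_exp n k).2 *: btens b 1.

Lemma circle_expansion (t : base_change M circle_ring) :
  exists (N : nat) (a b : nat -> M), forall N', (N <= N')%N ->
    t = \sum_(n < N') cs circle_point n (a n) (b n).
Proof.
elim/tens_ind: t => [|t u [N [a [b E]]] [N2 [a2 [b2 E2]]]|m f].
- exists 0%N, (fun=> 0), (fun=> 0) => N _.
  by rewrite big1 // => n _; rewrite /cs !btens0 !scaler0 addr0.
- exists (maxn N N2), (fun n => a n + a2 n), (fun n => b n + b2 n) => M'.
  rewrite geq_max => /andP[/E {1}-> /E2 {1}->].
  rewrite -big_split; apply: eq_bigr => n _ /=.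
  by rewrite /cs !btensD; lmod circle_ring (base_change M circle_ring); ring.
have [N [a [b E]]] := circle_ring_trigonometric f.
exists N, (fun n => a n *: m), (fun n => b n *: m) => N' /E {1}->.
rewrite -[ptens m _]/(btens m _) btensE scaler_suml; apply: eq_bigr => n _.
rewrite /cs !btensZ scalerDl !scalerA; congr (_ *: _ + _ *: _).
  by rewrite mulrC mulr_algl.
by rewrite mulrC mulr_algl.
Qed.

(** Expand the image of m under the universal point and specialize it to k. The
    coefficient of sin 0 is arbitrary and is normalized to 0. *)
Lemma kact_expansion (m : M) : exists (N : nat) (a b : nat -> M), b 0%N = 0 /\
  forall (A : comAlgType rat) (k : so2 A) N', (N <= N')%N ->
    kact k (btens m 1) = \sum_(n < N') cs k n (a n) (b n).
Proof.
have [N [a [b E]]] := circle_expansion (kact circle_point (btens m 1)).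
exists N, a, (fun n => if n == 0%N then 0 else b n); split=> // A k N' le_N.
rewrite -{1}(so2_map_circle_point k) -[btens m 1](base_change_map_btens1 (circle_evalM k)).
rewrite kact_natural (E _ le_N).
have sumE : forall F : 'I_N' -> base_change M circle_ring,
    base_change_map (circle_evalM k) (\sum_n F n) = \sum_n base_change_map (circle_evalM k) (F n).
  by move=> F; apply: big_morph => [x y|]; rewrite (base_change_mapD, base_change_map0).
rewrite sumE; apply: eq_bigr => n _.
have expE : so2_exp n k = so2_map (circle_evalM k) (so2_exp n circle_point).
  by rewrite -so2_exp_map so2_map_circle_point.
rewrite /cs base_change_mapD !base_change_mapZ !base_change_map_btens1 expE.
case: eqP => [n0|//]; congr (_ + _); rewrite -expE n0.
by rewrite -[(so2_exp 0 circle_point).2]/0 rmorph0 -[(so2_exp 0 k).2]/0 !scale0r.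
Qed.

(** In the plane of a and b, where b is a turned by a right angle, K acts by n-th powers. *)
Definition rotates (n : nat) (a b : M) : Prop :=
  forall (A : comAlgType rat) (k : so2 A), kact k (btens a 1) = cs k n a b.

(** The expansion of the image of a is valid over every A, and over Q(i) its coefficients
    are unique. *)
Lemma rotates_Qi n (a b : M) : (n = 0%N -> b = 0) ->
  (forall k : so2 Qi, kact k (btens a 1) = cs k n a b) -> rotates n a b.
Proof.
move=> b0 Eab; have [N [a' [b' [b'0 E]]]] := kact_expansion a.
pose N' := maxn N n.+1.
have le_N : (N <= N')%N by rewrite leq_maxl.
have lt_n : (n < N')%N by rewrite leq_max ltnSn orbT.
have split_n (A : comAlgType rat) (k : so2 A) (c d : nat -> M) : (forall r, r != n -> c r = 0 /\ d r = 0) ->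
    \sum_(r < N') cs k r (c r) (d r) = cs k n (c n) (d n).
  move=> z; rewrite (bigD1 (Ordinal lt_n)) //= big1 ?addr0 // => r.
  by rewrite -val_eqE /= => /z[-> ->]; rewrite /cs !btens0 !scaler0 addr0.
pose da r : M := if r == n then a else 0; pose db r : M := if r == n then b else 0.
have Ed (A : comAlgType rat) (k : so2 A) : cs k n a b = \sum_(r < N') cs k r (da r) (db r).
  rewrite split_n /da /db ?eqxx // => r /negPf -> //.
have ind := @trigonometric_independent (base_change M Qi)
  (fun r => btens (a' r - da r) 1) (fun r => btens (b' r - db r) 1) N'.
have {}ind r : (r < N')%N -> a' r = da r /\ b' r = db r.
  move=> lt_r; have [k|Ea Eb] := ind _ r lt_r.
    transitivity (kact k (btens a 1) - cs k n a b); last by rewrite Eab subrr.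
    rewrite (E _ k _ le_N) Ed -sumrB; apply: eq_bigr => i _.
    by rewrite /cs !btensD !btensN; lmod Qi (base_change M Qi); ring.
  have inj := @btens_Qi_inj M.
  split; first by apply/eqP; rewrite -subr_eq0; apply/eqP/inj; rewrite Ea btens0.
  have [r0|r_gt0] := posnP r; last first.
    by apply/eqP; rewrite -subr_eq0; apply/eqP/inj; rewrite Eb // btens0.
  by rewrite r0 b'0 /db; case: eqP => // /esym /b0.
move=> A k; rewrite (E _ k _ le_N) Ed.
by apply: eq_bigr => r _; have [-> ->] := ind r (ltn_ord r).
Qed.

(** Differentiate at k = 1, i.e. take k = 1 + eps J. *)
Lemma rotates_J n (a b : M) : rotates n a b -> gJ M a = n%:R *: b.
Proof.
move=> /(_ dualQ (so2_tangent 1)); rewrite kact_differential /cs so2_exp_tangent /=.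
rewrite scale1r scale1r => /addrI; rewrite mulr1 => E.
apply: (@btens_eps_inj M); rewrite -[LHS]/(btens (gJ M a) eps) E.
by rewrite [RHS]btensE btensZ scalerA -scalerAr mulr1.
Qed.

Lemma rotates0 n : rotates n 0 0.
Proof.
move=> A k; rewrite /cs !btens0 !scaler0 addr0.
by rewrite (linP (kact_linear k)).
Qed.

(** Every vector is a sum of weight vectors, because the coefficients of the
    expansion of k m rotate themselves: compare the expansions of l (k m) and
    (l k) m as functions of k. *)
Lemma kact_weights (m : M) : exists (N : nat) (a b : nat -> M), [/\
  m = \sum_(n < N) a n,
  forall n, rotates n (a n) (b n),
  forall n, gJ M (a n) = n%:R *: b n,
  forall n, gJ M (b n) = - (n%:R *: a n) &
  forall n, (N <= n)%N -> a n = 0].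
Proof.
have [N [a [b [b0 E]]]] := kact_expansion m.
have rot n : (n < N)%N -> rotates n (a n) (b n) /\ ((0 < n)%N -> rotates n (b n) (- a n)).
  move=> lt_n.
  have main (l : so2 Qi) : kact l (btens (a n) 1) = cs l n (a n) (b n) /\
      kact l (btens (b n) 1) = cs l n (b n) (- a n).
    have L := linP (kact_linear (g := M) l).
    have ind := @trigonometric_independent (base_change M Qi)
      (fun r => kact l (btens (a r) 1) - cs l r (a r) (b r))
      (fun r => kact l (btens (b r) 1) - cs l r (b r) (- a r)) N.
    have [k|Ea Eb] := ind _ n lt_n.
      transitivity (kact l (kact k (btens m 1)) - kact (so2_mul l k) (btens m 1)); last first.
        by rewrite kactM subrr.
      rewrite !(E _ _ N) // lin_sum; last exact: kact_linear.
      rewrite -sumrB; apply: eq_bigr => i _.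
      rewrite /cs so2_expM !L /= btensN; lmod Qi (base_change M Qi); ring.
    split; first by apply/eqP; rewrite -subr_eq0 Ea.
    have [n0|n_gt0] := posnP n; last by apply/eqP; rewrite -subr_eq0 Eb.
    by rewrite n0 b0 /cs btens0 !scaler0 L scale0r addr0.
  split=> [|n_gt0]; apply: rotates_Qi => [n0|l]; rewrite ?n0 ?b0 //; try by case: (main l).
  by rewrite n0 in n_gt0.
pose t (c : nat -> M) n := if (n < N)%N then c n else 0.
exists N, (t a), (t b); split=> [|n|n|n|n]; rewrite /t.
- apply: (@btens_Qi_inj M); rewrite -[LHS](kact1 (g := M)) (E _ _ _ (leqnn N)) btens_sum.
  by apply: eq_bigr => n _; rewrite ltn_ord /cs so2_exp_one /= scale1r scale0r addr0.
- by case: ifP => [/rot[]|_] //; exact: rotates0.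
- case: ifP => [/rot[rn _]|_]; first exact: rotates_J.
  by rewrite linear0 scaler0.
- case: ifP => [/rot[_ rn]|_]; last by rewrite linear0 scaler0 oppr0.
  have [n0|n_gt0] := posnP n; first by rewrite n0 b0 linear0 scale0r oppr0.
  by rewrite (rotates_J (rn n_gt0)) scalerN.
- by rewrite ltnNge => ->.
Qed.

(** In a decomposition of v as in [kact_weights] the components are eigenvectors of J^2,
    so only that of frequency n is not zero. *)
Lemma rotates_weight n (v : M) : (0 < n)%N -> weight (gJ M) n%:R v ->
  rotates n v (n%:R^-1 *: gJ M v).
Proof.
move=> n_gt0 wt_v; have [N [a [b [Ev rot Ja Jb a0]]]] := kact_weights v.
have n0 : (n%:R : rat) != 0 by rewrite Num.Theory.pnatr_eq0 -lt0n.
pose d r : M := if r == n then v else 0.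
have JJL : linear (fun x => gJ M (gJ M x)) by move=> r x y; rewrite !linearP.
have inj : injective (fun r : nat => - (r%:R ^+ 2) : rat).
  move=> r s /= /oppr_inj /eqP; rewrite -!natrX Num.Theory.eqr_nat.
  by rewrite eqn_exp2r // => /eqP.
pose N' := maxn N n.+1.
have ind := @eigenvectors_independent _ M _ _ N' (fun r => a r - d r) JJL inj.
have lt_n : (n < N')%N by rewrite leq_max ltnSn orbT.
have Ean : a n = v.
  apply/eqP; rewrite -subr_eq0; apply/eqP.
  have := ind _ _ _ lt_n; rewrite /d eqxx; apply=> [r|].
    rewrite !(linE (gJ M)) Ja !(linE (gJ M)) Jb.
    case: eqP => [->|_]; first by rewrite wt_v; lmod rat M; ring.
    by rewrite !linear0; lmod rat M; ring.
  rewrite sumrB; apply/eqP; rewrite subr_eq0; apply/eqP.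
  rewrite [RHS](bigD1 (Ordinal lt_n)) //= /d eqxx [X in _ = _ + X]big1 => [|r]; last first.
    by rewrite -val_eqE /= => /negPf ->.
  rewrite addr0 [in RHS]Ev [RHS](big_ord_widen N' a) ?leq_maxl // [RHS]big_mkcond.
  by apply: eq_bigr => r _; case: ltnP => // /a0.
have -> : n%:R^-1 *: gJ M v = b n by rewrite -Ean Ja scalerA mulVf // scale1r.
by rewrite -{1}Ean; exact: rot.
Qed.

Hypothesis opp_one : opp_one_acts_by_opp M.

(** - 1_2 rotates by an even multiple of the half turn if n is even. *)
Lemma rotates_even n (a b : M) : rotates n a b -> ~~ odd n -> a = 0.
Proof.
move=> rot even_n; apply: (@btens_rat_inj M).
have := rot rat^o so2_opp_one; rewrite (opp_one _) /cs so2_exp_opp (negPf even_n) /=.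
rewrite scale1r scale0r addr0 btens0 => E.
have : (2 : rat^o) *: btens a (1 : rat^o) = 0 :> base_change M rat^o.
  by rewrite scaler_nat mulr2n -{1}E addNr.
by move/eqP; rewrite scaler_eq0 => /eqP.
Qed.

Lemma odd_weights (v : M) : exists (N : nat) (a : nat -> M),
  v = \sum_(j < N) a j /\ forall j, weight (gJ M) (wt j)%:R (a j).
Proof.
have [N [a [b [Ev rot Ja Jb a0]]]] := kact_weights v.
exists N, (fun j => a (wt j)); split=> [|j]; last first.
  by rewrite /weight Ja !(linE (gJ M)) Jb; lmod rat M; ring.
have sum2 (f : nat -> M) K : \sum_(n < K.*2) f n = \sum_(j < K) (f j.*2 + f j.*2.+1).
  by elim: K => [|K IHK]; rewrite ?big_ord0 // doubleS !big_ord_recr /= IHK addrA.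
rewrite [LHS]Ev (big_ord_widen N.*2 a) -?addnn ?leq_addr // addnn big_mkcond.
transitivity (\sum_(n < N.*2) a n).
  by apply: eq_bigr => n _; case: ltnP => // /a0.
by rewrite sum2; apply: eq_bigr => j _; rewrite (rotates_even (rot _)) ?add0r // odd_double.
Qed.

End Expansion.

(** * The module attached to a representation *)

(** Restricting scalars to Q, a vector space W over Q(i) with a semilinear map phi is
    a module with an operator I of square -1 which anticommutes with phi. *)
Section Model.
Variables (W : lmodType rat) (I phi : {linear W -> W}).

Definition finsupp_pred : pred (nat -> W) :=
  fun f => `[< exists N, forall k, (N <= k)%N -> f k = 0 >].
Definition finsupp := [qualify a f | finsupp_pred f].

Fact finsupp_submod_closed : submod_closed finsupp.
Proof.
split=> [|a f g /asboolP[N fN] /asboolP[N' gN]]; apply/asboolP; first by exists 0%N.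
exists (maxn N N') => k; rewrite geq_max => /andP[/fN fk /gN gk].
by rewrite !fctE /= fk gk scaler0 addr0.
Qed.
HB.instance Definition _ :=
  GRing.isSubmodClosed.Build rat (nat -> W) finsupp_pred finsupp_submod_closed.

Record model := Model { model_fun :> nat -> W; _ : model_fun \is a finsupp }.
HB.instance Definition _ := [isSub for model_fun].
HB.instance Definition _ := [Choice of model by <:].
HB.instance Definition _ := [SubChoice_isSubLmodule of model by <:].

Lemma model_finsupp (f : model) : exists N, forall k, (N <= k)%N -> f k = 0.
Proof. by have /asboolP := valP f. Qed.

Lemma model_eq (f g : model) : (forall k, f k = g k) -> f = g.
Proof. by move=> E; apply/val_inj/funext. Qed.

Lemma modelE (r : rat) (f g : model) k : (r *: f + g) k = r *: f k + g k.
Proof. by []. Qed.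

Lemma model_sum (K : nat) (F : 'I_K -> model) k : (\sum_n F n) k = \sum_n F n k.
Proof.
by elim: K F => [|K IHK] F; rewrite ?big_ord0 // !big_ord_recr /= -IHK.
Qed.

(** X maps the copy k - 1 to the copy k by the identity, and Y the copy k + 1 to the copy k
    by phi^2 - (k+1)^2. At the bottom Y maps to the weight - 1, which is identified with
    the weight 1 by conjugation: this contributes phi to the copy 0. *)
Definition shift_up (f : nat -> W) k : W := if k is k'.+1 then f k' else phi (f 0%N).
Definition shift_down (f : nat -> W) k : W :=
  phi (phi (f k.+1)) - k.+1%:R ^+ 2 *: f k.+1.

Fact shift_finsupp (f : model) : exists N, forall k, (N <= k)%N ->
  shift_up f k = 0 /\ shift_down f k = 0.
Proof.
have [N fN] := model_finsupp f; exists N.+1 => -[//|k] le_N.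
rewrite /shift_down /= (fN k le_N) (fN k.+2) ?(linear0 phi) ?scaler0 ?subrr //.
exact: leq_trans (le_N : (N <= k)%N) (leqW (leqnSn k)).
Qed.

Fact model_h_subproof (f : model) : (fun k => shift_up f k + shift_down f k) \is a finsupp.
Proof.
have [N fN] := shift_finsupp f; apply/asboolP; exists N => k /fN[-> ->].
exact: addr0.
Qed.
Definition model_h0 f := Model (model_h_subproof f).

Fact model_q_subproof (f : model) :
  (fun k => I (shift_down f k - shift_up f k)) \is a finsupp.
Proof.
have [N fN] := shift_finsupp f; apply/asboolP; exists N => k /fN[-> ->].
by rewrite subrr (linear0 I).
Qed.
Definition model_q0 f := Model (model_q_subproof f).

Fact model_J_subproof (f : model) : (fun k => - (wt k)%:R *: I (f k)) \is a finsupp.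
Proof.
have [N fN] := model_finsupp f; apply/asboolP; exists N => k /fN ->.
by rewrite linear0 scaler0.
Qed.
Definition model_J0 f := Model (model_J_subproof f).

Fact single_subproof j (w : W) : (fun k => if k == j then w else 0) \is a finsupp.
Proof. by apply/asboolP; exists j.+1 => k /gtn_eqF ->. Qed.
Definition single0 j w := Model (single_subproof j w).

Fact single_linear j : linear (single0 j).
Proof.
by move=> r u v; apply: model_eq => k; rewrite modelE /=; case: eqP => //; rewrite scaler0 addr0.
Qed.
Fact shift_linear r (u v : model) k :
  shift_up (r *: u + v) k = r *: shift_up u k + shift_up v k /\
  shift_down (r *: u + v) k = r *: shift_down u k + shift_down v k.
Proof.
split; last by rewrite /shift_down !modelE !(linE phi); lmod rat W; ring.
by case: k => [|k] //; rewrite -[LHS]/(phi (r *: u 0%N + v 0%N)) !(linE phi).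
Qed.
Fact model_h_linear : linear model_h0.
Proof.
move=> r u v; apply: model_eq => k; rewrite modelE.
rewrite -[LHS]/(shift_up (r *: u + v) k + shift_down (r *: u + v) k).
by have [-> ->] := shift_linear r u v k; rewrite /=; lmod rat W; ring.
Qed.
Fact model_q_linear : linear model_q0.
Proof.
move=> r u v; apply: model_eq => k; rewrite modelE.
rewrite -[LHS]/(I (shift_down (r *: u + v) k - shift_up (r *: u + v) k)).
by have [-> ->] := shift_linear r u v k; rewrite /= !(linE I); lmod rat W; ring.
Qed.
Fact model_J_linear : linear model_J0.
Proof.
move=> r u v; apply: model_eq => k; rewrite modelE.
by rewrite -[LHS]/(- (wt k)%:R *: I ((r *: u + v) k)) modelE /= !(linE I); lmod rat W; ring.
Qed.

HB.instance Definition _ j := GRing.isLinear.Build rat W model *:%R (single0 j) (single_linear j).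
HB.instance Definition _ := GRing.isLinear.Build rat model model *:%R model_h0 model_h_linear.
HB.instance Definition _ := GRing.isLinear.Build rat model model *:%R model_q0 model_q_linear.
HB.instance Definition _ := GRing.isLinear.Build rat model model *:%R model_J0 model_J_linear.

Definition single j : {linear W -> model} := single0 j.
Definition model_h : {linear model -> model} := model_h0.
Definition model_q : {linear model -> model} := model_q0.
Definition model_J : {linear model -> model} := model_J0.

Definition model_pr j : {linear model -> model} :=
  HB.pack (fun f : model => single j (f j))
    (GRing.isLinear.Build rat model model *:%R (fun f : model => single j (f j))
       (fun r u v => linearP (single j) r (u j) (v j))).

Hypothesis II : forall w, I (I w) = - w.
Hypothesis phiI : forall w, phi (I w) = - I (phi w).

Lemma model_relations : sl2_relations model_h model_q model_J.
Proof.
have N1 n : (n.+1%:R : rat) = n%:R + 1 by rewrite mulrSr.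
have wtE n : (wt n)%:R = n%:R * 2 + 1 :> rat by rewrite /wt -muln2 mulrSr natrM.
split=> f; apply: model_eq => k; rewrite -?scaleNr addrC modelE /= /shift_down /shift_up /=.
- case: k => [|[|k]] /=; rewrite /shift_down !(phiI, II, linE phi, linE I) !wtE ?N1 /=;
    by lmod rat W; ring.
- case: k => [|[|k]] /=; rewrite /shift_down !(phiI, II, linE phi, linE I) !wtE ?N1 /=;
    by lmod rat W; ring.
- case: k => [|[|k]] /=; rewrite /shift_down !(phiI, II, linE phi, linE I) !wtE ?N1 /=;
    by lmod rat W; ring.
Qed.

Lemma single_sum (f : model) N : (forall k, (N <= k)%N -> f k = 0) ->
  f = \sum_(k < N) single k (f k).
Proof.
move=> fN; apply: model_eq => k; rewrite model_sum.
have [lt_k|le_k] := ltnP k N; last first.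
  by rewrite (fN k le_k) big1 // => i _ /=; case: eqP => // Ek; rewrite -Ek fN.
rewrite (bigD1 (Ordinal lt_k)) //= eqxx big1 ?addr0 // => i.
by rewrite -val_eqE /= eq_sym => /negPf ->.
Qed.

(** J^2 is - (2k+1)^2 on the copy k, and these scalars are distinct. *)
Lemma model_weightE j (f : model) :
  weight model_J (wt j)%:R f <-> forall k, k != j -> f k = 0.
Proof.
split=> [wt_f k ne_k|z].
  have := congr1 (fun g : model => g k) wt_f; rewrite /= !(linE I) II => E.
  have {}E : ((wt j)%:R ^+ 2 - (wt k)%:R ^+ 2) *: f k = 0.
    have {}E : - (wt k)%:R *: (- (wt k)%:R *: - f k) = - (wt j)%:R ^+ 2 *: f k by [].
    transitivity (- (- (wt j)%:R ^+ 2 *: f k) + - (wt k)%:R *: (- (wt k)%:R *: - f k)).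
      by lmod rat W; ring.
    by rewrite E addNr.
  move/eqP: E; rewrite scaler_eq0 subr_eq0 -!natrX Num.Theory.eqr_nat eqn_exp2r //.
  by rewrite /wt eqSS (inj_eq double_inj) eq_sym (negPf ne_k) => /eqP.
apply: model_eq => k; rewrite /= !(linE I) II.
rewrite -[RHS]/(- (wt j)%:R ^+ 2 *: f k).
have [->|/z ->] := eqVneq k j; first by lmod rat W; ring.
by rewrite oppr0 !scaler0.
Qed.

Lemma single_weight j w : weight model_J (wt j)%:R (single j w).
Proof. by apply/model_weightE => k /negPf /= ->. Qed.

Lemma model_decomposition : odd_weight_decomposition model_J model_pr.
Proof.
split=> [j f|i j f /model_weightE z|f].
- exact: single_weight.
- apply: model_eq => k /=.
  have [->|ne_i] := eqVneq i j; last by rewrite (z _ ne_i); case: eqP.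
  by have [->|/z ->] := eqVneq k j.
- have [N fN] := model_finsupp f; exists N; split; first exact: single_sum.
  by move=> j /fN E; rewrite /= E linear0.
Qed.

Lemma model_casimir (f : model) k :
  casimir model_h model_q model_J f k = 4 *: phi (phi (f k)).
Proof.
have N1 n : (n.+1%:R : rat) = n%:R + 1 by rewrite mulrSr.
have wtE n : (wt n)%:R = n%:R * 2 + 1 :> rat by rewrite /wt -muln2 mulrSr natrM.
rewrite /casimir -[- _]scaleN1r.
rewrite -[LHS]/(shift_up (model_h f) k + shift_down (model_h f) k
  + (I (shift_down (model_q f) k - shift_up (model_q f) k))
  + -1 *: (- (wt k)%:R *: I (- (wt k)%:R *: I (f k))) + f k).
case: k => [|[|k]]; rewrite /shift_down /shift_up /= /shift_down /shift_up
  !(phiI, II, linE phi, linE I) !wtE ?N1 /=; by lmod rat W; ring.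
Qed.

Definition model_gK : gK_module := weight_gK model_relations model_decomposition.

End Model.
Arguments single {W} j.
Arguments model_pr {W} j.

(** * The Casimir element *)

Section CasimirElement.
Variable M : gK_module.

Let rho (Z : sl2 rat) : {linear M -> M} := @gact M Z.

Lemma base_change_gact_coord (a b c : Qi) (m : M) :
  base_change_act (@gact M) (mk_sl2 a b c) (btens m 1) =
    a *: btens (gh M m) 1 + (b + c) / 2 *: btens (gq M m) 1 + (c - b) / 2 *: btens (gJ M m) 1.
Proof.
rewrite (base_change_actE rho) /rho /= !mxE /=.
have -> : mk_sl2 0 1 0 = mk_sl2 0 (2^-1 - - 2^-1) (2^-1 + - 2^-1) :> sl2 rat.
  by congr mk_sl2; apply/eqP.
have -> : mk_sl2 0 0 1 = mk_sl2 0 (2^-1 - 2^-1) (2^-1 + 2^-1) :> sl2 rat.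
  by congr mk_sl2; apply/eqP.
rewrite !gact_coord !btensD !btensZ.
have -> : (0 : rat)%:A = 0 :> Qi by exact: scale0r.
have -> : (- 2^-1 : rat)%:A = - 2^-1 :> Qi by apply/eqP.
have -> : (2^-1 : rat)%:A = 2^-1 :> Qi by apply/eqP.
by lmod Qi (base_change M Qi); ring.
Qed.

Lemma U_C_act (m : M) : U_act (base_change_act (@gact M) (A := Qi)) U_C (btens m 1) =
  btens (casimir (gh M) (gq M) (gJ M) m) 1.
Proof.
have : forall Z, linear (base_change_act (@gact M) (A := Qi) Z).
  exact: (base_change_act_linear rho (A := Qi)).
have := base_change_gact_coord; rewrite [U_act _ _ _]/= /sl2_H /sl2_X /sl2_Y.
move: (base_change_act (@gact M) (A := Qi)) => B E BL; have L Z := linP (BL Z).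
have [hq _ _] := gK_relations M.
rewrite !E !L !E /casimir hq !(btensD, btensN, btensZ).
have -> : (2 : rat)%:A = 2 :> Qi by apply/eqP.
by lmod Qi (base_change M Qi); apply/eqP; vm_compute.
Qed.

Lemma C_nilpotentE : C_nilpotent M <->
  exists n, forall m : M, iter n (casimir (gh M) (gq M) (gJ M)) m = 0.
Proof.
have E n m : iter n (U_act (base_change_act (@gact M) (A := Qi)) U_C) (btens m 1) =
    btens (iter n (casimir (gh M) (gq M) (gJ M)) m) 1.
  by elim: n => //= n ->; exact: U_C_act.
split=> -[n z]; exists n => m.
  by apply: (@btens_Qi_inj M); rewrite -E z btens0.
by rewrite E z btens0.
Qed.

End CasimirElement.

(** * Finiteness *)

Section FiniteDimension.
Variables (F : fieldType) (V : lmodType F).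

(** Induction on the number of generators: either P lies in the span of all but the first
    of them, or one vector of P is used to eliminate the first generator. *)
Lemma finite_dimensional_sub (P : V -> Prop) (n : nat) (s : 'I_n -> V) :
  P 0 -> (forall a u v, P u -> P v -> P (a *: u + v)) ->
  (forall v, P v -> exists c : 'I_n -> F, v = \sum_(i < n) c i *: s i) ->
  finite_dimensional P.
Proof.
elim: n s P => [|n IHn] s P P0 PD span.
  exists 0%N, s; split=> [i|v /span[c ->]]; first by have := ltn_ord i; rewrite ltn0.
  by exists c; rewrite !big_ord0.
pose s' (i : 'I_n) := s (lift ord0 i).
pose P' v := P v /\ exists c : 'I_n -> F, v = \sum_(i < n) c i *: s' i.
have [d [t [Pt tspan]]] : finite_dimensional P'.
  apply: (IHn s') => [|a u v [Pu [c Eu]] [Pv [c' Ev]]|v []//].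
    by split=> //; exists (fun=> 0); rewrite big1 // => i _; rewrite scale0r.
  split; first exact: PD.
  exists (fun i => a * c i + c' i); rewrite Eu Ev scaler_sumr -big_split; apply: eq_bigr => i _.
  by rewrite scalerDl scalerA.
have [[p [Pp [c0 [c [c0_neq0 Ep]]]]]|none] := pselect (exists p, P p /\
    exists c0 (c : 'I_n -> F), c0 != 0 /\ p = c0 *: s ord0 + \sum_i c i *: s' i); last first.
  exists d, t; split=> [i|v Pv]; first by case: (Pt i).
  apply: tspan; split=> //; have [c Ev] := span v Pv.
  exists (fun i => c (lift ord0 i)); move: Ev; rewrite big_ord_recl.
  have [->|c0] := eqVneq (c ord0) 0; first by rewrite scale0r add0r.
  by move=> Ev; case: none; exists v; split=> //; exists (c ord0), (fun i => c (lift ord0 i)).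
exists d.+1, (fun i => if unlift ord0 i is Some j then t j else p); split=> [i|v Pv].
  by case: unliftP => // j _; case: (Pt j).
have [e Ev] := span v Pv; rewrite big_ord_recl in Ev.
pose r := e ord0 / c0.
have [f Ef] : exists f : 'I_d -> F, v - r *: p = \sum_i f i *: t i.
  apply: tspan; split; first by rewrite -scaleNr addrC; exact: PD.
  exists (fun i => e (lift ord0 i) - r * c i).
  rewrite Ev Ep scalerDr scalerA /r divfK // opprD addrACA subrr add0r.
  by rewrite scaler_sumr -sumrB; apply: eq_bigr => i _; rewrite scalerBl scalerA.
exists (fun i => if unlift ord0 i is Some j then f j else r).
rewrite big_ord_recl unlift_none -[v in LHS](subrK (r *: p)) Ef addrC; congr (_ + _).
by apply: eq_bigr => i _; rewrite !liftK.
Qed.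

End FiniteDimension.

Section ModelFiniteness.
Variables (W : lmodType rat) (I phi : {linear W -> W}).
Hypotheses (II : forall w, I (I w) = - w) (phiI : forall w, phi (I w) = - I (phi w)).

Let M := model_gK II phiI.
Let mh := model_h phi.
Let mJ := model_J I.
Let mq := model_q I phi.

Let rel : sl2_relations mh mq mJ := model_relations II phiI.
Let dec : odd_weight_decomposition mJ model_pr := model_decomposition II.

Lemma model_opp_one : opp_one_acts_by_opp M.
Proof.
move=> v; move: v; apply: (weight_eq dec (f := kact (g := M) so2_opp_one) (g := -%R)).
- exact: (kact_linear (g := M)).
- by move=> a t u; rewrite opprD scalerN.
move=> j v wt_v; apply: etrans (weight_kactE dec so2_opp_one wt_v) _.
by rewrite /rotation so2_exp_opp /wt /= odd_double /= scale0r addr0 scaleN1r.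
Qed.

Lemma model_ghE m : gh M m = mh m.
Proof. exact: weight_gacth. Qed.
Lemma model_gJE m : gJ M m = mJ m.
Proof. exact: weight_gactJ. Qed.
Lemma model_gqE m : gq M m = mq m.
Proof.
have -> : gq M m = weight_gact mh mq mJ (mk_sl2 0 (1 - 0) (1 + 0)) m by rewrite subr0.
by rewrite weight_gact_coord !scale0r add0r addr0 scale1r.
Qed.

Lemma model_C_nilpotent : (exists n, forall w, iter n phi w = 0) -> C_nilpotent M.
Proof.
move=> [n nil]; apply/C_nilpotentE; exists n => m.
have casE (f : M) : casimir (gh M) (gq M) (gJ M) f = casimir mh mq mJ f.
  by rewrite /casimir !(model_ghE, model_gqE, model_gJE).
apply: model_eq => k.
suff -> : (iter n (casimir (gh M) (gq M) (gJ M)) m : model W) k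
    = iter n (fun w => 4 *: phi (phi w)) ((m : model W) k).
  have phi0 p : iter p (fun w => 4 *: phi (phi w)) (m k) = 4 ^+ p *: iter p phi (iter p phi (m k)).
    elim: p => [|p IHp]; first by rewrite expr0 scale1r.
    rewrite [LHS]iterS IHp !(linE phi) scalerA -exprS; congr (_ *: _).
    by rewrite [RHS]iterS [in RHS](iterS p) -iterSr.
  by rewrite phi0 nil scaler0.
elim: n {nil} => // n IHn; rewrite !iterS casE -IHn; exact: model_casimir.
Qed.

Hypothesis W_fin : exists (n : nat) (s : 'I_n -> W), forall w, exists c : 'I_n -> rat,
  w = \sum_i c i *: s i.

Lemma model_raise k w : raise mh mq mJ (wt k)%:R (single k w) = single k.+1 w.
Proof.
apply: model_eq => j; rewrite /raise.
have k0 := wt0 k.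
rewrite -[LHS]/((2 * (wt k)%:R)^-1 *: (((wt k)%:R - 2) *: (shift_up phi (single k w) j
  + shift_down phi (single k w) j) + - (- (wt j)%:R *: I (I (shift_down phi (single k w) j
  - shift_up phi (single k w) j))))).
rewrite II.
transitivity ((2 * (wt k)%:R)^-1 *: (((wt k)%:R - 2 + (wt j)%:R) *: shift_up phi (single k w) j
    + ((wt k)%:R - 2 - (wt j)%:R) *: shift_down phi (single k w) j)).
  by lmod rat W; ring.
have -> : ((wt k)%:R - 2 - (wt j)%:R) *: shift_down phi (single k w) j = 0.
  rewrite /shift_down /=; case: eqP => [Ej|_]; last by rewrite !(linear0 phi) !scaler0 subrr scaler0.
  by rewrite -Ej wtS addrK subrr scale0r.
rewrite addr0; case: j => [|j] /=; last first.
  rewrite eqSS; case: eqP => [->|_]; last by rewrite !scaler0.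
  by rewrite scalerA wtS; lmod rat W; field.
rewrite /= eq_sym; case: eqP => [->|_]; last by rewrite (linear0 phi) !scaler0.
have -> : (wt 0)%:R - 2 + (wt 0)%:R = 0 :> rat by apply/eqP.
by rewrite scale0r scaler0.
Qed.

(** The lowest copy of W generates the others, as X is the shift. *)
Lemma model_finitely_generated : finitely_generated M.
Proof.
have [n [s span]] := W_fin.
exists n, (fun i => single 0 (s i)).
pose G (m : M) := exists u : 'I_n -> U_expr rat,
  m = \sum_(i < n) U_act (@gact M) (u i) (single 0 (s i)).
have GD m m' : G m -> G m' -> G (m + m').
  by move=> [u ->] [u' ->]; exists (fun i => UAdd (u i) (u' i)); rewrite -big_split.
have GZ r m : G m -> G (r *: m).
  by move=> [u ->]; exists (fun i => UMul (UScal r) (u i)); rewrite scaler_sumr.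
have Gg Z m : G m -> G (gact Z m).
  move=> [u ->]; exists (fun i => UMul (UGen Z) (u i)).
  by rewrite (lin_sum _ _ _ (gact_linear Z)).
have G0 : G 0 by exists (fun=> UScal 0); rewrite big1 // => i _; exact: scale0r.
have Gsingle k w : G (single k w).
  elim: k => [|k IHk].
    have [c ->] := span w; exists (fun i => UScal (c i)).
    by rewrite linear_sum; apply: eq_bigr => i _; rewrite linearZ.
  rewrite -model_raise /raise -!model_ghE -!model_gqE -!model_gJE.
  apply/GZ/GD; first exact/GZ/Gg.
  by rewrite -scaleN1r; exact/GZ/Gg/Gg.
move=> m; have [N fN] := model_finsupp m.
suff: G m by [].
rewrite (single_sum fN); elim/big_ind: _ => //.
Qed.

End ModelFiniteness.

Section ModelAdmissible.
Variables (W : lmodType rat) (I phi : {linear W -> W}).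
Hypotheses (II : forall w, I (I w) = - w) (phiI : forall w, phi (I w) = - I (phi w)).
Hypothesis W_fin : exists (n : nat) (s : 'I_n -> W), forall w, exists c : 'I_n -> rat,
  w = \sum_i c i *: s i.

Let M := model_gK II phiI.
Let mJ := model_J I.

Let dec : odd_weight_decomposition mJ model_pr := model_decomposition II.

Let T : base_change M Qi -> base_change M Qi := kact so2_two.
Let P (j : nat) : base_change M Qi -> base_change M Qi := bc_map (model_pr j) Qi.
Let c j : Qi := (so2_exp (wt j) so2_two).1.

Let TL : linear T. Proof. exact: (kact_linear (g := M)). Qed.
Let PL j : linear (P j). Proof. exact: tens_map_linear. Qed.

Let TE j (v : M) : weight mJ (wt j)%:R v ->
  T (btens v 1) = rotation mJ (wt j) so2_two v.
Proof. exact: (weight_kactE dec). Qed.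

Let PE j (v : M) : P j (btens v 1) = btens (model_pr j v) 1.
Proof. exact: tens_map_btens. Qed.

(** On the component of index j the point so2_two acts with the eigenvalues 2^n and 2^-n,
    n = 2j + 1. *)
Lemma model_quadratic j t : T (T (P j t)) = 2 * c j *: T (P j t) - P j t.
Proof.
move: t; apply: base_change_eq => [a t u|a t u|m].
- by rewrite (PL j) !TL.
- by rewrite (PL j) !TL; lmod Qi (base_change M Qi); ring.
rewrite PE; have wt_v : weight mJ (wt j)%:R (model_pr j m : M) := single_weight II j _.
have wt_v' := partner_weight wt_v.
rewrite (TE wt_v) /rotation !(linP TL) (TE wt_v) (TE wt_v') /rotation (partnerK wt_v) btensN.
rewrite -/(c j); set s := (so2_exp (wt j) so2_two).2.
have E : c j ^+ 2 + s ^+ 2 = 1 := so2P _.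
set e := btens (model_pr j m) 1.
have Ee : e = (c j ^+ 2 + s ^+ 2) *: e by rewrite E scale1r.
rewrite [X in _ = _ - X]Ee.
by lmod Qi (base_change M Qi); ring.
Qed.

Lemma model_commute j t : P j (T t) = T (P j t).
Proof.
move: t; apply: (weight_eq dec) => [a t u|a t u|i v wt_v].
- by rewrite TL (PL j).
- by rewrite (PL j) TL.
have wt_v' := partner_weight wt_v.
have [_ pr_wt _] := dec.
rewrite PE (TE wt_v) /rotation !(linP (PL j)) !PE (pr_wt _ _ _ wt_v) (pr_wt _ _ _ wt_v').
case: eqP => _; first by rewrite (TE wt_v).
by rewrite btens0 (linP TL) !scaler0 addr0.
Qed.

Lemma base_change_components (t : base_change M Qi) : exists N, t = \sum_(j < N) P j t.
Proof.
suff: exists N, forall N', (N <= N')%N -> t = \sum_(j < N') P j t.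
  by case=> N /(_ N (leqnn N)); exists N.
elim/base_change_ind: t => [|t u [N Et] [N2 Eu]|a t [N Et]|m].
- by exists 0%N => N _; rewrite big1 // => j _; exact: (linP (PL j)).2.
- exists (maxn N N2) => N'; rewrite geq_max => /andP[/Et {1}-> /Eu {1}->].
  by rewrite -big_split; apply: eq_bigr => j _; rewrite (linP (PL j)).
- exists N => N' /Et {1}->; rewrite scaler_sumr; apply: eq_bigr => j _.
  by rewrite (linP (PL j)).
have [N fN] := model_finsupp m; exists N => N' le_N.
have fN' k : (N' <= k)%N -> m k = 0 by move=> /(leq_trans le_N); exact: fN.
rewrite [in LHS](single_sum fN') btens_sum; apply: eq_bigr => j _.
by rewrite PE.
Qed.

(** An isotypic vector is an eigenvector of so2_two, for an eigenvalue la which depends only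
    on the character. By [model_quadratic], la^2 + 1 = (2^n + 2^-n) la if the component of
    index j is not zero, and this determines j. *)
Lemma model_admissible : admissible M.
Proof.
move=> chi; set la := chi Qi idfun so2_two.
have eig v : isotypic (M := M) chi v -> T v = la *: v.
  by move=> /(_ Qi idfun so2_two); rewrite base_change_map_id.
have isoD a u v : isotypic (M := M) chi u -> isotypic (M := M) chi v ->
    isotypic (M := M) chi (a *: u + v).
  move=> iu iv A j k; rewrite base_change_mapD base_change_mapZ.
  by rewrite (kact_linear (g := M)) iu iv !scalerDr !scalerA mulrC.
have iso0 : isotypic (M := M) chi 0.
  by move=> A j k; rewrite base_change_map0 (linP (kact_linear (g := M) k)) scaler0.
have quad j v : isotypic (M := M) chi v -> (la ^+ 2 - 2 * c j * la + 1) *: P j v = 0.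
  move=> iv; have := model_quadratic j v; rewrite -!model_commute (eig _ iv).
  rewrite !(linP TL) !(eig _ iv) !(linP (PL j)) => /eqP.
  by rewrite -subr_eq0 => /eqP E; rewrite -[RHS]E; lmod Qi (base_change M Qi); ring.
have [[j0 [v0 [iv0 nz]]]|none] := pselect (exists (j : nat) v, isotypic (M := M) chi v /\ P j v <> 0);
    last first.
  exists 0%N, (fun=> 0); split=> [i //|v iv]; exists (fun=> 0); rewrite big_ord0.
  have [N ->] := base_change_components v; rewrite big1 // => j _.
  by apply: contrapT => nz; apply: none; exists j, v.
have c_eq j v : isotypic (M := M) chi v -> P j v <> 0 -> la ^+ 2 + 1 = 2 * c j * la.
  move=> iv /eqP nzj; have /eqP := quad j v iv; rewrite scaler_eq0 (negPf nzj) orbF.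
  by move=> /eqP E; apply/eqP; rewrite -subr_eq0 -E; apply/eqP; ring.
have one j v : isotypic (M := M) chi v -> j != j0 -> P j v = 0.
  move=> iv ne_j; apply: contrapT => nzj.
  have := c_eq _ _ iv nzj; rewrite (c_eq _ _ iv0 nz) => E.
  have [la0|la_neq0] := eqVneq la 0.
    by have := c_eq _ _ iv0 nz; rewrite la0 expr0n mulr0 add0r => /eqP; rewrite oner_eq0.
  have two0 : (2 : Qi) != 0 by [].
  move: E => /(mulIf la_neq0) /(mulfI two0) /so2_exp_two_inj.
  by rewrite /wt => -[] /double_inj /eqP; rewrite eq_sym (negPf ne_j).
have [n [s span]] := W_fin.
apply: (@finite_dimensional_sub _ (base_change M Qi) _ n
  (fun i => btens (single j0 (s i) : M) 1)) => // v iv.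
have Ev : v = P j0 v.
  have [N Ev] := base_change_components v.
  have [lt_j|le_j] := ltnP j0 N.
    rewrite {1}Ev (bigD1 (Ordinal lt_j)) //= big1 ?addr0 // => j.
    by rewrite -val_eqE /= => /(one _ _ iv).
  rewrite Ev big1 ?(linP (PL j0)) // => j _; apply: (one _ _ iv).
  by rewrite neq_ltn (leq_trans (ltn_ord j) le_j).
rewrite Ev; elim/base_change_ind: {iv Ev} v => [|t u [d Et] [d' Eu]|a t [d Et]|m].
- by exists (fun=> 0); rewrite (linP (PL j0)) big1 // => i _; rewrite scale0r.
- exists (fun i => d i + d' i); rewrite (linP (PL j0)) Et Eu -big_split.
  by apply: eq_bigr => i _; rewrite scalerDl.
- exists (fun i => a * d i); rewrite (linP (PL j0)) Et scaler_sumr.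
  by apply: eq_bigr => i _; rewrite scalerA.
have [d Em] := span (m j0); exists (fun i => (d i)%:A).
rewrite PE /= -[single0 j0 _]/(single j0 _) Em linear_sum btens_sum; apply: eq_bigr => i _.
by rewrite linearZ btensZ.
Qed.

End ModelAdmissible.

(** * Morphisms of (g, K)-modules *)

Section Morphisms.
Variables (M N : gK_module) (f : {linear M -> N}).
Hypotheses (fh : forall v, f (gh M v) = gh N (f v)) (fJ : forall v, f (gJ M v) = gJ N (f v)).

(** [J, h] = 2q, so h and J generate. *)
Lemma q_from_hJ (L : gK_module) v : gq L v = 2^-1 *: (gJ L (gh L v) - gh L (gJ L v)).
Proof. by have [_ _ ->] := gK_relations L; lmod rat L; field. Qed.

Lemma gact_from_hJ Z v : f (gact Z v) = gact Z (f v).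
Proof.
have E (L : gK_module) (w : L) : gact Z w = Z 0 0 *: gh L w
    + (2^-1 * (Z 0 1 + Z 1 0)) *: gq L w + (2^-1 * (Z 1 0 - Z 0 1)) *: gJ L w.
  rewrite -gact_coord {1}(gact_eq Z); congr (gact (mk_sl2 _ _ _) w); by field.
by rewrite !E !(linE f) !q_from_hJ !(fh, fJ, linE f).
Qed.

(** K being connected, its action is determined by that of its Lie algebra. *)
Lemma hom_from_hJ : opp_one_acts_by_opp M -> is_gK_hom f.
Proof.
move=> oppM; split=> [|A k]; first exact: gact_from_hJ.
apply: base_change_eq => [a t u|a t u|m].
- by rewrite (kact_linear (g := M)) tens_map_linear.
- by rewrite tens_map_linear (kact_linear (g := N)).
have [K [a [-> wt_a]]] := odd_weights oppM m.
rewrite btens_sum !lin_sum; first last.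
- exact: (kact_linear (g := M)).
- exact: tens_map_linear.
- exact: tens_map_linear.
- exact: (kact_linear (g := N)).
apply: eq_bigr => j _; rewrite (rotates_weight _ (wt_a j)) // tens_map_btens.
have wt_fa : weight (gJ N) (wt j)%:R (f (a j)).
  by rewrite /weight -!fJ wt_a linearZ.
rewrite (rotates_weight _ wt_fa) // !(linP (tens_map_linear f (A := A))) !tens_map_btens.
by rewrite linearZ fJ.
Qed.

End Morphisms.

Lemma bijective_is_iso (M N : gK_module) (f : gK_hom M N) :
  injective f -> (forall v, exists u, f u = v) -> @is_iso gK_Mod M N f.
Proof.
move=> inj surj.
pose g v := projT1 (cid (surj v)).
have fg v : f (g v) = v := projT2 (cid (surj v)).
have gf u : g (f u) = u by apply: inj; rewrite fg.
have gL : linear g by move=> r u v; apply: inj; rewrite linearP !fg.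
pose G : {linear N -> M} := HB.pack g (GRing.isLinear.Build rat N M *:%R g gL).
have [fgact fkact] := gK_funP f.
have Gf (A : comAlgType rat) t : tens_map (scalars A) G (tens_map (scalars A) f t) = t.
  rewrite -tens_map_comp; move: t; apply: base_change_eq => [||m].
  - exact: tens_map_linear.
  - by [].
  - by rewrite tens_map_btens /= gf.
have fG (A : comAlgType rat) t : tens_map (scalars A) f (tens_map (scalars A) G t) = t.
  rewrite -tens_map_comp; move: t; apply: base_change_eq => [||m].
  - exact: tens_map_linear.
  - by [].
  - by rewrite tens_map_btens /= fg.
have Ghom : is_gK_hom G.
  split=> [Z m|A k v]; first by apply: inj; rewrite fgact !fg.
  by rewrite -{1}(fG A v) -fkact Gf.
by exists (GKHom Ghom); split; apply: gK_hom_ext => v /=; rewrite ?gf ?fg.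
Qed.

(** The model is the direct sum of its copies of W. *)
Section LinearExtension.
Variables (W V : lmodType rat) (theta : nat -> {linear W -> V}).

Let bound (f : model W) := projT1 (cid (model_finsupp f)).
Let boundP (f : model W) k : (bound f <= k)%N -> f k = 0.
Proof. exact: (projT2 (cid (model_finsupp f))). Qed.

Definition model_ext0 (f : model W) : V := \sum_(k < bound f) theta k (f k).

Lemma model_ext0E (f : model W) N : (forall k, (N <= k)%N -> f k = 0) ->
  model_ext0 f = \sum_(k < N) theta k (f k).
Proof.
have E (N1 N2 : nat) : (N1 <= N2)%N -> (forall k, (N1 <= k)%N -> f k = 0) ->
    \sum_(k < N1) theta k (f k) = \sum_(k < N2) theta k (f k).
  move=> le z; rewrite (big_ord_widen _ (fun k => theta k (f k)) le) big_mkcond.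
  by apply: eq_bigr => k _; case: ltnP => // /z ->; rewrite (linear0 (theta k)).
move=> z; rewrite /model_ext0; have [le|/ltnW le] := leqP N (bound f).
  exact/esym/E.
by apply: E => //; exact: boundP.
Qed.

Fact model_ext_linear : linear model_ext0.
Proof.
move=> r u v; pose N := maxn (bound u) (bound v).
have zu k : (N <= k)%N -> u k = 0 by rewrite geq_max => /andP[/boundP].
have zv k : (N <= k)%N -> v k = 0 by rewrite geq_max => /andP[_ /boundP].
rewrite (model_ext0E zu) (model_ext0E zv) (@model_ext0E _ N) => [|k le_k].
  rewrite scaler_sumr -big_split; apply: eq_bigr => k _.
  by rewrite modelE linearP.
by rewrite modelE zu // zv // scaler0 addr0.
Qed.
HB.instance Definition _ :=
  GRing.isLinear.Build rat (model W) V *:%R model_ext0 model_ext_linear.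

Definition model_ext : {linear model W -> V} := model_ext0.

Lemma model_ext_single k w : model_ext (single k w) = theta k w.
Proof.
rewrite [LHS](@model_ext0E _ k.+1) => [|i lt_i]; last by rewrite /= gtn_eqF.
rewrite big_ord_recr /= eqxx big1 ?add0r // => i _.
by rewrite ltn_eqF // (linear0 (theta i)).
Qed.

End LinearExtension.

Lemma model_lin_eq (W V : lmodType rat) (f g : {linear model W -> V}) :
  (forall k w, f (single k w) = g (single k w)) -> f =1 g.
Proof.
move=> E m; have [N fN] := model_finsupp m; rewrite (single_sum fN) !linear_sum.
by apply: eq_bigr => k _; exact: E.
Qed.

Section ModelSingle.
Variables (W : lmodType rat) (I phi : {linear W -> W}).

Lemma model_J_single k w : model_J I (single k w) = single k (- (wt k)%:R *: I w).
Proof.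
apply: model_eq => j; rewrite /=; case: eqP => [->//|_].
by rewrite (linear0 I) scaler0.
Qed.

Lemma model_h_single k w : model_h phi (single k w) = single k.+1 w
  + if k is k'.+1 then single k' (phi (phi w) - k%:R ^+ 2 *: w) else single 0 (phi w).
Proof.
apply: model_eq => j.
have D (u v : model W) i : (u + v) i = u i + v i by [].
rewrite D -[LHS]/(shift_up phi (single k w) j + shift_down phi (single k w) j).
have phi0 := linear0 phi.
rewrite /shift_down /=; case: k => [|k] /=.
  rewrite !phi0 scaler0 subrr addr0.
  by case: j => [|j] /=; rewrite ?add0r ?addr0 // ?eqSS.
rewrite !eqSS; congr (_ + _); first by case: j => [|j] /=.
by case: eqP => [->//|_]; rewrite !phi0 scaler0 subrr.
Qed.

End ModelSingle.

(** * Reconstructing a module from its vectors of weight 1 *)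

Section NilpotentCasimir.
Variables (V : lmodType rat) (h q J : {linear V -> V}) (n0 : nat).
Hypotheses (rel : sl2_relations h q J) (nil : forall v, iter n0 (casimir h q J) v = 0).

Local Notation Om := (casimir h q J).

Lemma casimir_linear : linear Om.
Proof.
by move=> r u v; rewrite /casimir !(linE h, linE q, linE J); lmod rat V; ring.
Qed.

Lemma weightZ n c v : weight J n v -> weight J n (c *: v).
Proof. by rewrite /weight !(linE J) => ->; lmod rat V; ring. Qed.

Lemma weight_casimir n v : weight J n v -> weight J n (Om v).
Proof.
rewrite /weight => wt_v; rewrite -!(casimir_J rel) wt_v.
by rewrite (linP casimir_linear).
Qed.

Lemma casimir_eigen mu v : mu != 0 -> Om v = mu *: v -> v = 0.
Proof.
move=> mu0 E; have : iter n0 Om v = mu ^+ n0 *: v.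
  elim: n0 => [|n IHn]; first by rewrite expr0 scale1r.
  by rewrite iterS IHn (linP casimir_linear) E scalerA -exprSr.
by rewrite nil => /esym/eqP; rewrite scaler_eq0 expf_eq0 (negPf mu0) andbF => /eqP.
Qed.

(** C - mu is invertible on each weight space for mu <> 0, since C is nilpotent. *)
Lemma casimir_solve n mu a : mu != 0 -> weight J n a ->
  exists2 b, weight J n b & a = Om b - mu *: b.
Proof.
move=> mu0; have := nil a; elim: n0 a => [|m IHm] a /=.
  by move=> -> wt0; exists 0 => //; rewrite (linP casimir_linear) scaler0 subr0.
rewrite -iterS iterSr => nil_a wt_a.
have [b wt_b Eb] := IHm _ nil_a (weight_casimir wt_a).
exists (mu^-1 *: (b - a)).
  by rewrite /weight !(linE J) wt_b wt_a; lmod rat V; ring.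
rewrite !(linP casimir_linear) Eb.
by lmod rat V; field.
Qed.

Lemma raise_linear n : linear (raise h q J n).
Proof. by move=> r u v; rewrite /raise !(linE h, linE q, linE J); lmod rat V; ring. Qed.

Let sq_neq0 j : ((wt j)%:R + 1) ^+ 2 != 0 :> rat.
Proof. by rewrite expf_neq0 // -mulrSr Num.Theory.pnatr_eq0. Qed.

Lemma raise_inj j v : weight J (wt j)%:R v -> raise h q J (wt j)%:R v = 0 -> v = 0.
Proof.
move=> wt_v E; apply: (casimir_eigen (sq_neq0 j)).
have n2 : (wt j)%:R + 2 != 0 :> rat by rewrite -wtS wt0.
have := lower_raise rel (wt0 j) wt_v n2.
have -> : raise h q J (wt j)%:R v = 0 *: v by rewrite scale0r.
rewrite /lower !(linE h, linE q, linE J) !scale0r scaler0 addr0 scaler0 => /esym /eqP.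
by rewrite scaler_eq0 /= subr_eq0 => /eqP.
Qed.

Lemma raise_surj j v : weight J (wt j.+1)%:R v ->
  exists2 u, weight J (wt j)%:R u & v = raise h q J (wt j)%:R u.
Proof.
move=> wt_v; have [b wt_b Eb] := casimir_solve (sq_neq0 j) wt_v.
have E2 : (wt j.+1)%:R - 2 = (wt j)%:R :> rat by rewrite wtS addrK.
have wt_u := weight_lower rel (wt0 j.+1) wt_b; rewrite E2 in wt_u.
exists (4 *: lower h q J (wt j.+1)%:R b); first exact: weightZ.
have := raise_lower rel (wt0 j.+1) wt_b; rewrite E2 => /(_ (wt0 j)) E.
rewrite (linP (raise_linear _)) E [LHS]Eb wtS.
by lmod rat V; field.
Qed.

Lemma casimir_raise n v : Om (raise h q J n v) = raise h q J n (Om v).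
Proof.
by rewrite /raise !(linP casimir_linear) (casimir_h rel) (casimir_J rel) (casimir_q rel).
Qed.

End NilpotentCasimir.

(** The data (W, I, phi) are those which M carries on its vectors of weight 1. *)
Section Reconstruction.
Variables (M : gK_module) (n0 : nat).
Hypothesis nil : forall v : M, iter n0 (casimir (gh M) (gq M) (gJ M)) v = 0.
Hypothesis oppM : opp_one_acts_by_opp M.
Variables (W : lmodType rat) (I phi : {linear W -> W}) (iota : {linear W -> M}).
Hypotheses (II : forall w, I (I w) = - w) (phiI : forall w, phi (I w) = - I (phi w)).
Hypothesis iota_inj : injective iota.
Hypothesis iota_image : forall v : M, weight (gJ M) 1 v <-> exists w, v = iota w.
Hypothesis iotaI : forall w, gJ M (iota w) = - iota (I w).
Hypothesis iota_phi : forall w, lower (gh M) (gq M) (gJ M) 1 (iota w) = iota (phi w).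

Local Notation X j := (raise (gh M) (gq M) (gJ M) (wt j)%:R).
Local Notation Y j := (lower (gh M) (gq M) (gJ M) (wt j)%:R).
Local Notation Om := (casimir (gh M) (gq M) (gJ M)).

Let rel := gK_relations M.

(** The component of index k of the model embeds as the image of iota under k raising
    operators. *)
Fixpoint theta0 k (w : W) : M := if k is k'.+1 then X k' (theta0 k' w) else iota w.

Fact theta_linear k : linear (theta0 k).
Proof.
elim: k => [|k IHk] r u v /=; first exact: linearP.
by rewrite IHk; exact: raise_linear.
Qed.
HB.instance Definition _ k := GRing.isLinear.Build rat W M *:%R (theta0 k) (theta_linear k).
Definition theta k : {linear W -> M} := theta0 k.

Lemma theta_weight k w : weight (gJ M) (wt k)%:R (theta k w).
Proof.
elim: k => [|k IHk]; first by apply/iota_image; exists w.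
by rewrite wtS; exact: (weight_raise rel (wt0 k) IHk).
Qed.

Lemma theta_J k w : gJ M (theta k w) = - (wt k)%:R *: theta k (I w).
Proof.
elim: k w => [|k IHk] w; first by rewrite scaleN1r; exact: iotaI.
rewrite [LHS](raiseJ rel (wt0 k) (theta_weight k w)) IHk -wtS.
rewrite (linP (raise_linear _ _ _ _)) scalerA; congr (_ *: _).
by field; exact: wt0.
Qed.

(** On the weight 1 this is C = 4 phi^2, as raise (- 1) = lower 1; C commutes with X. *)
Lemma theta_casimir k w : Om (theta k w) = theta k (4 *: phi (phi w)).
Proof.
elim: k w => [|k IHk] w.
  have wt1 := theta_weight 0 w.
  have n1 : (wt 0)%:R - 2 != 0 :> rat by [].
  have := raise_lower rel (wt0 0) wt1 n1.
  have -> : ((wt 0)%:R - 1) ^+ 2 = 0 :> rat by apply/eqP.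
  rewrite scale0r subr0 => E.
  have -> : Om (theta 0 w) = 4 *: raise (gh M) (gq M) (gJ M) ((wt 0)%:R - 2) (Y 0 (theta 0 w)).
    by rewrite E scalerA divff ?scale1r.
  have XY v : raise (gh M) (gq M) (gJ M) ((wt 0)%:R - 2) v = Y 0 v.
    rewrite /raise /lower; have -> : (wt 0)%:R = 1 :> rat by [].
    lmod rat M; field.
  have iphi v : Y 0 (theta 0 v) = iota (phi v) := iota_phi v.
  by rewrite XY iphi [Y 0 _]iphi [RHS]linearZ.
by rewrite [LHS](casimir_raise rel) IHk.
Qed.

Lemma theta_h k w : gh M (theta k w) = theta k.+1 w
  + if k is k'.+1 then theta k' (phi (phi w) - k%:R ^+ 2 *: w) else theta 0 (phi w).
Proof.
rewrite -(raise_add_lower rel (theta k w) (wt0 k)); congr (_ + _).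
case: k => [|k]; first exact: iota_phi.
have n2 : (wt k)%:R + 2 != 0 :> rat by rewrite -wtS wt0.
have := lower_raise rel (wt0 k) (theta_weight k w) n2.
rewrite -wtS => ->; rewrite theta_casimir !(linE (theta k)).
have -> : (wt k)%:R = k%:R * 2 + 1 :> rat by rewrite /wt -muln2 mulrSr natrM.
have -> : k.+1%:R = k%:R + 1 :> rat by rewrite mulrSr.
by lmod rat M; field.
Qed.

Lemma theta_inj k w : theta k w = 0 -> w = 0.
Proof.
elim: k => [|k IHk] E; first by apply: iota_inj; rewrite (linear0 iota).
exact/IHk/(raise_inj rel nil (theta_weight k w)).
Qed.

Lemma theta_surj k v : weight (gJ M) (wt k)%:R v -> exists w, v = theta k w.
Proof.
elim: k v => [|k IHk] v wt_v; first exact/iota_image.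
have [u wt_u ->] := raise_surj rel nil wt_v.
by have [w ->] := IHk u wt_u; exists w.
Qed.

Definition reconstruct : {linear model W -> M} := model_ext theta.

Lemma reconstruct_hom : @is_gK_hom (model_gK II phiI) M reconstruct.
Proof.
apply: (@hom_from_hJ (model_gK II phiI) M reconstruct) => [v|v|].
- rewrite model_ghE; move: v.
  apply: (model_lin_eq (f := reconstruct \o model_h phi) (g := gh M \o reconstruct)) => k w.
  rewrite /= [model_h0 _ _](model_h_single phi k w) [LHS](linearD reconstruct).
  rewrite !model_ext_single theta_h; congr (_ + _).
  by case: k => [|k]; exact: model_ext_single.
- rewrite model_gJE; move: v.
  apply: (model_lin_eq (f := reconstruct \o model_J I) (g := gJ M \o reconstruct)) => k w.
  rewrite /= [model_J0 _ _](model_J_single I k w).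
  by rewrite [LHS]model_ext_single [in RHS]model_ext_single theta_J linearZ.
- exact: model_opp_one.
Qed.

Lemma reconstruct_inj : injective reconstruct.
Proof.
move=> f g Efg; apply/eqP; rewrite -subr_eq0; apply/eqP.
have {Efg} : reconstruct (f - g) = 0 by rewrite linearB Efg subrr.
move: (f - g) => {f g} f Ef; have [N fN] := model_finsupp f.
apply: model_eq => k; have [lt_k|/fN -> //] := ltnP k N.
have JJL : linear (fun x => gJ M (gJ M x)) by move=> r x y; rewrite !linearP.
have inj : injective (fun j : nat => - (wt j)%:R ^+ 2 : rat).
  move=> i j /= /oppr_inj /eqP; rewrite -!natrX Num.Theory.eqr_nat eqn_exp2r //.
  by rewrite /wt eqSS => /eqP /double_inj.
apply: (theta_inj (k := k)).
apply: (eigenvectors_independent (v := fun j => theta j (f j)) JJL inj _ _ lt_k) => [j|].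
  exact: theta_weight.
by rewrite -(model_ext0E theta fN).
Qed.

Lemma reconstruct_surj v : exists f, reconstruct f = v.
Proof.
have [N [a [-> wt_a]]] := odd_weights oppM v.
elim/big_ind: _ => [|u w [f <-] [g <-]|j _].
- by exists 0; rewrite linear0.
- by exists (f + g); rewrite linearD.
have [w ->] := theta_surj (wt_a j); exists (single j w).
exact: model_ext_single.
Qed.

End Reconstruction.

(** * The vectors of weight 1 *)

(** The character x - iy, which K has on the vectors of weight 1 over Q(i). *)
Definition weight_one_fun (A : comAlgType rat) (j : {lrmorphism Qi -> A}) (k : so2 A) : A :=
  k.1 - j sqrtm1 * k.2.

Lemma sqrtm1_image (A : comAlgType rat) (j : {lrmorphism Qi -> A}) :
  j sqrtm1 ^+ 2 = -1.
Proof. by rewrite expr2 -rmorphM sqrtm1_sqr rmorphN1. Qed.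

Definition weight_one_character : so2_character.
Proof.
refine (@SO2Character weight_one_fun _ _ _).
- by move=> A j; rewrite /weight_one_fun /= mulr0 subr0.
- move=> A j k l; rewrite /weight_one_fun /=.
  transitivity (k.1 * l.1 + (- 1) * (k.2 * l.2) - j sqrtm1 * (k.1 * l.2 + k.2 * l.1)).
    by ring.
  by rewrite -(sqrtm1_image j); ring.
- by move=> A B j phi k; rewrite /weight_one_fun /= rmorphB rmorphM.
Defined.

Section WeightOne.
Variable M : gK_module.

Lemma weight_one_isotypic (v : M) : weight (gJ M) 1 v ->
  isotypic weight_one_character (btens v 1 + sqrtm1 *: btens (gJ M v) (1 : Qi)).
Proof.
move=> wt_v A j k; have L := linP (kact_linear (g := M) k).
have wt_v' : weight (gJ M) 1 (gJ M v) := weightJ wt_v.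
rewrite base_change_mapD base_change_mapZ !base_change_map_btens1 !L.
rewrite (@rotates_weight M 1 v isT wt_v) (@rotates_weight M 1 (gJ M v) isT wt_v').
rewrite invr1 !scale1r wt_v so2_exp1 /= expr1n scaleN1r btensN.
rewrite /weight_one_fun; move: (sqrtm1_image j); set i := j sqrtm1 => i2.
transitivity (k.1 *: (btens v 1 + i *: btens (gJ M v) 1)
    - (i * k.2) *: btens v 1 + k.2 *: btens (gJ M v) 1).
  by lmod A (base_change M A); ring.
have -> : k.2 *: btens (gJ M v) 1 = (- i ^+ 2 * k.2) *: btens (gJ M v) 1.
  by rewrite i2 opprK mul1r.
by lmod A (base_change M A); ring.
Qed.

(** A vector v of weight 1 is the real part of v + i J v, which lies in the isotypic component
    of x - iy; this component is finite-dimensional over Q(i), hence over Q. *)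
Lemma weight_one_finite : admissible M -> finite_dimensional (weight (gJ M) 1).
Proof.
move=> /(_ weight_one_character) [n [s [_ span]]].
pose re (t : base_change M Qi) : M := @bc_functional M Qi (@Re rat) t.
have reD t u : re (t + u) = re t + re u := bc_functionalD Re_lin t u.
have reE m (a : Qi) : re (btens m a) = Re a *: m := bc_functionalE Re_lin m a.
have reZ (a : Qi) t : re (a *: t) = Re a *: re t + Im a *: re (sqrtm1 *: t).
  elim/tens_ind: t => [|t u Et Eu|m b].
  - have z : re 0 = 0 by apply: (addrI (re 0)); rewrite -reD !addr0.
    by rewrite !scaler0 z !scaler0 addr0.
  - by rewrite !scalerDr !reD Et Eu !(scalerDr (Re a)) !(scalerDr (Im a)) addrACA.
  rewrite -[ptens m b]/(btens m b) btensE !scalerA -!btensE !reE.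
  by case: a b => x y [z w]; rewrite /= scalerA scalerA -scalerDl; congr (_ *: _); ring.
pose t (i : 'I_(n + n)) : M :=
  match fintype.split i with inl j => re (s j) | inr j => re (sqrtm1 *: s j) end.
apply: (finite_dimensional_sub (s := t)) => [|a u v|v wt_v].
- by rewrite /weight !(linear0 (gJ M)) scaler0.
- by rewrite /weight !(linE (gJ M)) => -> ->; lmod rat M; ring.
have [c Ec] := span _ (weight_one_isotypic wt_v).
exists (fun i => match fintype.split i with inl j => Re (c j) | inr j => Im (c j) end).
transitivity (re (btens v 1 + sqrtm1 *: btens (gJ M v) 1)).
  by rewrite -btensE reD !reE /= scale1r scale0r addr0.
rewrite Ec big_split_ord /= -big_split /=.
have sumE (F : 'I_n -> base_change M Qi) : re (\sum_i F i) = \sum_i re (F i).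
  apply: big_morph => [|]; first exact: reD.
  by apply: (addrI (re 0)); rewrite -reD !addr0.
rewrite sumE; apply: eq_bigr => i _; rewrite reZ /t.
have El : fintype.split (lshift n i) = inl i by have := unsplitK (inl i : 'I_n + 'I_n).
have Er : fintype.split (rshift n i) = inr i by have := unsplitK (inr i : 'I_n + 'I_n).
by rewrite El Er.
Qed.

Definition weight_one_pred : pred M := fun v => gJ M (gJ M v) == - v.
Definition weight_one_qual := [qualify a v | weight_one_pred v].

Fact weight_one_submod_closed : submod_closed weight_one_qual.
Proof.
split=> [|a u v /eqP Eu /eqP Ev]; rewrite qualifE /weight_one_pred.
  by rewrite !(linear0 (gJ M)) oppr0.
by rewrite !(linE (gJ M)) Eu Ev scalerN opprD.
Qed.
HB.instance Definition _ :=
  GRing.isSubmodClosed.Build rat M weight_one_pred weight_one_submod_closed.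

Record weight_one := WeightOne { weight_one_val :> M; _ : weight_one_val \is a weight_one_qual }.
HB.instance Definition _ := [isSub for weight_one_val].
HB.instance Definition _ := [Choice of weight_one by <:].
HB.instance Definition _ := [SubChoice_isSubLmodule of weight_one by <:].

Lemma weight_oneP (u : weight_one) : weight (gJ M) 1 u.
Proof. by have /eqP E := valP u; rewrite /weight E expr1n scaleN1r. Qed.

Lemma weight_one_qualP v : weight (gJ M) 1 v -> v \is a weight_one_qual.
Proof. by rewrite /weight expr1n scaleN1r => E; apply/eqP. Qed.

Definition weight_one_J (u : weight_one) : weight_one :=
  WeightOne (weight_one_qualP (weightJ (weight_oneP u))).

(** On the vectors of weight 1 the operator -J is multiplication by i. *)
Definition weight_one_space : Type := weight_one.
HB.instance Definition _ := GRing.Zmodule.copy weight_one_space weight_one.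

Definition weight_one_scale (c : Qi) (u : weight_one_space) : weight_one_space :=
  Re c *: (u : weight_one) - Im c *: weight_one_J u.

Let scale_val c u : weight_one_val (weight_one_scale c u) =
  Re c *: weight_one_val u - Im c *: gJ M (weight_one_val u).
Proof. by []. Qed.

Lemma weight_one_eq (u v : weight_one_space) : weight_one_val u = weight_one_val v -> u = v.
Proof. exact: val_inj. Qed.

Let JJ (u : weight_one) : gJ M (gJ M (weight_one_val u)) = - weight_one_val u.
Proof. by rewrite (weight_oneP u) expr1n scaleN1r. Qed.

Fact weight_one_scaleA a b u :
  weight_one_scale a (weight_one_scale b u) = weight_one_scale (a * b) u.
Proof.
apply: weight_one_eq; rewrite !scale_val !(linE (gJ M)) JJ.
by case: a b => x y [z w] /=; lmod rat M; ring.
Qed.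

Fact weight_one_scale1 : left_id 1 weight_one_scale.
Proof. by move=> u; apply: weight_one_eq; rewrite scale_val /= scale1r scale0r subr0. Qed.

Fact weight_one_scaleDr : right_distributive weight_one_scale +%R.
Proof.
move=> a u v; apply: weight_one_eq.
rewrite -[RHS]/(weight_one_val (weight_one_scale a u) + weight_one_val (weight_one_scale a v)) !scale_val.
rewrite -[weight_one_val (u + v)]/(weight_one_val u + weight_one_val v) !(linE (gJ M)).
by lmod rat M; ring.
Qed.

Fact weight_one_scaleDl u : {morph weight_one_scale^~ u : a b / a + b}.
Proof.
move=> a b; apply: weight_one_eq.
rewrite -[RHS]/(weight_one_val (weight_one_scale a u) + weight_one_val (weight_one_scale b u)) !scale_val.
by case: a b => x y [z w] /=; lmod rat M; ring.
Qed.

HB.instance Definition _ := GRing.Zmodule_isLmodule.Build Qi weight_one_space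
  weight_one_scaleA weight_one_scale1 weight_one_scaleDr weight_one_scaleDl.

Lemma weight_one_scaleE (c : Qi) (u : weight_one_space) :
  weight_one_val (c *: u) = Re c *: (weight_one_val u) - Im c *: gJ M (weight_one_val u).
Proof. by []. Qed.

Lemma weight_one_spanned : admissible M -> exists n (s : 'I_n -> weight_one_space),
  forall u, exists c : 'I_n -> Qi, u = \sum_i c i *: s i.
Proof.
move=> /weight_one_finite [n [s [wt_s span]]].
exists n, (fun i => WeightOne (weight_one_qualP (wt_s i))) => u.
have [c Ec] := span u (weight_oneP u).
exists (fun i => Complex (c i) 0); apply: weight_one_eq; rewrite /= Ec.
have valD : {morph (fun u : weight_one_space => weight_one_val u) : x y / x + y >-> x + y} by [].
rewrite (big_morph _ valD (erefl : weight_one_val (0 : weight_one_space) = 0)).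
by apply: eq_bigr => i _; rewrite weight_one_scaleE /= scale0r subr0.
Qed.

End WeightOne.

Section Basis.
Variables (F : fieldType) (U : lmodType F).

(** As long as the vectors which span U satisfy a linear relation, one of them can be dropped. *)
Lemma coordinates n (s : 'I_n -> U) :
  (forall u, exists c : 'I_n -> F, u = \sum_i c i *: s i) ->
  exists (d : nat) (f : {linear 'rV[F]_d -> U}), injective f /\ forall u, exists v, f v = u.
Proof.
elim: n s => [|n IHn] s span; last first.
  have [[c [i0 [c0 Ec]]]|free] := pselect (exists c : 'I_n.+1 -> F, exists i0,
      c i0 != 0 /\ \sum_i c i *: s i = 0).
    apply: (IHn (fun i => s (lift i0 i))) => u; have [e ->] := span u.
    exists (fun i => e (lift i0 i) - e i0 / c i0 * c (lift i0 i)).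
    transitivity (\sum_i e i *: s i - (e i0 / c i0) *: \sum_i c i *: s i).
      by rewrite Ec scaler0 subr0.
    rewrite !(bigD1_ord i0) //= scalerDr scalerA divfK // opprD addrACA subrr add0r.
    by rewrite scaler_sumr -sumrB; apply: eq_bigr => i _; rewrite scalerBl scalerA.
  pose f (v : 'rV[F]_n.+1) := \sum_i v 0 i *: s i.
  have fL : linear f.
    move=> r u v; rewrite /f scaler_sumr -big_split; apply: eq_bigr => i _.
    by rewrite !mxE scalerDl scalerA.
  pose g : {linear 'rV[F]_n.+1 -> U} := HB.pack f (GRing.isLinear.Build F 'rV[F]_n.+1 U *:%R f fL).
  exists n.+1, g.
  split=> [u v /= E|u]; last first.
    have [c ->] := span u; exists (\row_i c i).
    by rewrite /= /f; apply: eq_bigr => i _; rewrite mxE.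
  apply/rowP => i; apply/eqP; rewrite -subr_eq0; apply: contrapT => /negP ne.
  apply: free; exists (fun j => u 0 j - v 0 j), i; split=> //.
  under eq_bigr do rewrite scalerBl.
  by rewrite sumrB; apply/eqP; rewrite subr_eq0; apply/eqP.
pose f (v : 'rV[F]_0) := (0 : U).
have fL : linear f by move=> r u v; rewrite /f scaler0 addr0.
pose g : {linear 'rV[F]_0 -> U} := HB.pack f (GRing.isLinear.Build F 'rV[F]_0 U *:%R f fL).
exists 0%N, g.
split=> [u v _|u]; first by rewrite [u]thinmx0 [v]thinmx0.
by exists 0; have [c ->] := span u; rewrite big_ord0.
Qed.

End Basis.

(** * Representations of the species as semilinear maps *)

Definition restriction (W : lmodType Qi) : Type := W.

Section Restriction.
Variable W : lmodType Qi.

HB.instance Definition _ := GRing.Zmodule.copy (restriction W) W.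

Definition restriction_scale (r : rat) (w : restriction W) : restriction W :=
  (r%:A : Qi) *: (w : W).

Fact restriction_scaleA a b w :
  restriction_scale a (restriction_scale b w) = restriction_scale (a * b) w.
Proof. by rewrite /restriction_scale scalerA mulr_algl scalerA. Qed.
Fact restriction_scale1 : left_id 1 restriction_scale.
Proof. by move=> w; rewrite /restriction_scale !scale1r. Qed.
Fact restriction_scaleDr : right_distributive restriction_scale +%R.
Proof. by move=> a u v; exact: scalerDr. Qed.
Fact restriction_scaleDl w : {morph restriction_scale^~ w : a b / a + b}.
Proof. by move=> a b; rewrite /restriction_scale !scalerDl. Qed.
HB.instance Definition _ := GRing.Zmodule_isLmodule.Build rat (restriction W)
  restriction_scaleA restriction_scale1 restriction_scaleDr restriction_scaleDl.

Lemma restrictionZ (r : rat) (w : restriction W) : r *: w = (r%:A : Qi) *: (w : W).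
Proof. by []. Qed.

Definition mul_i0 (w : restriction W) : restriction W := sqrtm1 *: (w : W).
Fact mul_i_linear : linear mul_i0.
Proof.
by move=> r u v; rewrite /mul_i0 !restrictionZ; lmod Qi W; ring.
Qed.
HB.instance Definition _ :=
  GRing.isLinear.Build rat (restriction W) (restriction W) *:%R mul_i0 mul_i_linear.
Definition mul_i : {linear restriction W -> restriction W} := mul_i0.

Lemma mul_iK w : mul_i (mul_i w) = - w.
Proof. by rewrite /= /mul_i0 scalerA sqrtm1_sqr scaleN1r. Qed.

(** Rational combinations of w and i w are enough to express the scalars of Q(i). *)
Lemma scale_Qi (c : Qi) (w : W) :
  c *: w = Re c *: (w : restriction W) + Im c *: mul_i (w : restriction W) :> W.
Proof.
rewrite !restrictionZ /= /mul_i0; lmod Qi W; rewrite !mulr1.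
by case: c => x y; apply/eqP; rewrite eq_complex /=; apply/andP; split; apply/eqP; ring.
Qed.
End Restriction.

Section SemilinearMap.
Variable W : species_rep F_twisted.

Definition twisted_one : F_twisted := (1 : Qi).

(** Every pure tensor is a multiple of some w (x) 1, so these values determine the structure
    map; the right action on F^twisted makes them semilinear in w. *)
Definition twist_map0 (w : restriction W) : restriction W :=
  rep_map W (ptens (w : W) twisted_one).

Lemma rep_map_ptens (w : W) (b : F_twisted) :
  rep_map W (ptens w b) = (conjc (b : Qi) : Qi) *: twist_map0 w :> W.
Proof.
rewrite /twist_map0 -linearZ ptensZ; congr (rep_map W (ptens w _)).
by rewrite [RHS]mul1r; case: (b : Qi) => x y; rewrite /= opprK.
Qed.

Lemma twist_map0Z (c : Qi) (w : W) :
  twist_map0 (c *: w) = (conjc c : Qi) *: twist_map0 w :> W.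
Proof.
transitivity (rep_map W (ptens w (lact c twisted_one : F_twisted))).
  by congr (rep_map W _); exact: ptens_bal.
apply: etrans (rep_map_ptens w _) _.
by congr ((conjc _ : Qi) *: _); exact: (mulr1 (c : Qi)).
Qed.

Lemma twist_map0D (u v : W) : twist_map0 (u + v) = twist_map0 u + twist_map0 v :> W.
Proof. by rewrite /twist_map0 ptensDl linearD. Qed.

Lemma conjc_alg (r : rat) : conjc (r%:A : Qi) = r%:A :> Qi.
Proof. by rewrite /GRing.scale /= mulr0 oppr0. Qed.

Fact twist_map_linear : linear twist_map0.
Proof.
by move=> r u v; rewrite !restrictionZ [LHS]twist_map0D twist_map0Z conjc_alg.
Qed.
HB.instance Definition _ := GRing.isLinear.Build rat (restriction W) (restriction W) *:%R
  twist_map0 twist_map_linear.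
Definition twist_map : {linear restriction W -> restriction W} := twist_map0.

Lemma twist_mapI w : twist_map (mul_i W w) = - mul_i W (twist_map w).
Proof.
rewrite [LHS](twist_map0Z sqrtm1 w) (_ : conjc sqrtm1 = - sqrtm1 :> Qi); last exact/eqP.
by rewrite scaleNr.
Qed.

Fact rep_iter_linear n : linear (@rep_iter _ F_twisted W n).
Proof.
elim: n => [|n IHn] //= c t u.
pose g : {linear tens_power F_twisted W n -> W} :=
  HB.pack (@rep_iter _ F_twisted W n)
    (GRing.isLinear.Build Qi (tens_power F_twisted W n) W *:%R _ IHn).
have E x : tens_map F_twisted (@rep_iter _ F_twisted W n) x = tens_map F_twisted g x by [].
rewrite !E tens_mapD linearD -linearZ; congr (rep_map W _ + _).
elim/tens_ind: t => [|x y Ex Ey|m b]; first by rewrite scaler0 !tens_map0 scaler0.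
- by rewrite scalerDr !tens_mapD Ex Ey scalerDr.
- by rewrite ptensZ !tens_mapE ptensZ.
Qed.

Lemma rep_iterS n (t : tens_power F_twisted W n) (b : F_twisted) :
  @rep_iter _ F_twisted W n.+1 (ptens t b) = rep_map W (ptens (rep_iter t) b).
Proof.
pose g : {linear tens_power F_twisted W n -> W} :=
  HB.pack (@rep_iter _ F_twisted W n)
    (GRing.isLinear.Build Qi (tens_power F_twisted W n) W *:%R _ (@rep_iter_linear n)).
by congr (rep_map W _); exact: (@tens_mapE _ _ F_twisted _ _ g t b).
Qed.

(** The n-fold iterate is phi^n on pure tensors of w with ones, and its values are values of phi^n. *)
Lemma nilpotent_repE : nilpotent_rep W <-> exists n, forall w, iter n twist_map w = 0.
Proof.
split=> [[n _ z]|[n z]].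
  exists n => w.
  pose fix pure m : tens_power F_twisted W m :=
    if m is m'.+1 then ptens (pure m') twisted_one else (w : W).
  rewrite -[RHS](z (pure n)); elim: n {z} => // n IHn.
  by rewrite iterS IHn [RHS]rep_iterS.
exists n.+1 => // t.
have [w ->] : exists w, @rep_iter _ F_twisted W n.+1 t = iter n.+1 twist_map w.
  elim: n.+1 t => [|m IHm] t; first by exists t.
  elim/tens_ind: t => [|t u [w Ew] [w' Ew']|t b].
  - exists 0; rewrite (linP (@rep_iter_linear m.+1)).
    by elim: (m.+1) => //= k <-; rewrite linear0.
  - exists (w + w'); rewrite (linP (@rep_iter_linear m.+1)) Ew Ew'.
    by elim: (m.+1) {Ew Ew'} => //= k <-; rewrite linearD.
  have [w Ew] := IHm t.
  have scal k (c : Qi) : exists c' : Qi, forall v : W,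
      c *: (iter k twist_map v : W) = iter k twist_map (c' *: v).
    elim: k c => [|k IHk] c; first by exists c.
    have [c' Ec'] := IHk (conjc c); exists c' => v.
    rewrite [RHS]iterS -Ec' [RHS]twist_map0Z; congr ((_ : Qi) *: _).
    by case: c {Ec'} => x y; rewrite /= opprK.
  have [c' Ec'] := scal m.+1 (conjc (b : Qi)).
  exists (c' *: (w : W)); rewrite [LHS]rep_iterS rep_map_ptens Ew -Ec'.
  by [].
by rewrite iterS z linear0.
Qed.

End SemilinearMap.

(** * The equivalence *)

(** The inverse functor chooses a preimage of each object up to isomorphism. *)
Section Equivalence.
Variables (C D : category) (F : functor D C).
Hypotheses
  (full : forall (a b : D) (g : Defs.hom (F a) (F b)), exists f, fmor F f = g)
  (faithful : forall (a b : D) (f f' : Defs.hom a b), fmor F f = fmor F f' -> f = f')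
  (surj : forall c : C, exists (a : D) (i : Defs.hom (F a) c), is_iso i).

Let ob c : D := projT1 (cid (surj c)).
Let io c : Defs.hom (F (ob c)) c := projT1 (cid (projT2 (cid (surj c)))).
Let io_iso c : is_iso (io c) := projT2 (cid (projT2 (cid (surj c)))).
Let ji c : Defs.hom c (F (ob c)) := projT1 (cid (io_iso c)).
Let jiP c : cmp (ji c) (io c) = idm _ /\ cmp (io c) (ji c) = idm _ :=
  projT2 (cid (io_iso c)).
Let pre (a b : D) (g : Defs.hom (F a) (F b)) : Defs.hom a b := projT1 (cid (full g)).
Let preP (a b : D) (g : Defs.hom (F a) (F b)) : fmor F (pre g) = g := projT2 (cid (full g)).

Let gmor (a b : C) (f : Defs.hom a b) : Defs.hom (ob a) (ob b) := pre (cmp (ji b) (cmp f (io a))).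

Let gmor1 a : gmor (idm a) = idm (ob a).
Proof.
by apply: faithful; rewrite preP fmor1 cmp1m; case: (jiP a).
Qed.

Let gmorM (a b c : C) (g : Defs.hom b c) (f : Defs.hom a b) : gmor (cmp g f) = cmp (gmor g) (gmor f).
Proof.
apply: faithful; rewrite fmorM !preP -!cmpA; congr cmp; congr cmp.
by rewrite !cmpA; have [_ ->] := jiP b; rewrite cmp1m.
Qed.

Let G : functor C D := Functor gmor1 gmorM.

Let pre_iso (a b : D) (g : Defs.hom (F a) (F b)) : is_iso g -> is_iso (pre g).
Proof.
by move=> [k [kg gk]]; exists (pre k); split; apply: faithful;
  rewrite fmorM !preP fmor1.
Qed.

Lemma equivalence_of_full_faithful_surjective : equivalent_categories C D.
Proof.
exists G, F; split.
  exists io; split=> [c|a b f]; first exact: io_iso.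
  by rewrite /= preP !cmpA; have [_ ->] := jiP b; rewrite cmp1m.
exists (fun d => pre (io (F d))); split=> [d|a b f]; first exact/pre_iso/io_iso.
apply: faithful; rewrite !fmorM !preP /= !cmpA.
by have [_ ->] := jiP (F b); rewrite cmp1m.
Qed.

End Equivalence.

Lemma vectType_restriction_finite (W : vectType Qi) : exists n (s : 'I_n -> restriction W),
  forall w, exists c : 'I_n -> rat, w = \sum_i c i *: s i.
Proof.
pose d := \dim {: W}; pose b (i : 'I_d) : W := (vbasis {: W})`_i.
exists (d + d)%N, (fun i => match fintype.split i with inl j => b j | inr j => mul_i W (b j) end).
move=> w; pose c i := coord (vbasis {: W}) i w.
exists (fun i => match fintype.split i with inl j => Re (c j) | inr j => Im (c j) end).
have E : w = \sum_(i < d) c i *: b i :> W by exact: coord_vbasis (memvf _).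
rewrite {1}E big_split_ord /= -big_split /=; apply: eq_bigr => i _.
have El : fintype.split (lshift d i) = inl i by have := unsplitK (inl i : 'I_d + 'I_d).
have Er : fintype.split (rshift d i) = inr i by have := unsplitK (inr i : 'I_d + 'I_d).
by rewrite El Er; exact: scale_Qi.
Qed.

Section Functor.

Definition rep_gK (W : species_rep F_twisted) : gK_module :=
  model_gK (@mul_iK W) (@twist_mapI W).

Lemma rep_gK_HC0 (W : species_rep F_twisted) : nilpotent_rep W -> in_HC0 (rep_gK W).
Proof.
move=> /nilpotent_repE nil; have fin := vectType_restriction_finite W.
split.
- exact: model_finitely_generated.
- exact: model_admissible.
- exact: model_C_nilpotent.
- exact: model_opp_one.
Qed.

Definition functor_obj (W : Rep_nil_S_Gamma) : HC0 := exist _ _ (rep_gK_HC0 (projT2 W)).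

Section OnMorphisms.
Variables (V W : species_rep F_twisted).

Lemma rep_hom_semilinear (f : rep_hom V W) v :
  f (twist_map V v) = twist_map W (f v).
Proof. by have := rep_funP f (ptens (v : V) twisted_one); rewrite tens_mapE. Qed.

Variable f : rep_hom V W.

Definition rational0 (v : restriction V) : restriction W := f v.
Fact rational_linear : linear rational0.
Proof. by move=> r u v; rewrite /rational0 !restrictionZ linearP. Qed.
HB.instance Definition _ := GRing.isLinear.Build rat (restriction V) (restriction W) *:%R
  rational0 rational_linear.

Definition rational : {linear restriction V -> restriction W} := rational0.

Definition model_map : {linear model (restriction V) -> model (restriction W)} :=
  model_ext (fun k => single k \o rational).

Lemma model_map_single k v : model_map (single k v) = single k (rational v).
Proof. exact: model_ext_single. Qed.

Lemma model_map_hom : @is_gK_hom (rep_gK V) (rep_gK W) model_map.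
Proof.
apply: (@hom_from_hJ (rep_gK V) (rep_gK W) model_map) => [v|v|].
- rewrite !model_ghE; move: v.
  apply: (model_lin_eq (f := model_map \o model_h (twist_map V))
    (g := model_h (twist_map W) \o model_map)) => k v.
  rewrite /= [model_h0 _ _](model_h_single (twist_map V) k v) [LHS](linearD model_map).
  rewrite !model_map_single [RHS](model_h_single (twist_map W)); congr (_ + _).
  case: k => [|k]; rewrite model_map_single; congr single0.
    exact: rep_hom_semilinear.
  rewrite -[LHS]/(rational _) linearB linearZ; congr (_ - _).
  by rewrite [LHS]rep_hom_semilinear [f (twist_map0 _)]rep_hom_semilinear.
- rewrite !model_gJE; move: v.
  apply: (model_lin_eq (f := model_map \o model_J (mul_i V))
    (g := model_J (mul_i W) \o model_map)) => k v.
  rewrite /= [model_J0 _ _](model_J_single (mul_i V) k v) [LHS]model_map_single.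
  rewrite model_map_single [RHS](model_J_single (mul_i W)); congr single0.
  rewrite -[LHS]/(rational _) linearZ; congr (_ *: _).
  exact: (linE f).2 sqrtm1 (v : V).
- exact: model_opp_one.
Qed.

Definition rep_gK_map : gK_hom (rep_gK V) (rep_gK W) := GKHom model_map_hom.

End OnMorphisms.

Lemma rep_gK_map_single V W (f : rep_hom V W) k v :
  rep_gK_map f (single k v) = single k (f v : restriction W).
Proof. exact: model_map_single. Qed.

Lemma rep_gK_map1 V : rep_gK_map (rep_id V) = gK_id (rep_gK V).
Proof.
apply: gK_hom_ext; apply: (model_lin_eq (g := idfun)) => k v.
exact: rep_gK_map_single.
Qed.

Lemma rep_gK_mapM U V W (g : rep_hom V W) (f : rep_hom U V) :
  rep_gK_map (rep_comp g f) = gK_comp (rep_gK_map g) (rep_gK_map f).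
Proof.
apply: gK_hom_ext.
apply: (model_lin_eq (g := model_map g \o model_map f)) => k v.
by rewrite [LHS]rep_gK_map_single /= !model_map_single.
Qed.

Definition rep_functor : functor Rep_nil_S_Gamma HC0 :=
  @Functor Rep_nil_S_Gamma HC0 functor_obj (fun V W f => rep_gK_map f)
    (fun V => rep_gK_map1 (sval V)) (fun U V W g f => rep_gK_mapM g f).

Lemma rep_functor_faithful (V W : species_rep F_twisted) (f g : rep_hom V W) :
  rep_gK_map f = rep_gK_map g -> f = g.
Proof.
move=> E; apply: rep_hom_ext => v.
have : rep_gK_map f (single 0 (v : restriction V)) = rep_gK_map g (single 0 (v : restriction V)).
  by rewrite E.
by rewrite !rep_gK_map_single => /(congr1 (fun m : model (restriction W) => m 0%N)).
Qed.

Section Full.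
Variables (V W : species_rep F_twisted) (T : gK_hom (rep_gK V) (rep_gK W)).

Let T0 : {linear model (restriction V) -> model (restriction W)} := T.
Let t k (v : restriction V) : restriction W := T0 (single k v) k.

Let T_J m : T0 (model_J (mul_i V) m) = model_J (mul_i W) (T0 m).
Proof.
have E (U : species_rep F_twisted) := @model_gJE (restriction U) _ _ (@mul_iK U) (@twist_mapI U).
by rewrite -[model_J (mul_i V) m]E -[RHS]E; exact: ((gK_funP T).1 sl2_J m).
Qed.
Let T_h m : T0 (model_h (twist_map V) m) = model_h (twist_map W) (T0 m).
Proof.
have E (U : species_rep F_twisted) := @model_ghE (restriction U) _ _ (@mul_iK U) (@twist_mapI U).
by rewrite -[model_h (twist_map V) m]E -[RHS]E; exact: ((gK_funP T).1 (mk_sl2 1 0 0) m).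
Qed.

(* T commutes with J, so it preserves weights. *)
Let T_single k v : T0 (single k v) = single k (t k v).
Proof.
have /(model_weightE (@mul_iK W)) z : weight (model_J (mul_i W)) (wt k)%:R (T0 (single k v)).
  by rewrite /weight -!T_J single_weight ?linearZ //; exact: mul_iK.
by apply: model_eq => j /=; case: eqP => [->|/eqP /z].
Qed.

Let t_linear k : linear (t k).
Proof. by move=> r u v; rewrite /t !linearP. Qed.

Let tI k v : t k (mul_i V v) = mul_i W (t k v).
Proof.
have := T_J (single k v); rewrite !T_single !model_J_single T_single.
move/(congr1 (fun m : model (restriction W) => m k)); rewrite /= eqxx (linP (t_linear k)).
have n0 : - (wt k)%:R != 0 :> rat by rewrite oppr_eq0 wt0.
by move=> E; exact: (@scalerI rat (restriction W) _ n0 (t k (mul_i V v)) (mul_i W (t k v)) E).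
Qed.

(* Compare the raised parts of T (h v) and h (T v). *)
Let t_step k v : t k.+1 v = t k v.
Proof.
have := T_h (single k v); rewrite !T_single !model_h_single (linE T0) T_single.
move/(congr1 (fun m : model (restriction W) => m k.+1)).
have D (u w : model (restriction W)) i : (u + w) i = u i + w i by [].
have at_ j i (w : restriction W) : single j w i = if i == j then w else 0 by [].
by rewrite !D; case: k => [|k]; rewrite T_single !at_ !eqxx ?(@gtn_eqF k) // !addr0.
Qed.

Let t_eq k v : t k v = t 0 v.
Proof. by elim: k => // k <-; exact: t_step. Qed.

(* Compare the components of index 0, where h acts by phi. *)
Let t_phi v : t 0 (twist_map V v) = twist_map W (t 0 v).
Proof.
have := T_h (single 0 v); rewrite !T_single !model_h_single (linE T0) !T_single.
move/(congr1 (fun m : model (restriction W) => m 0%N)).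
have D (u w : model (restriction W)) i : (u + w) i = u i + w i by [].
have at_ j i (w : restriction W) : single j w i = if i == j then w else 0 by [].
by rewrite !D !at_ !add0r.
Qed.

Let t0 (v : V) : W := t 0 v.

Let t0_linear : linear t0.
Proof.
move=> c u v; rewrite (scale_Qi c u) (scale_Qi c (t0 u)).
have L := linP (t_linear 0).
by rewrite [LHS]L [t 0 _]L !L tI.
Qed.

Let t0L : {linear V -> W} := HB.pack t0 (GRing.isLinear.Build Qi V W *:%R t0 t0_linear).

Let t0_hom : is_rep_hom t0L.
Proof.
elim/tens_ind => [|x y Ex Ey|v b].
- by rewrite !(linear0, tens_map0).
- by rewrite !(linearD, tens_mapD) Ex Ey.
rewrite tens_mapE !rep_map_ptens linearZ; congr (_ *: _).
exact: t_phi.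
Qed.

Lemma rep_functor_full : exists f : rep_hom V W, rep_gK_map f = T.
Proof.
exists (RepHom t0_hom); apply: gK_hom_ext.
apply: (model_lin_eq (g := T0)) => k v.
by rewrite [LHS]rep_gK_map_single T_single t_eq.
Qed.

End Full.
End Functor.

(** The representation attached to M lives on coordinates f of its space of vectors of weight
    1, with psi = lower 1 as the semilinear map. *)
Section EssentiallySurjective.
Variables (M : gK_module) (n0 : nat).
Hypothesis nil : forall v : M, iter n0 (casimir (gh M) (gq M) (gJ M)) v = 0.
Hypothesis oppM : opp_one_acts_by_opp M.
Variables (d : nat) (f : {linear 'rV[Qi]_d -> weight_one_space M}).
Hypotheses (f_inj : injective f) (f_surj : forall u, exists w, f w = u).

Let rel := gK_relations M.
Local Notation Y := (lower (gh M) (gq M) (gJ M) 1).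

Let Y_weight v : weight (gJ M) 1 v -> weight (gJ M) 1 (Y v).
Proof.
move=> wt_v; have := weight_lower rel (oner_neq0 _) wt_v.
by rewrite /weight (_ : (1 - 2) ^+ 2 = 1 ^+ 2 :> rat) //; apply/eqP.
Qed.

Let YD : linear Y.
Proof.
by move=> r u v; rewrite /lower !(linE (gh M), linE (gq M), linE (gJ M)); lmod rat M; ring.
Qed.

Let YJ v : weight (gJ M) 1 v -> Y (gJ M v) = - gJ M (Y v).
Proof.
move=> wt_v; rewrite (lowerJ rel (oner_neq0 _) wt_v) divr1.
by rewrite (_ : 1 - 2 = -1 :> rat) ?scaleN1r ?opprK //; apply/eqP.
Qed.

Let lower_space (u : weight_one_space M) : weight_one_space M :=
  WeightOne (weight_one_qualP (Y_weight (weight_oneP u))).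

Let psi (w : 'rV[Qi]_d) : 'rV[Qi]_d := projT1 (cid (f_surj (lower_space (f w)))).
Let psiP w : f (psi w) = lower_space (f w) := projT2 (cid (f_surj (lower_space (f w)))).

Let psi_val w : weight_one_val (f (psi w)) = Y (weight_one_val (f w)).
Proof. by rewrite psiP. Qed.

Let valD (u v : weight_one_space M) :
  weight_one_val (u + v) = weight_one_val u + weight_one_val v.
Proof. by []. Qed.

Let psiD u v : psi (u + v) = psi u + psi v.
Proof.
apply: f_inj; apply: weight_one_eq; rewrite psi_val !linearD !valD.
by rewrite (linP YD) !psi_val.
Qed.

Let psiZ c w : psi (c *: w) = (conjc c : Qi) *: psi w.
Proof.
apply: f_inj; apply: weight_one_eq; rewrite psi_val !linearZ !weight_one_scaleE psi_val.
rewrite !(linP YD) YJ; last exact: weight_oneP.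
by case: c => x y /=; lmod rat M; ring.
Qed.

Let beta (w : 'rV[Qi]_d) (b : F_twisted) : 'rV[Qi]_d := (conjc (b : Qi) : Qi) *: psi w.

Let conjD (a b : Qi) : conjc (a + b) = conjc a + conjc b :> Qi.
Proof. by case: a b => x y [z w]; apply/eqP; rewrite eq_complex /= opprD !eqxx. Qed.
Let conjM (a b : Qi) : conjc (a * b) = conjc a * conjc b :> Qi.
Proof.
by case: a b => x y [z w]; apply/eqP; rewrite eq_complex /=; apply/andP; split; apply/eqP; ring.
Qed.
Let conjK (a : Qi) : conjc (conjc a) = a :> Qi.
Proof. by case: a => x y; rewrite /= opprK. Qed.

Let beta_bal : balanced beta.
Proof.
split=> [w w' b|w b b'|r w b]; rewrite /beta.
- by rewrite psiD scalerDr.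
- by rewrite -scalerDl; congr (_ *: _); exact: conjD.
- by rewrite psiZ scalerA; congr (_ *: _); rewrite [RHS]conjM mulrC.
Qed.

Let rep_lift (t : tens 'rV[Qi]_d F_twisted) : 'rV[Qi]_d := tens_lift beta t.

Let rep_lift_linear : linear rep_lift.
Proof.
move=> c t u; rewrite /rep_lift tens_liftD //; congr (_ + _).
have z : tens_lift beta 0 = 0 by apply: (addrI (tens_lift beta 0)); rewrite -tens_liftD // !addr0.
elim/tens_ind: t => [|x y Ex Ey|w b]; first by rewrite scaler0 z scaler0.
- by rewrite scalerDr !tens_liftD // Ex Ey scalerDr.
rewrite ptensZ !tens_liftE // /beta scalerA; congr (_ *: _).
by rewrite [LHS]conjM conjK mulrC.
Qed.

Let rep_liftL : {linear tens 'rV[Qi]_d F_twisted -> 'rV[Qi]_d} :=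
  HB.pack rep_lift (GRing.isLinear.Build Qi (tens 'rV[Qi]_d F_twisted) 'rV[Qi]_d *:%R
    rep_lift rep_lift_linear).

Definition weight_one_rep : species_rep F_twisted := @SpeciesRep Qi F_twisted 'rV[Qi]_d rep_liftL.

Let W : lmodType rat := restriction weight_one_rep.

Let phiE w : twist_map weight_one_rep w = psi w.
Proof.
rewrite [LHS]/(rep_lift (ptens (w : 'rV[Qi]_d) twisted_one)) /rep_lift tens_liftE // /beta.
by rewrite (_ : conjc twisted_one = 1 :> Qi) ?scale1r //; apply/eqP.
Qed.

Let iota0 (w : W) : M := weight_one_val (f w).
Let iota_linear : linear iota0.
Proof.
move=> r u v; rewrite /iota0 restrictionZ linearD linearZ valD weight_one_scaleE.
have -> : Re (r%:A : Qi) = r by rewrite /GRing.scale /= mulr1.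
have -> : Im (r%:A : Qi) = 0 by rewrite /GRing.scale /= mulr0.
by rewrite scale0r subr0.
Qed.
Let iota : {linear W -> M} := HB.pack iota0 (GRing.isLinear.Build rat W M *:%R iota0 iota_linear).

Let iota_inj : injective iota.
Proof. by move=> u v E; apply: f_inj; exact: weight_one_eq. Qed.

Let iota_image (v : M) : weight (gJ M) 1 v <-> exists w, v = iota w.
Proof.
split=> [wt_v|[w ->]]; last exact: weight_oneP.
by have [w Ew] := f_surj (WeightOne (weight_one_qualP wt_v)); exists w; rewrite /= /iota0 Ew.
Qed.

Let iotaI w : gJ M (iota w) = - iota (mul_i weight_one_rep w).
Proof.
have -> : iota (mul_i weight_one_rep w) = weight_one_val (f (sqrtm1 *: (w : 'rV[Qi]_d))) by [].
by rewrite (linE f) weight_one_scaleE /= scale0r sub0r opprK scale1r.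
Qed.

Let iota_phi w : Y (iota w) = iota (twist_map weight_one_rep w).
Proof. by rewrite phiE [RHS]psi_val. Qed.

Lemma weight_one_rep_nilpotent : nilpotent_rep weight_one_rep.
Proof.
apply/nilpotent_repE; exists (n0 + n0)%N => w.
have E k u : iter k (casimir (gh M) (gq M) (gJ M)) (iota u)
    = 4 ^+ k *: iota (iter (k + k) (twist_map weight_one_rep) u).
  elim: k => [|k IHk]; first by rewrite scale1r.
  rewrite iterS IHk (linP (casimir_linear _ _ _)).
  have -> : casimir (gh M) (gq M) (gJ M) (iota (iter (k + k) (twist_map weight_one_rep) u))
      = iota (4 *: iter (k + k).+2 (twist_map weight_one_rep) u).
    exact: (theta_casimir iota_image iota_phi 0).
  by rewrite addSn addnS linearZ scalerA exprSr.
have := E n0 w; rewrite nil => /esym/eqP; rewrite scaler_eq0 expf_eq0 andbF /= => /eqP z.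
by apply: iota_inj; exact: (etrans z (esym (linear0 iota))).
Qed.

Lemma rep_functor_surj : exists i : gK_hom (rep_gK weight_one_rep) M, @is_iso gK_Mod _ _ i.
Proof.
have P := reconstruct_hom (@mul_iK weight_one_rep) (@twist_mapI weight_one_rep)
  iota_image iotaI iota_phi.
exists (GKHom P); apply: bijective_is_iso => [|v].
- exact: (reconstruct_inj nil iota_inj iota_image).
- exact: (reconstruct_surj nil oppM iota_image v).
Qed.

End EssentiallySurjective.

Theorem corollary5p5 : equivalent_categories HC0 Rep_nil_S_Gamma.
Proof.
apply: (equivalence_of_full_faithful_surjective (F := rep_functor)).
- by move=> V W g; exact: rep_functor_full.
- by move=> V W f g; exact: rep_functor_faithful.
move=> [M [fg adm nilM oppM]].
have [n0 nil] := (C_nilpotentE M).1 nilM.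
have [n [s span]] := weight_one_spanned adm.
have [d [f [f_inj f_surj]]] := coordinates span.
have nilW := weight_one_rep_nilpotent nil f_inj f_surj.
have [i iso_i] := rep_functor_surj nil oppM f_inj f_surj.
exists (exist _ (weight_one_rep f_inj f_surj) nilW), i.
by case: iso_i => g gP; exists g.
Qed.
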